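(* Any Harish-Chandra module of the intermediate series over the twisted Heisenberg-Virasoro algebra $\mathcal L$ is isomorphic to one of the modules $\mathcal A_{a,b,c}$, $\mathcal A(a,d)$, $\mathcal B(a,d)$, $\mathcal U_d$, $\mathcal V_d$, $\tilde{\mathcal U}_d$, $\tilde{\mathcal V}_c$ defined in the context (if they are irreducible), or to one of their nontrivial simple subquotients, for appropriate $a,b,c,d\in\mathbb C$.
   Context: The twisted Heisenberg-Virasoro algebra $\mathcal L$ is the complex Lie algebra with basis $\{L(m),I(m),C_L,C_I,C_{LI}: m\in\mathbb Z\}$ and brackets, for $m,n\in\mathbb Z$, $$[L(m),L(n)]=(n-m)L(m+n)+\delta_{m+n,0}\tfrac1{12}(m^3-m)C_L,$$ $$[I(m),I(n)]=n\,\delta_{m+n,0}C_I,$$ $$[L(m),I(n)]=n\,I(m+n)+\delta_{m+n,0}(m^2-m)C_{LI},$$ with $C_L,C_I,C_{LI}$ central. A Harish-Chandra module over $\mathcal L$ is an indecomposable weight module $V=\bigoplus V^\lambda$, where $V^\lambda=\{v\in V\mid L(0)v=(\lambda+a)v\}$ for some $a\in\mathbb C$, such that each $V^\lambda$ is finite-dimensional. A nontrivial Harish-Chandra module is said to be of the intermediate series if each of its weight spaces $V^\lambda$ is at most one-dimensional. The following are $\mathcal L$-modules with basis $\{v_t\}_{t\in\mathbb Z}$, on which $C_L,C_I,C_{LI}$ act as $0$ (formulas for all $n,t\in\mathbb Z$ subject to the indicated conditions): (1) $\mathcal A_{a,b,c}$ ($a,b,c\in\mathbb C$): $L(n)v_t=(a+t+bn)v_{n+t}$,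 $I(n)v_t=c\,v_{n+t}$. (2) $\mathcal A(a,d)$ ($a,d\in\mathbb C$): $L(n)v_t=(t+n)v_{n+t}$ if $t\ne0$, $L(n)v_0=n(n+a)v_n$; $I(n)v_t=0$ if $t\ne0$, $I(n)v_0=dn\,v_n$. (3) $\mathcal B(a,d)$ ($a,d\in\mathbb C$): $L(n)v_t=t\,v_{n+t}$ if $t\ne-n$, $L(n)v_{-n}=-n(n+a)v_0$; $I(n)v_t=0$ if $n+t\ne0$, $I(n)v_{-n}=dn\,v_0$. (4) $\mathcal U_d$ ($d\in\mathbb C$): $L(n)v_t=t\,v_{n+t}$; $I(n)v_t=0$ if $n+t\neq0$, $I(n)v_{-n}=nd\,v_0$. (5) $\mathcal V_d$ ($d\in\mathbb C$): $L(n)v_t=(t+n)v_{n+t}$; $I(n)v_t=0$ if $t\ne0$, $I(n)v_0=nd\,v_n$. (6) $\tilde{\mathcal U}_d$ ($d\in\mathbb C$, $d\neq0$): $L(n)v_t=t\,v_{n+t}$ if $n+t\ne0$, $L(n)v_{-n}=0$; $I(n)v_t=0$ if $n+t\ne0$, $I(n)v_{-n}=dn\,v_0$. (7) $\tilde{\mathcal V}_c$ ($c\in\mathbb C$, $c\ne0$): $L(n)v_t=t\,v_{n+t}$ if $n+t\ne0$, $L(n)v_{-n}=0$; $I(n)v_t=0$ if $t\ne0$ or $n=t=0$, $I(n)v_0=c\,v_n$ if $n\ne0$.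
   Formalization: ''(if they are irreducible)'' taken literally fails for the reducible indecomposable A_{0,0,0}; proved instead: every V is isomorphic to a listed module (irreducible or not) or to a nontrivial simple subquotient, and the literal claim holds when V is simple. *)

(* Defs.v *)
From HB Require Import structures.
From mathcomp Require Import all_boot all_order all_algebra.
From mathcomp Require Import boolp classical_sets reals complex finmap.
From mathcomp.multinomials Require Import monalg.
From mathcomp Require Import zify ring.

Set Implicit Arguments.
Unset Strict Implicit.
Unset Printing Implicit Defensive.

Import GRing.Theory.
Local Open Scope classical_set_scope.
Local Open Scope ring_scope.

(** * Lie algebras and their modules *)

HB.mixin Record isLieAlgebra (F : fieldType) L of GRing.Lmodule F L := {
  lie : L -> L -> L;
  lie_linearl : forall y, linear (lie^~ y);
  lie_linearr : forall x, linear (lie x);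
  liexx : forall x, lie x x = 0;
  lie_jacobi : forall x y z,
    lie x (lie y z) + lie y (lie z x) + lie z (lie x y) = 0
}.

#[short(type="lieAlgType")]
HB.structure Definition LieAlgebra (F : fieldType) :=
  { L of GRing.Lmodule F L & isLieAlgebra F L }.

Record lieModule (F : fieldType) (g : lieAlgType F) := LieModule {
  lm_sort :> lmodType F;
  act : g -> lm_sort -> lm_sort;
  act_linearl : forall v, linear (act^~ v);
  act_linearr : forall x, linear (act x);
  act_lie : forall x y v, act (lie x y) v = act x (act y v) - act y (act x v)
}.

Section ModuleTheory.
Variables (F : fieldType) (g : lieAlgType F).
Implicit Types V W X S : lieModule g.

Definition submodule V (N : set V) : Prop :=
  [/\ N 0, forall (a : F) u v, N u -> N v -> N (a *: u + v)
    & forall x v, N v -> N (act x v)].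

Definition module_hom V W (f : V -> W) : Prop :=
  linear f /\ forall x v, f (act x v) = act x (f v).

Definition module_iso V W : Prop :=
  exists f : V -> W, module_hom f /\ bijective f.

Definition nonzero V : Prop := exists v : V, v != 0.

(* Nonzero action, not merely a nonzero space: the trivial modules are those on
   which g acts as zero. *)
Definition nontrivial V : Prop := exists (x : g) (v : V), act x v != 0.

Definition simple V : Prop :=
  nonzero V /\ forall N : set V, submodule N -> N = [set 0] \/ N = setT.

Definition indecomposable V : Prop :=
  nonzero V /\ forall A B : set V, submodule A -> submodule B ->
    [set a + b | a in A & b in B] = setT -> A `&` B = [set 0] ->
    A = [set 0] \/ B = [set 0].

(* S is a quotient of a submodule of X: M embeds in X and maps onto S. *)
Definition subquotient S X : Prop :=
  exists (M : lieModule g) (i : M -> X) (p : M -> S),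
    [/\ module_hom i, injective i, module_hom p
      & forall s, exists m, p m = s].

Definition iso_to_nontrivial_simple_subquotient V X : Prop :=
  exists S, [/\ subquotient S X, simple S, nontrivial S & module_iso V S].

(* The subspace W of V has dimension at most n. *)
Definition dim_le V (n : nat) (W : set V) : Prop :=
  exists e : 'I_n -> V, (forall i, W (e i)) /\
    forall w, W w -> exists c : 'I_n -> F, w = \sum_(i < n) c i *: e i.

End ModuleTheory.

(** * Linear extension from a basis

  [{malg F[K]}] is used only as the vector space with basis [K], the basis
  vector of [k : K] being [<< k >>]. *)

HB.lock Definition lext (F : fieldType) (K : choiceType) (V : lmodType F)
    (f : K -> V) (x : {malg F[K]}) : V :=
  \sum_(k <- msupp x) x@_k *: f k.

Section LinearExtension.
Variables (F : fieldType) (K : choiceType).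

Lemma lextEw (V : lmodType F) (f : K -> V) (d : {fset K}) x :
  (msupp x `<=` d)%fset -> lext f x = \sum_(k <- d) x@_k *: f k.
Proof.
move=> sxd; rewrite lext.unlock (big_fset_incl _ sxd) // => k _ kx.
by rewrite mcoeff_outdom // scale0r.
Qed.

Lemma lext_linear (V : lmodType F) (f : K -> V) : linear (lext f).
Proof.
move=> a x y; pose d := (msupp x `|` msupp y `|` msupp (a *: x + y))%fset.
have sx : (msupp x `<=` d)%fset by rewrite /d -fsetUA fsubsetUl.
have sy : (msupp y `<=` d)%fset.
  by rewrite /d (fsetUC (msupp x)) -fsetUA fsubsetUl.
have sz : (msupp (a *: x + y) `<=` d)%fset by rewrite /d fsubsetUr.
rewrite (lextEw f sx) (lextEw f sy) (lextEw f sz) scaler_sumr -big_split /=.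
by apply: eq_bigr => k _; rewrite mcoeffD mcoeffZ scalerDl scalerA.
Qed.

HB.instance Definition _ (V : lmodType F) (f : K -> V) :=
  GRing.isLinear.Build F {malg F[K]} V _ (lext f) (lext_linear f).

Lemma lextU (V : lmodType F) (f : K -> V) k : lext f << k >> = f k.
Proof.
by rewrite lext.unlock msuppU oner_eq0 big_seq_fset1 mcoeffUU scale1r.
Qed.

Lemma malg_ind (P : {malg F[K]} -> Prop) :
  P 0 -> (forall a x y, P x -> P y -> P (a *: x + y)) ->
  (forall k, P << k >>) -> forall x, P x.
Proof.
move=> P0 PD PU x; rewrite (monalgE x); apply: big_ind => //.
- by move=> u v Pu Pv; rewrite -[u]scale1r; apply: PD.
- move=> k _; have -> : << x@_k *g k >> = x@_k *: << k >> + 0.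
    apply/malgP => k'; rewrite addr0 mcoeffZ !mcoeffU.
    by case: eqP => _; rewrite ?mulr1 ?mulr0.
  exact: PD.
Qed.

Lemma lextDf (V : lmodType F) a (f h : K -> V) x :
  lext (fun k => a *: f k + h k) x = a *: lext f x + lext h x.
Proof.
rewrite lext.unlock scaler_sumr -big_split /=; apply: eq_bigr => k _.
by rewrite scalerDr !scalerA mulrC.
Qed.

End LinearExtension.

(** * The twisted Heisenberg-Virasoro algebra *)

Inductive thv_gen := Lg of int | Ig of int | CL | CI | CLI.

Definition thv_gen_code (x : thv_gen) : int + int + nat :=
  match x with
  | Lg m => inl (inl m) | Ig m => inl (inr m)
  | CL => inr 0%N | CI => inr 1%N | CLI => inr 2%N
  end.

Definition thv_gen_decode (x : int + int + nat) : thv_gen :=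
  match x with
  | inl (inl m) => Lg m | inl (inr m) => Ig m
  | inr 0%N => CL | inr 1%N => CI | inr _ => CLI
  end.

Lemma thv_gen_codeK : cancel thv_gen_code thv_gen_decode.
Proof. by case. Qed.

HB.instance Definition _ := Countable.copy thv_gen (can_type thv_gen_codeK).

Section TwistedHeisenbergVirasoro.
Variable F : fieldType.

Local Notation thv := {malg F[thv_gen]}.
Local Notation E k := (<< k >> : thv).
Local Notation delta n := ((n == 0 :> int)%:R : F).

Definition thv_br (x y : thv_gen) : thv :=
  match x, y with
  | Lg m, Lg n => (n - m)%:~R *: E (Lg (m + n))
      + (delta (m + n) * (12%:R^-1 * (m ^+ 3 - m)%:~R)) *: E CL
  | Ig m, Ig n => (n%:~R * delta (m + n)) *: E CI
  | Lg m, Ig n => n%:~R *: E (Ig (m + n))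
      + (delta (m + n) * (m ^+ 2 - m)%:~R) *: E CLI
  | Ig m, Lg n => (- m%:~R) *: E (Ig (m + n))
      + (- (delta (m + n) * (n ^+ 2 - n)%:~R)) *: E CLI
  | _, _ => 0
  end.

Definition thv_lie (x y : thv) : thv := lext (fun i => lext (thv_br i) y) x.

Lemma thv_lie_linearl y : linear (thv_lie^~ y).
Proof. by move=> a u v; rewrite /thv_lie linearP. Qed.

Lemma thv_lie_linearr x : linear (thv_lie x).
Proof.
move=> a u v; rewrite /thv_lie -lextDf; congr (lext _ _); apply/funext => k.
by rewrite linearP.
Qed.

Lemma thv_lieE i j : thv_lie (E i) (E j) = thv_br i j.
Proof. by rewrite /thv_lie !lextU. Qed.

Lemma thv_lie0r x : thv_lie x 0 = 0.
Proof.
by have := thv_lie_linearr x (-1) 0 0; rewrite scaler0 add0r scaleN1r addNr.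
Qed.

Lemma thv_lieDr x y z : thv_lie x (y + z) = thv_lie x y + thv_lie x z.
Proof. by have := thv_lie_linearr x 1 y z; rewrite !scale1r. Qed.

Lemma thv_lieZr x a y : thv_lie x (a *: y) = a *: thv_lie x y.
Proof. by have := thv_lie_linearr x a y 0; rewrite thv_lie0r !addr0. Qed.

Lemma thv_lieNr x y : thv_lie x (- y) = - thv_lie x y.
Proof. by rewrite -scaleN1r thv_lieZr scaleN1r. Qed.

Definition thv_lierE := (thv_lie0r, thv_lieDr, thv_lieZr, thv_lieNr, thv_lieE).

Lemma thv_lie0l z : thv_lie 0 z = 0.
Proof. by rewrite /thv_lie linear0. Qed.

Lemma thv_lie_antiU i j : thv_br i j = - thv_br j i.
Proof.
apply/malgP => k; case: i => [m|m|||]; case: j => [n|n|||] /=;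
  rewrite ?oppr0 ?opprK //= !(mcoeffN, mcoeffD, mcoeffZ) (addrC n m);
  (have [mn|_] := eqVneq (m + n) 0; rewrite ?(mulr0n, mulr1n) ?mn;
   last by ring);
  by rewrite (_ : n = - m); [ring | lia].
Qed.

Lemma thv_lie_anti x y : thv_lie x y = - thv_lie y x.
Proof.
elim/malg_ind: x y => [y|a u v IHu IHv y|i y].
- by rewrite thv_lie0l thv_lie0r oppr0.
- by rewrite thv_lie_linearl thv_lieDr thv_lieZr IHu IHv scalerN opprD.
elim/malg_ind: y => [|a u v IHu IHv|j].
- by rewrite thv_lie0l thv_lie0r oppr0.
- by rewrite thv_lie_linearl thv_lieDr thv_lieZr IHu IHv scalerN opprD.
- by rewrite !thv_lieE thv_lie_antiU.
Qed.

Lemma thv_liexx x : thv_lie x x = 0.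
Proof.
elim/malg_ind: x => [|a u v IHu IHv|i]; first exact: thv_lie0r.
- rewrite thv_lie_linearl !thv_lierE IHu IHv (thv_lie_anti v u).
  by rewrite ?(scaler0, addr0, add0r, scalerN, subrr, addNr).
rewrite thv_lieE; case: i => [m|m|||] //=; apply/malgP => k;
  rewrite ?(mcoeff0, mcoeffD, mcoeffZ, mcoeffN);
  (have [mm|_] := eqVneq (m + m) 0; rewrite ?(mulr0n, mulr1n); last by ring);
  rewrite (_ : m = 0); first [ring | lia].
Qed.

Definition thv_jac x y z : thv :=
  thv_lie x (thv_lie y z) + thv_lie y (thv_lie z x) + thv_lie z (thv_lie x y).

Lemma thv_jacC x y z : thv_jac x y z = thv_jac y z x.
Proof.
by rewrite /thv_jac -addrA addrC.
Qed.

Lemma thv_jac_linear x y : linear (thv_jac x y).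
Proof.
move=> a u v; rewrite /thv_jac !(thv_lie_linearl, thv_lieDr, thv_lieZr).
by apply/malgP => k; rewrite !(mcoeffD, mcoeffZ); ring.
Qed.

Lemma thv_lie_centralr c : thv_br^~ c =1 (fun=> 0) ->
  forall x, thv_lie x (E c) = 0.
Proof.
move=> cP; elim/malg_ind => [|a u v IHu IHv|i]; first exact: thv_lie0l.
- by rewrite thv_lie_linearl IHu IHv scaler0 addr0.
- by rewrite thv_lieE cP.
Qed.

Lemma thv_jacU_central i j c : thv_br^~ c =1 (fun=> 0) ->
  thv_jac (E i) (E j) (E c) = 0.
Proof.
move=> /thv_lie_centralr cr.
have cl x : thv_lie (E c) x = 0 by rewrite thv_lie_anti cr oppr0.
by rewrite /thv_jac cr !cl !thv_lie0r !addr0.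
Qed.

Lemma thv_lieU2 i a j b c : thv_br i c = 0 ->
  thv_lie (E i) (a *: E j + b *: E c) = a *: thv_br i j.
Proof.
by move=> ic; rewrite thv_lieDr !thv_lieZr !thv_lieE ic scaler0 addr0.
Qed.

Lemma thv_lieU1 i a j : thv_lie (E i) (a *: E j) = a *: thv_br i j.
Proof. by rewrite thv_lieZr thv_lieE. Qed.

Lemma comb3 (V : lmodType F) (x z : V) a1 b1 d1 a2 b2 d2 a3 b3 d3 :
  a1 * b1 + a2 * b2 + a3 * b3 = 0 -> a1 * d1 + a2 * d2 + a3 * d3 = 0 ->
  a1 *: (b1 *: x + d1 *: z) + a2 *: (b2 *: x + d2 *: z)
    + a3 *: (b3 *: x + d3 *: z) = 0.
Proof.
move=> ab ad; rewrite !scalerDr !scalerA [X in X + _ = _]addrACA -!scalerDl.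
rewrite addrACA -!scalerDl.
by rewrite ab ad !scale0r addr0.
Qed.

Lemma thv_brLL m n s : m + n = s -> thv_br (Lg m) (Lg n) =
  (n - m)%:~R *: E (Lg s) + (delta s * (12%:R^-1 * (m ^+ 3 - m)%:~R)) *: E CL.
Proof. by move=> <-. Qed.

Lemma thv_brLI m n s : m + n = s -> thv_br (Lg m) (Ig n) =
  n%:~R *: E (Ig s) + (delta s * (m ^+ 2 - m)%:~R) *: E CLI.
Proof. by move=> <-. Qed.

Lemma thv_brIL m n s : m + n = s -> thv_br (Ig m) (Lg n) =
  (- m%:~R) *: E (Ig s) + (- (delta s * (n ^+ 2 - n)%:~R)) *: E CLI.
Proof. by move=> <-. Qed.

Lemma thv_brII m n s : m + n = s ->
  thv_br (Ig m) (Ig n) = (n%:~R * delta s) *: E CI.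
Proof. by move=> <-. Qed.

Lemma delta_mul0 (s : int) (a : F) : (s = 0 -> a = 0) -> delta s * a = 0.
Proof. by case: eqP => [e ->|_ _]; rewrite ?mulr0 ?mul0r. Qed.

Lemma thv_jacU_LLL m n p : thv_jac (E (Lg m)) (E (Lg n)) (E (Lg p)) = 0.
Proof.
have [s sE] : exists s : int, m + n + p = s by eexists.
rewrite /thv_jac !thv_lieE (thv_brLL (erefl (n + p))).
rewrite (thv_brLL (erefl (p + m))) (thv_brLL (erefl (m + n))) !thv_lieU2 //.
rewrite (@thv_brLL m _ s); last by lia.
rewrite (@thv_brLL n _ s); last by lia.
rewrite (@thv_brLL p _ s); last by lia.
apply: comb3; first by ring.
rewrite ![_ * (delta s * _)]mulrCA -!mulrDr; apply: delta_mul0 => s0.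
by rewrite (_ : p = - (m + n)); [ring | lia].
Qed.

Lemma thv_jacU_LLI m n p : thv_jac (E (Lg m)) (E (Lg n)) (E (Ig p)) = 0.
Proof.
have [s sE] : exists s : int, m + n + p = s by eexists.
rewrite /thv_jac !thv_lieE (thv_brLI (erefl (n + p))).
rewrite (thv_brIL (erefl (p + m))) (thv_brLL (erefl (m + n))) !thv_lieU2 //.
rewrite (@thv_brLI m _ s); last by lia.
rewrite (@thv_brLI n _ s); last by lia.
rewrite (@thv_brIL p _ s); last by lia.
apply: comb3; first by ring.
rewrite !mulrN ![_ * (delta s * _)]mulrCA -mulrN -!mulrDr.
by apply: delta_mul0 => s0; rewrite (_ : p = - (m + n)); [ring | lia].
Qed.

Lemma thv_jacU_LII m n p : thv_jac (E (Lg m)) (E (Ig n)) (E (Ig p)) = 0.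
Proof.
have [s sE] : exists s : int, m + n + p = s by eexists.
rewrite /thv_jac !thv_lieE (thv_brII (erefl (n + p))).
rewrite (thv_brIL (erefl (p + m))) (thv_brLI (erefl (m + n))) !thv_lieU2 //.
rewrite thv_lieU1 (_ : thv_br (Lg m) CI = 0) // scaler0 add0r.
rewrite (@thv_brII n _ s); last by lia.
rewrite (@thv_brII p _ s); last by lia.
rewrite !scalerA -scalerDl (_ : _ + _ = 0) ?scale0r //.
rewrite !mulrA ![_ * delta s]mulrC -mulrDr; apply: delta_mul0 => s0.
by rewrite (_ : p = - (m + n)); [ring | lia].
Qed.

Lemma thv_jacU_III m n p : thv_jac (E (Ig m)) (E (Ig n)) (E (Ig p)) = 0.
Proof.
rewrite /thv_jac !thv_lieE (thv_brII (erefl (n + p))).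
rewrite (thv_brII (erefl (p + m))) (thv_brII (erefl (m + n))) !thv_lieU1.
have br0 q : thv_br (Ig q) CI = 0 by [].
by rewrite !br0 !scaler0 !addr0.
Qed.

Lemma thv_jacU i j k : thv_jac (E i) (E j) (E k) = 0.
Proof.
case: i => [m|m|||].
all: try by rewrite thv_jacC thv_jacU_central //; case.
all: case: j => [n|n|||].
all: try by rewrite thv_jacC thv_jacC thv_jacU_central //; case.
all: case: k => [p|p|||].
all: try by rewrite thv_jacU_central //; case.
- exact: thv_jacU_LLL.
- exact: thv_jacU_LLI.
- by rewrite thv_jacC thv_jacC thv_jacU_LLI.
- exact: thv_jacU_LII.
- by rewrite thv_jacC thv_jacU_LLI.
- by rewrite thv_jacC thv_jacU_LII.
- by rewrite thv_jacC thv_jacC thv_jacU_LII.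
- exact: thv_jacU_III.
Qed.

Lemma thv_jacobi x y z : thv_jac x y z = 0.
Proof.
elim/malg_ind: x => [|a u v IHu IHv|i].
- by rewrite thv_jacC /thv_jac !(thv_lie0r, thv_lie0l, addr0).
- rewrite thv_jacC thv_jac_linear !(thv_jacC y) !(thv_jacC z) IHu IHv.
  by rewrite scaler0 addr0.
elim/malg_ind: y => [|a u v IHu IHv|j].
- by rewrite /thv_jac !(thv_lie0r, thv_lie0l, addr0).
- rewrite 2!thv_jacC thv_jac_linear !(thv_jacC z) IHu IHv.
  by rewrite scaler0 addr0.
elim/malg_ind: z => [|a u v IHu IHv|k].
- by rewrite /thv_jac !(thv_lie0r, thv_lie0l, addr0).
- by rewrite thv_jac_linear IHu IHv scaler0 addr0.
- exact: thv_jacU.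
Qed.

HB.instance Definition _ := isLieAlgebra.Build F {malg F[thv_gen]}
  thv_lie_linearl thv_lie_linearr thv_liexx thv_jacobi.

End TwistedHeisenbergVirasoro.

Section ThvModules.
Variable F : fieldType.

Definition thv : lieAlgType F := {malg F[thv_gen]}.

Definition thv_basis (k : thv_gen) : thv := << k >>.

Section Weights.
Variable V : lieModule thv.

Definition weight_space (mu : F) : set V :=
  [set v | act (thv_basis (Lg 0)) v = mu *: v].

(* V is the sum of its weight spaces; the sum is automatically direct, as they
   are eigenspaces of one operator. *)
Definition weight_module : Prop :=
  forall v : V, exists (n : nat) (mu : 'I_n -> F) (u : 'I_n -> V),
    (forall i, weight_space (mu i) (u i)) /\ v = \sum_(i < n) u i.

Definition Harish_Chandra : Prop :=
  [/\ indecomposable V, weight_module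
    & forall mu, exists n, dim_le n (weight_space mu)].

Definition intermediate_series : Prop :=
  [/\ Harish_Chandra, nontrivial V & forall mu, dim_le 1 (weight_space mu)].

End Weights.

(** * The modules with basis [v_t], [t] in Z

  They all have the shape [L(n) v_t = ell n t *: v_(n+t)],
  [I(n) v_t = iota n t *: v_(n+t)], with central elements acting as zero. *)

Section GradedModule.
Variables ell iota : int -> int -> F.

Local Notation v t := (<< t >> : {malg F[int]}).

Definition graded_act_bas (x : thv_gen) (t : int) : {malg F[int]} :=
  match x with
  | Lg n => ell n t *: v (n + t)
  | Ig n => iota n t *: v (n + t)
  | _ => 0
  end.

Definition graded_act (x : thv) (u : {malg F[int]}) : {malg F[int]} :=
  lext (fun g => lext (graded_act_bas g) u) x.

Lemma graded_act_linearl u : linear (graded_act^~ u).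
Proof. by move=> a x y; rewrite /graded_act linearP. Qed.

Lemma graded_act_linearr x : linear (graded_act x).
Proof.
move=> a u w; rewrite /graded_act -lextDf; congr (lext _ _); apply/funext => k.
by rewrite linearP.
Qed.

Lemma graded_actE g t : graded_act << g >> << t >> = graded_act_bas g t.
Proof. by rewrite /graded_act !lextU. Qed.

Lemma graded_act0l u : graded_act 0 u = 0.
Proof.
by have := graded_act_linearl u (-1) 0 0; rewrite scaler0 add0r scaleN1r addNr.
Qed.

Lemma graded_act0r x : graded_act x 0 = 0.
Proof.
by have := graded_act_linearr x (-1) 0 0; rewrite scaler0 add0r scaleN1r addNr.
Qed.

Lemma graded_actZl a x u : graded_act (a *: x) u = a *: graded_act x u.
Proof.
by have := graded_act_linearl u a x 0; rewrite graded_act0l !addr0.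
Qed.

Lemma graded_actZr a x u : graded_act x (a *: u) = a *: graded_act x u.
Proof.
by have := graded_act_linearr x a u 0; rewrite graded_act0r !addr0.
Qed.

(* [L,L], [L,I] and [I,I] evaluated on v_t, all central terms being zero. *)
Definition graded_axiom : Prop :=
  [/\ forall m n t, ell n t * ell m (n + t) - ell m t * ell n (m + t)
        = (n - m)%:~R * ell (m + n) t,
      forall m n t, iota n t * ell m (n + t) - ell m t * iota n (m + t)
        = n%:~R * iota (m + n) t
    & forall m n t, iota n t * iota m (n + t) = iota m t * iota n (m + t)].

Hypothesis ax : graded_axiom.

Lemma combB (V : lmodType F) a (A B C D : V) :
  a *: (A - B) + (C - D) = (a *: A + C) - (a *: B + D).
Proof. by rewrite scalerBr opprD addrACA. Qed.

Lemma basL n t s : n + t = s -> graded_act_bas (Lg n) t = ell n t *: v s.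
Proof. by move=> <-. Qed.

Lemma basI n t s : n + t = s -> graded_act_bas (Ig n) t = iota n t *: v s.
Proof. by move=> <-. Qed.

Lemma graded_act_lieU i j t (x := thv_basis i) (y := thv_basis j)
    (u := << t >>) :
  graded_act (thv_lie x y) u
    = graded_act x (graded_act y u) - graded_act y (graded_act x u).
Proof.
rewrite /x /y /u /thv_basis {x y u} thv_lieE !graded_actE.
have [axLL axLI axII] := ax.
have actD (a1 a2 : F) (k c : thv_gen) : graded_act_bas c t = 0 ->
    graded_act (a1 *: << k >> + a2 *: << c >>) << t >>
    = a1 *: graded_act_bas k t.
  move=> c0; rewrite graded_act_linearl graded_actZl !graded_actE c0.
  by rewrite scaler0 addr0.
have ctr k w : (forall t', graded_act_bas k t' = 0) ->
    graded_act << k >> w = 0.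
  move=> k0; elim/malg_ind: w => [|b u' w IHu IHw|t']; first exact: graded_act0r.
    by rewrite graded_act_linearr IHu IHw scaler0 addr0.
  by rewrite graded_actE k0.
have ctrl k w : (forall t', graded_act_bas k t' = 0) ->
    thv_br F k j = 0 -> i = k -> graded_act (thv_br F i j) << t >> =
    graded_act << i >> w - graded_act << j >> (graded_act_bas i t).
  by move=> k0 kj ->; rewrite kj graded_act0l ctr // k0 graded_act0r subrr.
have ctrr k w : (forall t', graded_act_bas k t' = 0) ->
    thv_br F i k = 0 -> j = k -> graded_act (thv_br F i j) << t >> =
    graded_act << i >> (graded_act_bas j t) - graded_act << j >> w.
  move=> k0 ik ->; rewrite ik graded_act0l [graded_act << k >> _]ctr // k0.
  by rewrite graded_act0r subrr.
case Di: i => [m|m|||]; rewrite -?Di; last 3 first.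
- by apply: (ctrl _ _ _ _ Di) => //; case: (j).
- by apply: (ctrl _ _ _ _ Di) => //; case: (j).
- by apply: (ctrl _ _ _ _ Di) => //; case: (j).
all: case Dj: j => [n|n|||]; rewrite -?Dj; last 3 first.
all: try by apply: (ctrr _ _ _ _ Dj) => //; rewrite Di.
all: rewrite Di Dj {i j Di Dj ctrl ctrr ctr}.
all: have [s sE] : exists s : int, m + n + t = s by eexists.
all: have sn : n + (m + t) = s by lia.
all: have sm : m + (n + t) = s by lia.
- rewrite (thv_brLL _ (erefl _)) actD // (basL (erefl (n + t))).
  rewrite (basL (erefl (m + t))) !graded_actZr !graded_actE.
  by rewrite (basL sn) (basL sm) (basL sE) !scalerA -scalerBl axLL.
- rewrite (thv_brLI _ (erefl _)) actD // (basI (erefl (n + t))).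
  rewrite (basL (erefl (m + t))) !graded_actZr !graded_actE.
  by rewrite (basI sn) (basL sm) (basI sE) !scalerA -scalerBl axLI.
- rewrite (thv_brIL _ (erefl _)) actD // (basL (erefl (n + t))).
  rewrite (basI (erefl (m + t))) !graded_actZr !graded_actE.
  rewrite (basL sn) (basI sm) (basI sE) !scalerA -scalerBl.
  congr (_ *: _); apply: oppr_inj.
  by rewrite opprB axLI mulNr opprK (addrC n m).
- rewrite (thv_brII _ (erefl _)) graded_actZl graded_actE (basI (erefl (n + t))).
  rewrite (basI (erefl (m + t))) !graded_actZr !graded_actE.
  by rewrite (basI sn) (basI sm) scaler0 !scalerA -scalerBl axII subrr scale0r.
Qed.

Lemma graded_act_lie x y u :
  graded_act (lie x y) u
    = graded_act x (graded_act y u) - graded_act y (graded_act x u).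
Proof.
change (lie x y) with (thv_lie x y).
elim/malg_ind: u x y => [|a u w IHu IHw|t] x y.
- by rewrite !graded_act0r subrr.
- by rewrite !graded_act_linearr IHu IHw combB.
elim/malg_ind: x y => [|a x x' IHx IHx'|i] y.
- by rewrite thv_lie0l !graded_act0l graded_act0r subrr.
- rewrite thv_lie_linearl !graded_act_linearl graded_act_linearr IHx IHx'.
  by rewrite combB.
elim/malg_ind: y => [|a y y' IHy IHy'|j].
- by rewrite thv_lie0r !graded_act0l graded_act0r subrr.
- rewrite thv_lie_linearr !graded_act_linearl graded_act_linearr IHy IHy'.
  by rewrite combB.
exact: graded_act_lieU.
Qed.

Definition graded_module : lieModule thv :=
  LieModule graded_act_linearl graded_act_linearr graded_act_lie.

End GradedModule.
End ThvModules.

Section Families.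
Variable F : fieldType.
Implicit Types (a b c d : F) (n t : int).

Definition A_ell a b n t : F := a + t%:~R + b * n%:~R.
Definition A_iota c n t : F := c.

Definition Aad_ell a n t : F :=
  if t != 0 then (t + n)%:~R else n%:~R * (n%:~R + a).
Definition Aad_iota d n t : F := if t != 0 then 0 else d * n%:~R.

Definition Bad_ell a n t : F :=
  if t != - n then t%:~R else - n%:~R * (n%:~R + a).
Definition Bad_iota d n t : F := if n + t != 0 then 0 else d * n%:~R.

Definition U_ell n t : F := t%:~R.
Definition U_iota d n t : F := if n + t != 0 then 0 else n%:~R * d.

Definition V_ell n t : F := (t + n)%:~R.
Definition V_iota d n t : F := if t != 0 then 0 else n%:~R * d.

Definition tU_ell n t : F := if n + t != 0 then t%:~R else 0.
Definition tU_iota d n t : F := if n + t != 0 then 0 else d * n%:~R.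

Definition tV_ell n t : F := if n + t != 0 then t%:~R else 0.
Definition tV_iota c n t : F :=
  if (t != 0) || (n == 0) && (t == 0) then 0 else c.

Local Ltac elim_eq x e :=
  have -> : x = e by lia.

Local Ltac graded :=
  let m := fresh "m" in let n := fresh "n" in let t := fresh "t" in
  split; intros m n t;
  unfold A_ell, A_iota, Aad_ell, Aad_iota, Bad_ell, Bad_iota, U_ell, U_iota,
    V_ell, V_iota, tU_ell, tU_iota, tV_ell, tV_iota;
  repeat match goal with
    |- context [@eq_op _ ?x ?y] => case: (@eqP _ x y) => /= ? end;
  try solve [exfalso; lia];
  first [elim_eq t (0 : int) | idtac];
  first [elim_eq n (0 : int) | elim_eq n (- t) | idtac];
  first [elim_eq m (0 : int) | elim_eq m (- t) | elim_eq m (- n)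
        | elim_eq m (- (n + t)) | idtac];
  ring.

Lemma A_axiom a b c : graded_axiom (A_ell a b) (A_iota c).
Proof. graded. Qed.

Lemma Aad_axiom a d : graded_axiom (Aad_ell a) (Aad_iota d).
Proof. graded. Qed.

Lemma Bad_axiom a d : graded_axiom (Bad_ell a) (Bad_iota d).
Proof. graded. Qed.

Lemma U_axiom d : graded_axiom U_ell (U_iota d).
Proof. graded. Qed.

Lemma V_axiom d : graded_axiom V_ell (V_iota d).
Proof. graded. Qed.

Lemma tU_axiom d : graded_axiom tU_ell (tU_iota d).
Proof. graded. Qed.

Lemma tV_axiom c : graded_axiom tV_ell (tV_iota c).
Proof. graded. Qed.

Definition mod_A a b c : lieModule (thv F) := graded_module (A_axiom a b c).
Definition mod_Aad a d : lieModule (thv F) := graded_module (Aad_axiom a d).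
Definition mod_Bad a d : lieModule (thv F) := graded_module (Bad_axiom a d).
Definition mod_U d : lieModule (thv F) := graded_module (U_axiom d).
Definition mod_V d : lieModule (thv F) := graded_module (V_axiom d).
Definition mod_tU d : lieModule (thv F) := graded_module (tU_axiom d).
Definition mod_tV c : lieModule (thv F) := graded_module (tV_axiom c).

(* The seven families; [tU] and [tV] are the two with a tilde. *)
Inductive listed : lieModule (thv F) -> Prop :=
| listed_A a b c : listed (mod_A a b c)
| listed_Aad a d : listed (mod_Aad a d)
| listed_Bad a d : listed (mod_Bad a d)
| listed_U d : listed (mod_U d)
| listed_V d : listed (mod_V d)
| listed_tU d of d != 0 : listed (mod_tU d)
| listed_tV c of c != 0 : listed (mod_tV c).

End Families.

(* Main.v *)
(* Indecomposability puts all weights in one coset a + Z and makes the central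
   elements C_L, C_I, C_LI, I(0) act by scalars; a module of the intermediate
   series is then a table of scalars l(n,t), i(n,t), up to rescaling the basis.

   Support: a highest weight vector v generates lines only, so L(m) and
   L(m-j) L(j) pair with L(-m) and L(-j) L(j-m) on v in a matrix of rank at most
   one; its determinant is a polynomial in m which forces weight 0 and C_L = 0.
   Along a ray of nonzero weight spaces the scalars of L(-1)L(1), L(-2)L(2),
   L(-1)^2 L(2) and L(-2)L(1)^2 have known differences, hence are polynomials in
   t, and x y = f(t) f(t+1) g for these four loops determines them up to one
   parameter b, with C_L = 0: they are those of A_{a,b}.  A missing weight can
   thus only be the weight 0.

   Structure: unless a = 0 and b is 0 or 1, the loops determine l up to
   rescaling, so the Virasoro module is A_{a,b}.  In the exceptional case e_0
   spans a submodule or a complement of one, the remaining weights carry a fixed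
   simple module, and the extension is a cocycle al n + be n^2.  The brackets
   [L,I] and [I,I] then leave, up to duality, only the listed modules; when the
   weight 0 is absent, I acts by zero and V is the simple quotient of A_{0,0,0}. *)

Require Import Defs.
From mathcomp Require Import all_boot all_order all_algebra.
From mathcomp Require Import boolp classical_sets reals complex finmap.
From mathcomp.multinomials Require Import monalg.
From mathcomp Require Import zify ring.

Set Implicit Arguments.
Unset Strict Implicit.
Unset Printing Implicit Defensive.

Import Order.TTheory GRing.Theory Num.Theory.
Local Open Scope ring_scope.

(** Rescaling the basis changes every scalar l(n,t) but no product along a closed path, so the loops
    are the natural unknowns. The obstacle is that a vanishing loop does not say which of its edges
    vanishes, while the edge scalars a + t + b n of A_{a,b} do have zeros. For b other than 0 and 1
    each doubtful edge also lies on another loop, which decides. The value b = 1/2 needs extra care: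
    if the weights -1/2 and 1/2 occur, both L(1) and L(-1) vanish between their lines, and the
    relative scale of the two halves has to be fixed by L(2). The integration constants satisfy c^2
    = (4q + 1) q^2, a cubic with a node at q = c = 0, over which lie both b = 0 and b = 1. If in
    addition the weight 0 occurs, all four loops at its line vanish and leave the arrows at e_0
    undetermined; this is how different modules can share the same loops. *)

Section LinearCombinations.
Variable F : comPzRingType.
Implicit Types A B l r k : F.

Lemma eq_lincomb A B l r : l = r -> A - B = l - r -> A = B.
Proof. by move=> ->; rewrite subrr => /eqP; rewrite subr_eq0 => /eqP. Qed.

Lemma eq_add l r l' r' : l = r -> l' = r' -> l + l' = r + r'.
Proof. by move=> -> ->. Qed.

Lemma eq_scale k l r : l = r -> k * l = k * r.
Proof. by move=> ->. Qed.

End LinearCombinations.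

(* [lc e] closes [A = B] when [A - B] is, up to ring identities, the difference
   of the two sides of [e]; the [lcN] take linear combinations of equations. *)
Ltac lc e := apply: (eq_lincomb e); ring.
Ltac lc1 k e := lc (eq_scale k e).
Ltac lc2 k1 e1 k2 e2 := lc (eq_add (eq_scale k1 e1) (eq_scale k2 e2)).
Ltac lc3 k1 e1 k2 e2 k3 e3 :=
  lc (eq_add (eq_add (eq_scale k1 e1) (eq_scale k2 e2)) (eq_scale k3 e3)).
Ltac lc4 k1 e1 k2 e2 k3 e3 k4 e4 :=
  lc (eq_add (eq_add (eq_add (eq_scale k1 e1) (eq_scale k2 e2))
               (eq_scale k3 e3)) (eq_scale k4 e4)).

(** * Polynomials vanishing along an arithmetic progression *)

Section ArithmeticProgressions.
Variable F : numDomainType.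

Lemma poly_eq0_progression (p : {poly F}) x d :
  d != 0 -> (forall k : nat, p.[x + k%:R * d] = 0) -> p = 0.
Proof.
move=> d0 p0; apply/eqP/negPn/negP => pN0.
pose rs := [seq x + k%:R * d | k <- iota 0 (size p)].
have : (size rs < size p)%N.
  apply: max_poly_roots => //; first by apply/allP => _ /mapP[k _ ->];
    apply/eqP.
  rewrite map_inj_uniq ?iota_uniq // => i j /addrI /(mulIf d0) /eqP.
  by rewrite eqr_nat => /eqP.
by rewrite size_map size_iota ltnn.
Qed.

(** The coefficients come as a list under [horner_rec], so that simplification unfolds the
    hypothesis into an explicit expression within reach of [ring]. *)
Lemma coef_eq0_progression (e : seq F) x d : d != 0 ->
  (forall k : nat, horner_rec e (x + k%:R * d) = 0) -> forall i, e`_i = 0.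
Proof.
move=> d0 e0 i; rewrite -coef_Poly (@poly_eq0_progression (Poly e) x d) ?coef0
  //.
by move=> k; rewrite horner_Poly.
Qed.

End ArithmeticProgressions.

(** * Highest weight vectors *)

Section VirasoroData.
Variable F : numClosedFieldType.
Implicit Types (s : int -> bool) (a C h : F) (l : int -> int -> F).
Implicit Types (m n t r : int).

(* Scalar form of a weight module with lines spanned by e_t, [s t]: L(n) acts by
   L(n) e_t = [l n t] e_(n+t), L(0) e_t = (a + t) e_t and C_L acts by [C]. *)
Record vir_data s a l C : Prop := VirData {
  vd_supp : forall n t, l n t != 0 -> s t && s (n + t);
  vd_L0 : forall t, s t -> l 0 t = a + t%:~R;
  vd_br : forall m n t, s t ->
    l n t * l m (n + t) - l m t * l n (m + t) = (n - m)%:~R * l (m + n) t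
      + (m + n == 0)%:R * (12%:R^-1 * (m ^+ 3 - m)%:~R) * C
}.

Section Brackets.
Variables (s : int -> bool) (a C : F) (l : int -> int -> F).
Hypothesis D : vir_data s a l C.

Lemma vd0l n t : ~~ s t -> l n t = 0.
Proof. by move=> st; apply/eqP/negPn/negP => /(vd_supp D);
  rewrite (negPf st). Qed.

Lemma vd0r n t u : n + t = u -> ~~ s u -> l n t = 0.
Proof.
move=> <- st; apply/eqP/negPn/negP => /(vd_supp D).
by rewrite (negPf st) andbF.
Qed.

Lemma vd_bracket m n t p q r : s t -> n + t = p -> m + t = q -> m + n = r -> r
  != 0 ->
  l n t * l m p = l m t * l n q + (n - m)%:~R * l r t.
Proof.
move=> st <- <- <- /negPf mn; have := vd_br D m n st.
by rewrite mn !mul0r addr0 => e; lc e.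
Qed.

Lemma vd_bracket0 m n t p q : s t -> n + t = p -> m + t = q -> m + n = 0 ->
  l n t * l m p = l m t * l n q + (n - m)%:~R * (a + t%:~R)
    + 12%:R^-1 * (m ^+ 3 - m)%:~R * C.
Proof.
move=> st <- <- mn; have := vd_br D m n st.
by rewrite mn (vd_L0 D) // eqxx mul1r => e; lc e.
Qed.

(* Precomposing with an arrow into [u] makes the bracket relations at [u] hold
   without knowing that [u] is in the support. *)
Lemma vd_bracket_pre k v m n t p q r : k + v = t ->
  n + t = p -> m + t = q -> m + n = r -> r != 0 ->
  l k v * (l n t * l m p) = l k v * (l m t * l n q + (n - m)%:~R * l r t).
Proof.
move=> kv np mq mn r0; have [->|lkv] := eqVneq (l k v) 0;
  first by rewrite !mul0r.
by congr (_ * _); apply: vd_bracket => //; move: (vd_supp D lkv);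
  rewrite kv => /andP[].
Qed.

Lemma vd_bracket0_pre k v m n t p q : k + v = t ->
  n + t = p -> m + t = q -> m + n = 0 ->
  l k v * (l n t * l m p) = l k v * (l m t * l n q
    + (n - m)%:~R * (a + t%:~R) + 12%:R^-1 * (m ^+ 3 - m)%:~R * C).
Proof.
move=> kv np mq mn; have [->|lkv] := eqVneq (l k v) 0; first by rewrite !mul0r.
by congr (_ * _); apply: vd_bracket0 => //; move: (vd_supp D lkv);
  rewrite kv => /andP[].
Qed.

End Brackets.

Section Singular.
Variables (s : int -> bool) (a C : F) (l : int -> int -> F).
Hypothesis D : vir_data s a l C.
Variable t : int.
Hypothesis st : s t.
(** Weaker than being a highest weight vector: e_t may be raised, provided that nothing raised can
    be lowered again. The proof of [highest_weight_isolated] needs this generality. *)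
Hypothesis sing : forall m k, 0 < m -> 0 < k -> l m t * l (- k) (m + t) = 0.

Let h := a + t%:~R.
Let y := 12%:R^-1 * C.
Let g (m : F) := (m ^+ 3 - m) * y - 2 * m * h.

Lemma sing_return m p : 0 < m -> p = t - m -> l (- m) t * l m p = g m%:~R.
Proof.
move=> m0 ->; rewrite (vd_bracket0 D (p := t - m) (q := m + t) st); [|lia..].
by rewrite sing // /g /y /h; ring.
Qed.

(* The operators L(m) and L(m-j)L(j), resp. L(-m) and L(-j)L(j-m), are
   proportional between the lines of weights t and t - m. *)
Lemma sing_rank_le1 m j : 0 < j -> 2 * j < m ->
  g m%:~R * (m%:~R ^+ 2 * g (m - 2 * j)%:~R
    + (- 2 * j%:~R * (h - (m - j)%:~R) + (j ^+ 3 - j)%:~R * y) * g (m - j)%:~R)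
  = ((m + j)%:~R * g (m - j)%:~R) ^+ 2.
Proof.
move=> j0 jm; pose u1 := t - m + j; pose u0 := t - m; pose u2 := t - m + 2 * j.
have gm : l (- m) t * l m u0 = g m%:~R by apply: sing_return; lia.
have gj : l (- (m - j)) t * l (m - j) u1 = g (m - j)%:~R.
  by apply: sing_return; rewrite ?/u1; lia.
have g2 : l (- (m - 2 * j)) t * l (m - 2 * j) u2 = g (m - 2 * j)%:~R.
  by apply: sing_return; rewrite ?/u2; lia.
pose k := - (m - j).
have e1 : l k t * (l (- j) u1 * l m u0) = - (m + j)%:~R * g (m - j)%:~R.
  rewrite (vd_bracket_pre D (q := m + u1) (r := m - j)); [|rewrite /k /u1 /u0;
    lia..].
  have z1 := vd_bracket D (m := m) (n := k) (t := t) (p := u1) (q := m + t) (r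
    := j) st.
  have s1 : l m t * l k (m + t) = 0 by apply: sing; lia.
  have s2 : l j t * l (- j) (j + t) = 0 by apply: sing; lia.
  rewrite mulrDr mulrA z1; [|rewrite /k /u1; lia..].
  have -> : m + u1 = j + t by rewrite /u1; lia.
  rewrite -gj -/k; lc2 (l (- j) (j + t)) s1 ((k - m)%:~R : F) s2.
have e2 : l (- m) t * (l j u0 * l (m - j) u1) = - (m + j)%:~R * g (m - j)%:~R.
  have z1 := vd_bracket D (m := j) (n := - m) (t := t) (p := u0) (q := j + t)
    (r := k) st.
  have s1 : l j t * l (- m) (j + t) = 0 by apply: sing; lia.
  rewrite mulrA z1; [|rewrite /k /u0; lia..].
  rewrite -gj -/k; lc1 (l (m - j) u1) s1.
have e3 : l k t * (l (- j) u1 * l j u0) * l (m - j) u1 =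
    m%:~R ^+ 2 * g (m - 2 * j)%:~R
    + (- 2 * j%:~R * (h - (m - j)%:~R) + (j ^+ 3 - j)%:~R * y) * g (m - j)%:~R.
  (* Exchanging L(-j) and L(j) at [u1] reroutes the path through [u2] and adds the commutator. *)
  rewrite (vd_bracket0_pre D (q := u2)); [|rewrite /k /u1 /u0 /u2; lia..].
  have z1 := vd_bracket D (m := j) (n := k) (t := t) (p := u1) (q := j + t)
                 (r := - (m - 2 * j)) st.
  have s1 : l j t * l k (j + t) = 0 by apply: sing; lia.
  have z2 := vd_bracket_pre D (k := - (m - 2 * j)) (v := t) (m := m - j) (n :=
    - j)
                 (t := u2) (p := u1) (q := j + t) (r := m - 2 * j).
  have z3 := vd_bracket D (m := m - j) (n := - (m - 2 * j)) (t := t) (p := u2)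
                 (q := (m - j) + t) (r := j) st.
  have s3 : l (m - j) t * l (- (m - 2 * j)) (m - j + t) = 0 by apply: sing; lia.
  have s4 : l j t * l (- j) (j + t) = 0 by apply: sing; lia.
  have {}z1 : l k t * l j u1 = - m%:~R * l (- (m - 2 * j)) t.
    rewrite z1; [|rewrite /k /u1; lia..].
    by rewrite (_ : k - j = - m); [lc1 (1 : F) s1 | rewrite /k; lia].
  have {}z3 : l (- (m - 2 * j)) t * l (m - j) u2 = (3 * j - 2 * m)%:~R * l j t.
    by rewrite z3; [lc1 (1 : F) s3 | rewrite /u2; lia..].
  have {}z2 : l (- (m - 2 * j)) t * (l (- j) u2 * l (m - j) u1)
      = - m%:~R * g (m - 2 * j)%:~R.
    rewrite z2; [|rewrite /u1 /u2; lia..].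
    rewrite -g2; lc2 (l (- j) (j + t)) z3 ((3 * j - 2 * m)%:~R : F) s4.
  have -> : l k t * (l j u1 * l (- j) u2 + (- j - j)%:~R * (a + u1%:~R)
      + 12^-1 * (j ^+ 3 - j)%:~R * C) * l (m - j) u1 =
      (l k t * l j u1) * (l (- j) u2 * l (m - j) u1)
      + (- 2 * j%:~R * (h - (m - j)%:~R) + (j ^+ 3 - j)%:~R * y)
        * (l k t * l (m - j) u1).
    by rewrite /h /y /u1; ring.
  rewrite z1 gj; lc1 (- m%:~R : F) z2.
rewrite -gm -e3; lc2 (l (- m) t * (l j u0 * l (m - j) u1)) e1
   (- (m + j)%:~R * g (m - j)%:~R) e2.
Qed.

Lemma singular_weight : a + t%:~R = 0 /\ C = 0.
Proof.
suff [h0 y0] : h = 0 /\ y = 0.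
  split=> //; move/eqP: y0; rewrite /y mulf_eq0 invr_eq0 pnatr_eq0 /=.
  by move/eqP.
have := sing_rank_le1; rewrite /g; move: h y => z w rk1.
pose G (p : {poly F}) := (p ^+ 3 - p) * w%:P - 2%:P * p * z%:P.
pose E (j : int) : {poly F} := G 'X * ('X ^+ 2 * G ('X - (2 * j)%:~R%:P)
  + ((- 2 * j%:~R)%:P * (z%:P - ('X - j%:~R%:P)) + ((j ^+ 3 - j)%:~R * w)%:P)
    * G ('X - j%:~R%:P)) - (('X + j%:~R%:P) * G ('X - j%:~R%:P)) ^+ 2.
(* The relation holds for all integers m > 2j, hence identically in m, and may be evaluated at m =
   0. There g(0) = 0 and [E j] becomes - (j g(-j))^2; now g(-1) = 2z and g(-2) = 4z - 6w give first
   z = 0, then w = 0. *)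
have E0 j : 0 < j -> (E j).[0] = 0.
  move=> j0; rewrite (@poly_eq0_progression _ (E j) (2 * j + 1)%:~R 1);
    rewrite ?oner_neq0 ?horner0 // => k.
  have := @rk1 (2 * j + 1 + k%:Z) j j0 ltac:(lia).
  by rewrite /E /G !hornerE !(intrD, intrM, intrB) -!pmulrn => e; lc e.
have z0 : z = 0.
  have := E0 1 isT; rewrite /E /G !hornerE => e.
  have : - 4 * z ^+ 2 = 0 by lc e.
  by move/eqP; rewrite mulf_eq0 oppr_eq0 pnatr_eq0 expf_eq0 /= => /eqP.
split=> //; have := E0 2 isT; rewrite /E /G !hornerE z0 => e.
have : - 144 * w ^+ 2 = 0 by lc e.
by move/eqP; rewrite mulf_eq0 oppr_eq0 pnatr_eq0 expf_eq0 /= => /eqP.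
Qed.

End Singular.
End VirasoroData.

(** * Scalars of degree zero along a ray *)

Section VirasoroSupport.
Variable F : numClosedFieldType.
Implicit Types (s : int -> bool) (a C h : F) (l : int -> int -> F).
Implicit Types (m n t r : int).

(** The involution L(n) |-> - L(-n), C_L |-> - C_L of the Virasoro algebra reverses the grading; it
    turns each statement on raising operators into one on lowering operators. *)
Lemma vd_flip s a l C : vir_data s a l C ->
  vir_data (fun t => s (- t)) (- a) (fun n t => - l (- n) (- t)) (- C).
Proof.
move=> D; split.
- by move=> n t; rewrite oppr_eq0 => /(vd_supp D); rewrite opprD.
- by move=> t st; rewrite oppr0 (vd_L0 D) //; ring.
- move=> m n t st; have := vd_br D (- m) (- n) st.
  rewrite -!opprD oppr_eq0 => e; lc e.
Qed.

(* Scalars by which L(-1)L(1), L(-2)L(2), L(-1)^2 L(2) and L(-2)L(1)^2 act on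
   the line of index [t]. *)
Definition loop1 l t : F := l 1 t * l (- 1) (t + 1).
Definition loop2 l t : F := l 2 t * l (- 2) (t + 2).
Definition loop2N11 l t : F := l 2 t * l (- 1) (t + 2) * l (- 1) (t + 1).
Definition loop11N2 l t : F := l 1 t * l 1 (t + 1) * l (- 2) (t + 2).

(** Each side runs once through the same six arrows between the lines t, t + 1 and t + 2. *)
Lemma loop_prod l t :
  loop2N11 l t * loop11N2 l t = loop1 l t * loop1 l (t + 1) * loop2 l t.
Proof.
rewrite /loop2N11 /loop11N2 /loop1 /loop2 (_ : t + 1 + 1 = t + 2);
  first by ring.
by lia.
Qed.

Section Loops.
Variables (s : int -> bool) (a C : F) (l : int -> int -> F).
Hypothesis D : vir_data s a l C.

(** L(1) L(-1) on e_(t+1) has the same scalar as L(-1) L(1) on e_t, so consecutive loops differ by a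
    commutator. The next three lemmas work in the same way. *)
Lemma loop1_step t t' : s t' -> t' = t + 1 ->
  loop1 l t' = loop1 l t + 2 * (a + t'%:~R).
Proof.
move=> st e; rewrite /loop1 -e.
have := vd_bracket0 D (m := - 1) (n := 1) (t := t') (p := t' + 1) (q := t) st.
by move=> ->; [ring|lia..].
Qed.

Lemma loop2_step t t' : s t' -> t' = t + 2 ->
  loop2 l t' = loop2 l t + 4 * (a + t'%:~R) - 2^-1 * C.
Proof.
move=> st e; rewrite /loop2 -e.
have := vd_bracket0 D (m := - 2) (n := 2) (t := t') (p := t' + 2) (q := t) st.
by move=> ->; [field; rewrite ?pnatr_eq0|lia..].
Qed.

Lemma loop2N11_step t t' : s t' -> t' = t + 1 ->
  loop2N11 l t' = loop2N11 l t + 3 * loop1 l t'.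
Proof.
move=> st e; rewrite /loop2N11 /loop1 -e (_ : t + 2 = t' + 1); last by lia.
have := vd_bracket D (m := - 1) (n := 2) (t := t') (p := t' + 2) (q := t) (r :=
  1) st.
by move=> ->; [ring|lia..].
Qed.

Lemma loop11N2_step t t' : s (t' + 1) -> t' = t + 1 ->
  loop11N2 l t' = loop11N2 l t + 3 * loop1 l t'.
Proof.
move=> st e; rewrite /loop11N2 /loop1 -e (_ : t + 2 = t' + 1); last by lia.
have := vd_bracket D (m := - 2) (n := 1) (t := t' + 1) (p := t' + 2) (q := t)
  (r := - 1) st.
move=> H; rewrite -mulrA H; [|lia..].
by ring.
Qed.

Lemma pos_eq0 t : s t -> l 1 t = 0 -> l 2 t = 0 -> forall m, 0 < m -> l m t = 0.
Proof.
move=> st l1 l2; suff H (k : nat) : l (k.+1%:Z) t = 0.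
  by case=> // -[|m] // _; apply: H.
elim: k => [|[|k] IH] //.
have := vd_bracket D (m := 1) (n := k.+2%:Z) (t := t) (p := k.+2%:Z + t) (q :=
  1 + t)
  (r := k.+3%:Z) st.
rewrite IH l1 !mul0r add0r => /(_ erefl erefl ltac:(lia) ltac:(lia))/esym/eqP.
by rewrite mulf_eq0 intr_eq0 => /orP[|/eqP //]; lia.
Qed.

Lemma highest_weight t : s t -> l 1 t = 0 -> l 2 t = 0 ->
  a + t%:~R = 0 /\ C = 0.
Proof.
move=> st l1 l2; apply: (singular_weight D st) => m k m0 _.
by rewrite (pos_eq0 st l1 l2) ?mul0r.
Qed.

End Loops.

Section Flipped.
Variables (s : int -> bool) (a C : F) (l : int -> int -> F).
Hypothesis D : vir_data s a l C.

Lemma neg_eq0 t : s t -> l (- 1) t = 0 -> l (- 2) t = 0 ->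
  forall m, m < 0 -> l m t = 0.
Proof.
move=> st l1 l2 m m0; apply: oppr_inj; rewrite oppr0.
have := @pos_eq0 _ _ _ _ (vd_flip D) (- t) _ _ _ (- m).
by rewrite !opprK; apply=> //; rewrite ?l1 ?l2 ?oppr0 //; lia.
Qed.

Lemma lowest_weight t : s t -> l (- 1) t = 0 -> l (- 2) t = 0 ->
  a + t%:~R = 0 /\ C = 0.
Proof.
move=> st l1 l2.
have := @highest_weight _ _ _ _ (vd_flip D) (- t).
rewrite !opprK l1 l2 oppr0 => /(_ st erefl erefl)[e /eqP].
rewrite oppr_eq0 => /eqP ->; split=> //; lc1 (-1 : F) e.
Qed.

(* In terms of [T = a + t] and [u = T + 1] these are the values on A_{a,b} with
   [q = b^2 - b] and [c = (2b - 1) q]. *)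
Definition loop_formulas q c t := let T := a + t%:~R in let u := T + 1 in
  [/\ loop1 l t = T ^+ 2 + T - q, loop2 l t = u ^+ 2 - 4 * q - 1,
      loop2N11 l t = u ^+ 3 - (1 + 3 * q) * u + c
    & loop11N2 l t = u ^+ 3 - (1 + 3 * q) * u - c].

(* The step relations make the four loops polynomial in [t] up to integration
   constants; [loop_prod], an identity of polynomials, fixes the constants. *)
Lemma ray_formulas r : (forall t, r <= t -> s t) ->
  C = 0 /\ exists q c, c ^+ 2 = (4 * q + 1) * q ^+ 2 /\
    forall t, r <= t -> loop_formulas q c t.
Proof.
move=> sr; pose T := a + r%:~R; pose w := 4^-1 * C.
have wE : 2^-1 * C = 2 * w by rewrite /w; field; rewrite ?pnatr_eq0.
pose q := T ^+ 2 + T - loop1 l r.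
pose cx := loop2N11 l r - ((T + 1) ^+ 3 - (1 + 3 * q) * (T + 1)).
pose cy := loop11N2 l r - ((T + 1) ^+ 3 - (1 + 3 * q) * (T + 1)).
have L1 (k : nat) : loop1 l (r + k%:Z) = (T + k%:R) ^+ 2 + (T + k%:R) - q.
  elim: k => [|k IH]; first by rewrite !addr0 /q; ring.
  rewrite (loop1_step D (t := r + k%:Z)) ?IH; [|by apply: sr; lia|by lia].
  by rewrite intrD -pmulrn /T; ring.
have LX (k : nat) : loop2N11 l (r + k%:Z)
    = (T + k%:R + 1) ^+ 3 - (1 + 3 * q) * (T + k%:R + 1) + cx.
  elim: k => [|k IH]; first by rewrite !addr0 /cx; ring.
  rewrite (loop2N11_step D (t := r + k%:Z)) ?IH ?L1; [|by apply: sr;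
    lia|by lia].
  by ring.
have LY (k : nat) : loop11N2 l (r + k%:Z)
    = (T + k%:R + 1) ^+ 3 - (1 + 3 * q) * (T + k%:R + 1) + cy.
  elim: k => [|k IH]; first by rewrite !addr0 /cy; ring.
  rewrite (loop11N2_step D (t := r + k%:Z)) ?IH ?L1; [|by apply: sr;
    lia|by lia].
  by ring.
pose U (p : nat) := T + p%:R + 1.
(* The difference of [loop2] is known over two steps only, hence one integration constant for each
   parity [p]. *)
pose hp p := loop2 l (r + p%:Z) - (U p ^+ 2 - w * U p).
have L2 p (k : nat) : loop2 l (r + (p + 2 * k)%N%:Z)
    = (U p + k%:R * 2) ^+ 2 - w * (U p + k%:R * 2) + hp p.
  elim: k => [|k IH]; first by rewrite muln0 addn0 /hp; ring.
  rewrite (loop2_step D (t := r + (p + 2 * k)%N%:Z)) ?IH ?wE;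
    [|by apply: sr; lia|by lia].
  by rewrite intrD -pmulrn /U /T natrD natrM; ring.
have key p : [/\ w = 0, hp p = - (4 * q + 1), cx + cy = 0
    & cx * cy = q ^+ 2 * hp p].
  pose A := - (1 + 3 * q).
  (* Coefficients, constant term first, of the difference of the two sides of [loop_prod] as a
     polynomial in u = T + 1 + p + 2k; the terms u^6 cancel. The three highest give w = 0, the value
     of [hp p] and cx + cy = 0, the constant one the equation for c. *)
  pose e : seq F := [:: cx * cy - q ^+ 2 * hp p; A * (cx + cy) + q ^+ 2 * w;
    A ^+ 2 + (1 + 2 * q) * hp p - q ^+ 2; cx + cy - (1 + 2 * q) * w;
    2 * A - hp p + (1 + 2 * q); w].
  have e0 : forall i, e`_i = 0.
    apply: (coef_eq0_progression (x := U p) (d := 2));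
      first by rewrite pnatr_eq0.
    move=> k; have := loop_prod l (r + (p + 2 * k)%N%:Z).
    rewrite LX LY L1 L2 (_ : _ + 1 = r + (p + 2 * k).+1%:Z); last by lia.
    by rewrite L1 /= /U /A -natr1 natrD natrM => E; lc E.
  have w0 : w = 0 := e0 5.
  have h0 : hp p = - (4 * q + 1) by have := e0 4; rewrite /= /A => E;
    lc1 (-1 : F) E.
  split=> //; first by have := e0 3; rewrite /= w0 => E; lc E.
  by have := e0 0; rewrite /= => E; lc E.
have [w0 h0 cxy cq] := key 0.
have [_ h1 _ _] := key 1%N.
have C0 : C = 0.
  by move/eqP: w0; rewrite /w mulf_eq0 invr_eq0 pnatr_eq0 /= => /eqP.
split=> //; exists q, cx; split.
  by rewrite h0 in cq; lc2 cx cxy (-1 : F) cq.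
move=> t rt; have [k ->] : exists k : nat, t = r + k%:Z by exists `|t - r|%N;
  lia.
have TE : a + (r + k%:Z)%:~R = T + k%:R by rewrite intrD -pmulrn /T addrA.
split; rewrite TE.
- exact: L1.
- have [p [j [p2 ->]]] : exists p j, (p < 2)%N /\ k = (p + 2 * j)%N.
    by exists (k %% 2)%N, (k %/ 2)%N; lia.
  rewrite L2 w0 natrD natrM /U.
  by case: p p2 => [|[|]] // _; rewrite ?h0 ?h1; ring.
- exact: LX.
- by rewrite LY; lc1 (1 : F) cxy.
Qed.

End Flipped.
End VirasoroSupport.

(** * The support *)

Section Support.

Lemma last_before (s : int -> bool) p t : p < t -> s p ->
  exists2 p', p <= p' < t & s p' /\ forall r, p' < r < t -> ~~ s r.
Proof.
have [k] := ubnP `|t - p|%N; elim: k p => // k IH p pk pt sp.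
have [[r [pr rt] sr]|no] := pselect (exists2 r, p < r /\ r < t & s r).
  have [p' pp' H] := IH r ltac:(lia) ltac:(lia) sr.
  by exists p' => //; lia.
exists p; first by lia.
by split=> // r /andP[pr rt]; apply/negP => sr; apply: no; exists r.
Qed.

Lemma first_after (s : int -> bool) p t : t < p -> s p ->
  exists2 p', t < p' <= p & s p' /\ forall r, t < r < p' -> ~~ s r.
Proof.
move=> tp sp; have [||p' pp' [sp' H]] := @last_before (fun t => s (- t)) (- p)
  (- t).
- by lia.
- by rewrite opprK.
exists (- p'); first by lia.
by split=> // r rr; rewrite -[r]opprK H //; lia.
Qed.

Variable F : numClosedFieldType.
Implicit Types (s : int -> bool) (a C h : F) (l : int -> int -> F).
Implicit Types (m n t r : int).

Lemma addz_eq0_inj a m n : a + m%:~R = 0 -> a + n%:~R = 0 -> m = n.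
Proof. by move=> <- /addrI/intr_inj. Qed.

Section Gaps.
Variables (s : int -> bool) (a C : F) (l : int -> int -> F).
Hypothesis D : vir_data s a l C.

(** Two adjacent missing weights suffice to stop L(1) and L(2), which generate the raising
    operators; the last weight below them is therefore a highest weight. *)
Lemma gap_below t p : ~~ s t -> ~~ s (t + 1) -> p < t -> s p ->
  exists2 p', p <= p' < t & [/\ s p', a + p'%:~R = 0, C = 0
    & forall r, p' < r <= t + 1 -> ~~ s r].
Proof.
move=> st st1 pt sp; have [p' pp' [sp' gap]] := last_before pt sp.
have {}gap r : p' < r <= t + 1 -> ~~ s r.
  move=> pr; have [->//|rt] := eqVneq r t.
  by have [->//|rt1] := eqVneq r (t + 1); apply: gap; lia.
exists p' => //.
have [] := @highest_weight _ _ _ _ _ D p' sp' _ _ => //.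
  by apply: (vd0r D (u := p' + 1)); [lia|apply: gap; lia].
by apply: (vd0r D (u := p' + 2)); [lia|apply: gap; lia].
Qed.

(** Nothing leaves e_p downwards, since L(-1) e_p or else L(-2) e_p would be a highest weight vector
    of nonzero weight. The next weight below can then be raised only to e_p, from where nothing is
    lowered, and [singular_weight] excludes it. *)
Lemma highest_weight_isolated p : s p -> a + p%:~R = 0 -> C = 0 ->
  (forall r, p < r -> ~~ s r) -> forall r, s r -> r = p.
Proof.
move=> sp ap C0 gap.
have l0 m t : p < m + t -> l m t = 0.
  by move=> pm; apply: (vd0r D (u := m + t)) => //; apply: gap.
have wN t : t != p -> a + t%:~R != 0.
  by move=> tp; apply/eqP => at0; case/eqP: tp; apply: addz_eq0_inj at0 ap.
have lN1 : l (- 1) p = 0.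
  apply/eqP/negPn/negP => lp.
  have := loop1_step D (t := p - 1) (t' := p) sp ltac:(lia).
  rewrite ap mulr0 addr0 /loop1 subrK l0; last by lia.
  rewrite mul0r => /esym/eqP; rewrite mulf_eq0 (negPf lp) orbF => /eqP l1.
  have /andP[_ sp1] := vd_supp D lp.
  rewrite addrC in l1; have l2 : l 2 (- 1 + p) = 0 by apply: l0; lia.
  have [e _] := highest_weight D sp1 l1 l2.
  by move: (wN (- 1 + p)); rewrite e eqxx; lia.
have lN2 : l (- 2) p = 0.
  apply/eqP/negPn/negP => lp.
  have := loop2_step D (t := p - 2) (t' := p) sp ltac:(lia).
  rewrite ap C0 !mulr0 subr0 addr0 /loop2 subrK l0; last by lia.
  rewrite mul0r => /esym/eqP; rewrite mulf_eq0 (negPf lp) orbF => /eqP l2.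
  have /andP[_ sp2] := vd_supp D lp.
  have := vd_bracket D (m := 1) (n := - 2) (p := - 2 + p) (q := p + 1) (r := -
    1) sp.
  rewrite lN1 (l0 1 p) ?mul0r ?mulr0 ?addr0; last by lia.
  move=> /(_ erefl ltac:(lia) erefl isT)/eqP.
  rewrite mulf_eq0 (negPf lp) => /eqP l1.
  rewrite addrC in l2; have [e _] := highest_weight D sp2 l1 l2.
  by move: (wN (- 2 + p)); rewrite e eqxx; lia.
move=> r sr; apply/eqP/negPn/negP => rp; have {}rp : r < p.
  by case: (ltgtP r p) rp => // pr _; move: (gap r pr); rewrite sr.
have [q rq [sq between]] := last_before rp sr.
have [|e _] := @singular_weight _ _ _ _ _ D q sq; last first.
  by move: (wN q); rewrite e eqxx; lia.
move=> m k m0 k0; have [mq|mq] := eqVneq (m + q) p.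
  by rewrite mq (neg_eq0 D sp lN1 lN2) ?mulr0 //; lia.
rewrite (vd0r D (u := m + q)) ?mul0r //.
have [mqp|mqp] := ltP (m + q) p; [apply: between|apply: gap]; lia.
Qed.

(* These loops do not exclude the weight - 2/3; the ray on the other side of the
   hole will. *)
Lemma hole_ray t : ~~ s t -> (forall r, t < r -> s r) ->
  C = 0 /\ (a + t%:~R = 0 \/ 3 * (a + t%:~R) = - 2).
Proof.
move=> st sr; have [|C0 [q [c [_ H]]]] := @ray_formulas _ _ _ _ _ D (t + 1).
  by move=> r tr; apply: sr; lia.
split=> //; set w := a + t%:~R.
have [L1 _ _ _] := H (t + 1) ltac:(lia);
  have [_ L2 _ _] := H (t + 2) ltac:(lia).
have := loop1_step D (t := t) (t' := t + 1) (sr (t + 1) ltac:(lia)) erefl.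
have := loop2_step D (t := t) (t' := t + 2) (sr (t + 2) ltac:(lia)) erefl.
rewrite L1 L2 /loop1 /loop2 !(vd0l D _ st) !intrD C0 => E2 E1.
have : w * (3 * w + 2) = 0 by rewrite /w; lc2 (- 1 : F) E2 (4 : F) E1.
move/eqP; rewrite mulf_eq0 => /orP[/eqP|/eqP E]; [by left|right].
by lc E.
Qed.

(** [loop1] vanishes both at t and at t' - 1, so its differences, twice the weights strictly between
    the holes, add up to 0: the mean weight is 0. *)
Lemma hole_hole t t' : ~~ s t -> ~~ s t' -> t + 1 < t' ->
  (forall r, t < r < t' -> s r) -> (a + t%:~R) + (a + t'%:~R) = 0.
Proof.
move=> st st' tt' sr; set w := a + t%:~R.
have L (k : nat) : t + k%:Z < t' -> loop1 l (t + k%:Z) = k%:R * (2 * w + k%:R +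
  1).
  elim: k => [|k IH] kt; first by rewrite /loop1 addr0 (vd0l D _ st) !mul0r.
  rewrite (loop1_step D (t := t + k%:Z)) ?IH; [|lia|by apply: sr; lia|lia].
  by rewrite /w intrD -pmulrn; ring.
have [k kE] : exists k : nat, t' = t + k.+2%:Z by exists `|(t' - t - 2)%R|%N;
  lia.
have := L k.+1 ltac:(lia).
rewrite /loop1 (vd0r D (u := t')); [|lia|by []].
rewrite mul0r => /esym/eqP; rewrite mulf_eq0 pnatr_eq0 /= => /eqP e.
by rewrite /w in e *; rewrite kE intrD -pmulrn; lc e.
Qed.

End Gaps.

(** The nearest weights on the two sides of the gap would both be extremal, hence both equal to 0.
    So only one side is inhabited, and [highest_weight_isolated] applies to it. *)
Lemma double_gap s a C l t p : vir_data s a l C -> ~~ s t -> ~~ s (t + 1) -> s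
  p ->
  a + p%:~R = 0 /\ forall r, s r -> r = p.
Proof.
move=> D; wlog pt : s a C l D t p / p < t => [W|] st st1 sp.
  have pNt : p != t by apply: contraNneq st => <-.
  have pNt1 : p != t + 1 by apply: contraNneq st1 => <-.
  have [|tp] := ltP p t; first by move=> pt; apply: W D _ _ pt _ _ _.
  have [||||e H] := W _ _ _ _ (vd_flip D) (- t - 1) (- p).
  - by lia.
  - by rewrite (_ : - _ = t + 1) //; lia.
  - by rewrite (_ : - _ = t) //; lia.
  - by rewrite opprK.
  split=> [|r sr]; first by lc1 (-1 : F) e.
  by apply: oppr_inj; apply: H; rewrite opprK.
have [p' /andP[pp' p't] [sp' ap' C0 gap]] := gap_below D st st1 pt sp.
have above r : p' < r -> ~~ s r.
  move=> p'r; apply/negP => sr; have rt : t + 1 < r.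
    by rewrite ltNge; apply/negP => rt; move: (gap r);
      rewrite sr p'r rt => /(_ isT).
  have [||||q /andP[_ qt] [_ aq _ _]] := gap_below (vd_flip D) (t := - t - 1)
    (p := - r).
  - by rewrite (_ : - _ = t + 1) //; lia.
  - by rewrite (_ : - _ = t) //; lia.
  - by lia.
  - by rewrite opprK.
  have /addz_eq0_inj/(_ ap') : a + (- q)%:~R = 0 by lc1 (-1 : F) aq.
  by lia.
have iso := highest_weight_isolated D sp' ap' C0 above.
by rewrite (iso p sp).
Qed.

(** Consecutive holes have opposite weights, so three of them are impossible. With two, the upper
    one bounds a ray and has weight 0 or - 2/3 by [hole_ray]; then the holes would coincide or their
    distance would not be an integer. *)
Lemma ray_above_hole s a C l t : vir_data s a l C -> (forall r,
  s r || s (r + 1)) -> ~~ s t ->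
  forall r, t < r -> s r.
Proof.
move=> D nogap st r tr; apply/negPn/negP => sr.
have next u v : ~~ s u -> u < v -> ~~ s v -> exists t',
    [/\ ~~ s t', u + 1 < t' & (a + u%:~R) + (a + t'%:~R) = 0].
  move=> su uv sv; have [t' ut' [st' between]] := first_after (s := fun r => ~~
    s r) uv sv.
  exists t'; have ut1 : u + 1 < t'.
    rewrite lt_neqAle; apply/andP; split; last by lia.
    by apply: contraNneq st' => <-; move: (nogap u); rewrite (negPf su).
  split=> //; apply: (hole_hole D su st') => // v' uv'.
  by apply/negPn; apply: between.
have [t1 [st1 tt1 e1]] := next _ _ st tr sr.
have [ray|[t2 [st2 tt2]]] : (forall r, t1 < r -> s r) \/ exists t2,
    [/\ ~~ s t2, t1 + 1 < t2 & (a + t1%:~R) + (a + t2%:~R) = 0].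
  have [[v [tv sv]]|no] := pselect (exists v, t1 < v /\ ~~ s v).
    by right; apply: next sv.
  by left=> v tv; apply/negPn/negP => sv; apply: no; exists v.
  have [_ []] := hole_ray D st1 ray => e2.
    have /addz_eq0_inj/(_ e2) : a + t%:~R = 0 by lc2 (1 : F) e1 (-1 : F) e2.
    by lia.
  have : (3 * (t1 - t) + 4)%:~R = 0 :> F by lc2 (-3 : F) e1 (2 : F) e2.
  by move/eqP; rewrite intr_eq0; lia.
move=> e2; have : (t2 - t)%:~R = 0 :> F by lc2 (1 : F) e2 (-1 : F) e1.
by move/eqP; rewrite intr_eq0; lia.
Qed.

Theorem vir_support s a C l p : vir_data s a l C -> s p ->
  [\/ a + p%:~R = 0 /\ (forall r, s r -> r = p),
      C = 0 /\ (forall t, s t)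
    | C = 0 /\ exists t, [/\ ~~ s t, a + t%:~R = 0 & forall r, r != t -> s r]].
Proof.
move=> D sp.
have [[t /norP[st st1]]|ng] := pselect (exists t, ~~ (s t || s (t + 1))).
  by constructor 1; apply: (double_gap D st st1 sp).
have {}ng r : s r || s (r + 1).
  by apply/negPn/negP => nr; apply: ng; exists r.
have [[t st]|full] := pselect (exists t, ~~ s t); last first.
  have {}full t : s t by apply/negPn/negP => nt; apply: full; exists t.
  constructor 2; split=> //.
  by have [|] := @ray_formulas _ _ _ _ _ D 0.
have up := ray_above_hole D ng st.
have stN : ~~ s (- - t) by rewrite opprK.
have down := ray_above_hole (vd_flip D) (t := - t) _ stN.
have {}down r : - t < r -> s (- r).
  apply: down => {}r; move: (ng (- r - 1)).
  by rewrite subrK orbC (_ : - r - 1 = - (r + 1)) //; lia.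
have [C0 w1] := hole_ray D st up.
have [_ w2] := hole_ray (vd_flip D) stN down.
constructor 3; split=> //; exists t; split=> //.
  case: w1 w2 => // e1 [e2|e2]; first by lc1 (-1 : F) e2.
  have : 4 = 0 :> F by lc2 (1 : F) e1 (1 : F) e2.
  by move/eqP; rewrite pnatr_eq0.
move=> r rt; case: (ltgtP r t) rt => // rt _; last exact: up.
by rewrite -[r]opprK; apply: down; lia.
Qed.

End Support.

(** * Virasoro normal forms *)

Section NormalForms.
Variable F : numClosedFieldType.
Implicit Types (s : int -> bool) (a b C q c : F) (l ell iota : int -> int -> F).
Implicit Types (d rho h : int -> F) (m n t r : int).

(* The structure constants in the basis d_t e_t. *)
Definition rescale d l n t := l n t * d t / d (n + t).

Lemma vd_rescale s a l C d : (forall t, d t != 0) ->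
  vir_data s a l C -> vir_data s a (rescale d l) C.
Proof.
move=> d0 D; split.
- move=> n t H; apply: (vd_supp D); apply: contraNneq H => l0.
  by rewrite /rescale l0 !mul0r.
- by move=> t st; rewrite /rescale add0r mulfK ?(vd_L0 D).
- move=> m n t st; have := vd_br D m n st; rewrite /rescale.
  rewrite !addrA (addrC n m) => e.
  have E x y v w : v != 0 -> w != 0 -> x * d t / v * (y * v / w) = x * y * (d t
    / w) :> F.
    by move=> v0 w0; field; rewrite v0 w0.
  rewrite !E //.
  have [mn|mn] := eqVneq (m + n) 0; last first.
    move: e; rewrite (negPf mn) !mul0r !addr0 => e; lc1 (d t / d (m + n + t)) e.
  move: e; rewrite mn eqxx add0r mulfV // mulfK // => e; lc e.
Qed.

Lemma gauge_exists rho : (forall t, rho t != 0) ->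
  exists2 d, (forall t, d t != 0) & forall t, d (t + 1) = rho t * d t.
Proof.
move=> r0; pose up (n : nat) := \prod_(0 <= k < n) rho k%:Z.
pose down (n : nat) := \prod_(0 <= k < n) (rho (Negz k))^-1.
exists (fun t => match t with Posz n => up n | Negz n => down n.+1 end).
  by case=> n; rewrite prodf_seq_neq0; apply/allP => k _;
    rewrite /= ?invr_eq0 r0.
case=> [n|[|n]].
- have -> : n%:Z + 1 = n.+1%:Z by lia.
  by rewrite /up big_nat_recr //= mulrC.
- have -> : Negz 0 + 1 = 0%:Z by lia.
  by rewrite /up /down big_nat1 big_geq // mulfV.
- have -> : Negz n.+1 + 1 = Negz n by lia.
  have -> : down n.+2 = down n.+1 * (rho (Negz n.+1))^-1 by rewrite /down
    big_nat_recr.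
  by rewrite mulrCA mulfV ?mulr1.
Qed.

Lemma vir_data_unique s a l l' : vir_data s a l 0 -> vir_data s a l' 0 ->
  l 1 =1 l' 1 -> l 2 =1 l' 2 -> l (- 1) =1 l' (- 1) -> l (- 2) =1 l' (- 2) ->
  forall n, l n =1 l' n.
Proof.
have pos s0 a0 l0 l0' (D : vir_data s0 a0 l0 0) (D' : vir_data s0 a0 l0' 0) :
    l0 1 =1 l0' 1 -> l0 2 =1 l0' 2 -> forall k : nat, l0 k.+1%:Z =1 l0' k.+1%:Z.
  move=> e1 e2; elim=> [|[|k] IH] // t.
  have [st|st] := boolP (s0 t); last by rewrite (vd0l D) // (vd0l D').
  have := vd_bracket D (m := 1) (n := k.+2%:Z) (r := k.+3%:Z) st erefl erefl
    ltac:(lia) isT.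
  have := vd_bracket D' (m := 1) (n := k.+2%:Z) (r := k.+3%:Z) st erefl erefl
    ltac:(lia) isT.
  rewrite !IH !e1 => -> /addrI/mulfI -> //.
  by rewrite intr_eq0; lia.
move=> D D' e1 e2 eN1 eN2 n t; have [n0|n0|->] := ltgtP n 0; last first.
- have [st|st] := boolP (s t); first by rewrite (vd_L0 D) // (vd_L0 D').
  by rewrite (vd0l D) // (vd0l D').
- by case: n n0 => // -[|n] // _; apply: pos D D' e1 e2 n t.
case: n n0 => // n _; have Df := vd_flip D; have Df' := vd_flip D'.
rewrite oppr0 in Df Df'; apply: oppr_inj.
have := pos _ _ _ _ Df Df' _ _ n (- t); rewrite opprK NegzE; apply=> u /=;
  congr (- _).
  exact: eN1.
exact: eN2.
Qed.

Lemma vd_graded a ell iota : graded_axiom ell iota ->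
  (forall t, ell 0 t = a + t%:~R) -> vir_data xpredT a ell 0.
Proof.
case=> LL _ _ L0; split=> // m n t _.
by rewrite LL mulr0 addr0.
Qed.


(** A loop returns to its line, so the factors of [d] cancel. *)
Lemma rescale_loops d l q c a t : (forall t, d t != 0) ->
  loop_formulas a l q c t -> loop_formulas a (rescale d l) q c t.
Proof.
move=> d0 [L1 L2 LX LY].
have E1 : 1 + t = t + 1 := addrC _ _.
have E2 : 2 + t = t + 2 := addrC _ _.
have E3 : - 1 + (t + 1) = t by lia.
have E4 : - 2 + (t + 2) = t by lia.
have E5 : - 1 + (t + 2) = t + 1 by lia.
have E6 : 1 + (t + 1) = t + 2 by lia.
split.
- by rewrite -L1 /loop1 /rescale E1 E3; field; rewrite !d0.
- by rewrite -L2 /loop2 /rescale E2 E4; field; rewrite !d0.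
- by rewrite -LX /loop2N11 /rescale E2 E5 E3; field; rewrite !d0.
- by rewrite -LY /loop11N2 /rescale E1 E6 E4; field; rewrite !d0.
Qed.

(** Parametrization of the nodal cubic by the slope 2b - 1 = c / q, a square root of 4q + 1. The
    value of q alone does not tell b from 1 - b; the sign of c does. *)
Lemma loop_parameter q c : c ^+ 2 = (4 * q + 1) * q ^+ 2 ->
  exists b, q = b ^+ 2 - b /\ c = (2 * b - 1) * q.
Proof.
move=> cq; pose r := sqrtC (4 * q + 1).
have rr : r ^+ 2 = 4 * q + 1 by apply: sqrtCK.
have : (c - r * q) * (c + r * q) = 0 by lc2 (1 : F) cq (- q ^+ 2) rr.
have two : 2 != 0 :> F by rewrite pnatr_eq0.
move/eqP; rewrite mulf_eq0 => /orP[] /eqP e.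
  exists ((1 + r) / 2); split; last by apply: (eq_lincomb e); field.
  by apply: (eq_lincomb (eq_scale (- (4^-1)) rr)); field; rewrite ?pnatr_eq0.
exists ((1 - r) / 2); split; last by apply: (eq_lincomb e); field.
by apply: (eq_lincomb (eq_scale (- (4^-1)) rr)); field; rewrite ?pnatr_eq0.
Qed.

(** * Reconstruction of A_{a,b} from its loops, for b other than 0, 1 or without a zero weight *)

Section Generic.
Variables (s : int -> bool) (a b : F) (l : int -> int -> F).
Let q := b ^+ 2 - b.
Hypothesis D : vir_data s a l 0.
Hypothesis full : forall t, s t.
Hypothesis L : forall t, loop_formulas a l q ((2 * b - 1) * q) t.
Hypothesis gen : forall t, a + t%:~R != 0 \/ (b != 0) && (b != 1).

Local Notation T t := (a + t%:~R).

Lemma gen_factors t : [/\ loop1 l t = (T t + b) * (T t + 1 - b),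
  loop2 l t = (T t + 2 * b) * (T t + 2 - 2 * b),
  loop2N11 l t = (T t + 2 * b) * (T t + 2 - b) * (T t + 1 - b)
 & loop11N2 l t = (T t + 2 - 2 * b) * (T t + b) * (T t + 1 + b)].
Proof. by have [-> -> -> ->] := L t; split; rewrite /q; ring. Qed.

Lemma gen_b0 t : T t = 0 -> b != 0 /\ b != 1.
Proof. by case: (gen t) => [/negPf tN /eqP|/andP//]; rewrite tN. Qed.

Lemma gen_half : 2 * b - 1 = 0 -> b = 2^-1.
Proof. by move=> e; apply: (eq_lincomb (eq_scale (2^-1) e)); field;
  rewrite ?pnatr_eq0. Qed.

(** For b = 0 or 1, a zero of such a linear factor would produce a zero weight, which [gen] admits
    only for other values of b. *)
Lemma gen_pole t (k m : int) : T t + k%:~R * b + m%:~R = 0 -> b != 0 /\ b != 1.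
Proof.
move=> e; split; apply/eqP => bE.
  have [|/eqP//] := @gen_b0 (t + m); rewrite intrD.
  by rewrite bE in e; lc e.
have [|_ /eqP//] := @gen_b0 (t + m + k); rewrite !intrD.
by rewrite bE in e; lc e.
Qed.


Lemma two_neq0 : 2 != 0 :> F. Proof. by rewrite pnatr_eq0. Qed.

Lemma subr1_neq0 : b != 1 -> 1 - b != 0.
Proof. by rewrite subr_eq0 eq_sym. Qed.

(** [loop1] vanishes, but either edge could be responsible. The other edge lies on [loop2N11] as
    well, which is nonzero unless b = 1/2; for b = 1/2 it is [loop11N2] that vanishes with its other
    two edges nonzero. *)
Lemma gen_up0 t : T t + b = 0 -> l 1 t = 0.
Proof.
move=> Tb; have [b0 /subr1_neq0 b1] : b != 0 /\ b != 1.
  by apply: (@gen_pole t 1 0); lc Tb.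
have TE : T t = - b by lc Tb.
have [L1 L2 LX LY] := gen_factors t.
have [bh|bh] := eqVneq (2 * b - 1) 0; last first.
  have lN : l (- 1) (t + 1) != 0.
    have : loop2N11 l t != 0.
      rewrite LX TE (_ : _ * _ = - (2 * b * (1 - b) * (2 * b - 1)));
        last by ring.
      by rewrite oppr_eq0 !mulf_neq0 // two_neq0.
    by rewrite /loop2N11 mulf_eq0 negb_or => /andP[].
  by apply: (mulIf lN); rewrite mul0r -[LHS]/(loop1 l t) L1 TE; ring.
have bE := gen_half bh.
have [L1' _ _ _] := gen_factors (t + 1).
have l1 : l 1 (t + 1) != 0.
  have : loop1 l (t + 1) != 0.
    rewrite L1' intrD (_ : _ * _ = 1) ?oner_neq0 //.
    by rewrite addrA TE bE; field; rewrite ?pnatr_eq0.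
  by rewrite /loop1 mulf_eq0 negb_or => /andP[].
have l2 : l (- 2) (t + 2) != 0.
  have : loop2 l t != 0.
    rewrite L2 TE bE (_ : _ * _ = 4^-1) ?invr_eq0 ?pnatr_eq0 //.
    by field; rewrite ?pnatr_eq0.
  by rewrite /loop2 mulf_eq0 negb_or => /andP[].
apply: (mulIf (mulf_neq0 l1 l2)); rewrite mul0r mulrA -[LHS]/(loop11N2 l t).
by rewrite LY Tb mulr0 mul0r.
Qed.

Lemma gen_down0 t : T t + 1 - b = 0 -> l (- 1) (t + 1) = 0.
Proof.
move=> Tb; have [b0 /subr1_neq0 b1] : b != 0 /\ b != 1.
  by apply: (@gen_pole t (- 1) 1); lc Tb.
have TE : T t = b - 1 by lc Tb.
have [L1 L2 LX LY] := gen_factors t.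
have [bh|bh] := eqVneq (2 * b - 1) 0; last first.
  have lN : l 1 t != 0.
    have : loop11N2 l t != 0.
      rewrite LY TE (_ : _ * _ = 2 * b * (1 - b) * (2 * b - 1)); last by ring.
      by rewrite !mulf_neq0 // two_neq0.
    by rewrite /loop11N2 !mulf_eq0 !negb_or => /andP[/andP[]].
  by apply: (mulfI lN); rewrite mulr0 -[LHS]/(loop1 l t) L1 TE; ring.
have bE := gen_half bh.
have [L1' _ _ _] := gen_factors (t + 1).
have l1 : l (- 1) (t + 2) != 0.
  have : loop1 l (t + 1) != 0.
    rewrite L1' intrD (_ : _ * _ = 1) ?oner_neq0 //.
    by rewrite addrA TE bE; field; rewrite ?pnatr_eq0.
  by rewrite /loop1 (_ : t + 1 + 1 = t + 2) ?mulf_eq0 ?negb_or => [/andP[]|];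
    last lia.
have l2 : l 2 t != 0.
  have : loop2 l t != 0.
    rewrite L2 TE bE (_ : _ * _ = 4^-1) ?invr_eq0 ?pnatr_eq0 //.
    by field; rewrite ?pnatr_eq0.
  by rewrite /loop2 mulf_eq0 negb_or => /andP[].
apply: (mulfI (mulf_neq0 l2 l1)); rewrite mulr0 -[LHS]/(loop2N11 l t).
by rewrite LX Tb mulr0.
Qed.

(** L(2) is read off from [loop2N11] where the L(-1) edges are nonzero, otherwise from [loop2] and
    [loop11N2]. Both ways fail only for b = 1/2 at T = -1/2, where L(1) and L(-1) do not connect the
    two lines and the value is a choice of gauge (the last hypothesis), and at T = -3/2, where
    [L(-1), L(2)] one line higher reduces to that choice. *)
Lemma gen_edges2 : (forall t, l 1 t = T t + b) -> (forall t,
  l (- 1) t = T t - b) ->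
  (forall t, T t + b = 0 -> 2 * b - 1 = 0 -> l 2 t = T t + 2 * b) ->
  (forall t, l 2 t = T t + 2 * b) /\ (forall t, l (- 2) t = T t - 2 * b).
Proof.
move=> l1 lN1 half; have l2 t : l 2 t = T t + 2 * b.
  have [L1 L2 LX LY] := gen_factors t.
  have T1 : (T (t + 1) - b) = T t + 1 - b by rewrite intrD; ring.
  have T2 : (T (t + 2) - b) = T t + 2 - b by rewrite intrD; ring.
  have T1' : (T (t + 1) + b) = T t + 1 + b by rewrite intrD; ring.
  rewrite /loop2N11 !lN1 T1 T2 in LX.
  rewrite /loop11N2 !l1 T1' in LY.
  have fromN2 : T t + b != 0 -> T t + 1 + b != 0 -> T t + 2 - 2 * b != 0 ->
      l 2 t = T t + 2 * b.
    move=> n1 n2 n3; apply: (mulIf n3); rewrite -L2 /loop2; congr (_ * _).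
    apply: (mulfI (mulf_neq0 n1 n2)); lc1 (-1 : F) LY.
  have [e1|n1] := eqVneq (T t + 1 - b) 0.
    have TE : T t = b - 1 by lc e1.
    have [b0 /subr1_neq0 b1] : b != 0 /\ b != 1.
      by apply: (@gen_pole t (- 1) 1); lc e1.
    have [bh|bh] := eqVneq (2 * b - 1) 0; first by apply: half => //;
      lc2 (1 : F) e1 (1 : F) bh.
    by apply: fromN2; rewrite TE;
      [rewrite (_ : _ + b = 2 * b - 1)|rewrite (_ : _ + b = 2 * b)
      |rewrite (_ : _ - _ = 1 - b)]; rewrite ?mulf_neq0 ?two_neq0 //; ring.
  have [e2|n2] := eqVneq (T t + 2 - b) 0; last first.
    by apply: (mulIf n2); apply: (mulIf n1).
  have TE : T t = b - 2 by lc e2.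
  have [b0 /subr1_neq0 b1] : b != 0 /\ b != 1.
    by apply: (@gen_pole t (- 1) 2); lc e2.
  have [bh|bh] := eqVneq (2 * b - 1) 0; last first.
    apply: fromN2; rewrite TE.
    - rewrite (_ : _ + b = - (2 * (1 - b))); last by ring.
      by rewrite oppr_eq0 mulf_neq0 ?two_neq0.
    - by rewrite (_ : _ + b = 2 * b - 1) //; ring.
    - by rewrite (_ : _ - _ = - b) ?oppr_eq0 //; ring.
  have := vd_bracket D (m := - 1) (n := 2) (t := t + 1) (p := t + 3) (q := t)
    (r := 1)
            (full _) ltac:(lia) ltac:(lia) ltac:(lia) isT.
  have TE1 : T (t + 1) = b - 1 by rewrite intrD; lc e2.
  have TE3 : T (t + 3) = b + 1 by rewrite intrD; lc e2.
  rewrite !lN1 l1 half ?TE1 ?TE3 ?TE //; last by lc bh.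
  rewrite (gen_half bh) => e.
  by apply: (eq_lincomb e); field; rewrite ?pnatr_eq0.
split=> // t; have [u ->] : exists u, t = u + 2 by exists (t - 2); lia.
have [_ L2 _ LY] := gen_factors u.
have T1' : (T (u + 1) + b) = T u + 1 + b by rewrite intrD; ring.
rewrite /loop11N2 !l1 T1' in LY; rewrite /loop2 l2 in L2.
have -> : T (u + 2) - 2 * b = T u + 2 - 2 * b by rewrite intrD; ring.
have [e|n] := eqVneq (T u + 2 * b) 0; last by apply: (mulfI n).
have [b0 /subr1_neq0 b1] : b != 0 /\ b != 1 by apply: (@gen_pole u 2 0); lc e.
have TE : T u = - (2 * b) by lc e.
have n1 : T u + b != 0 by rewrite TE (_ : _ + b = - b) ?oppr_eq0 //; ring.
have n2 : T u + 1 + b != 0 by rewrite TE (_ : _ + b = 1 - b) //; ring.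
apply: (mulfI (mulf_neq0 n1 n2)); lc LY.
Qed.

Lemma gen_up_neq0 t : T t + b != 0 -> l 1 t != 0.
Proof.
move=> n; have [L1 _ _ LY] := gen_factors t.
have [e|n1] := eqVneq (T t + 1 - b) 0; last first.
  by have := mulf_neq0 n n1; rewrite -L1 /loop1 mulf_eq0 negb_or => /andP[].
have [b0 /subr1_neq0 b1] : b != 0 /\ b != 1 by apply: (@gen_pole t (- 1) 1);
  lc e.
have : loop11N2 l t != 0.
  rewrite LY (_ : T t + 1 + b = 2 * b); last by lc e.
  rewrite (_ : T t + 2 - 2 * b = 1 - b); last by lc e.
  by rewrite !mulf_neq0 // two_neq0.
by rewrite /loop11N2 !mulf_eq0 !negb_or => /andP[/andP[]].
Qed.

Lemma gen_down_neq0 t : T t + 1 - b != 0 -> l (- 1) (t + 1) != 0.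
Proof.
move=> n; have [L1 _ LX _] := gen_factors t.
have [e|n1] := eqVneq (T t + b) 0; last first.
  by have := mulf_neq0 n1 n; rewrite -L1 /loop1 mulf_eq0 negb_or => /andP[].
have [b0 /subr1_neq0 b1] : b != 0 /\ b != 1 by apply: (@gen_pole t 1 0); lc e.
have : loop2N11 l t != 0.
  rewrite LX (_ : T t + 2 * b = b); last by lc e.
  rewrite (_ : T t + 2 - b = 2 * (1 - b)); last by lc e.
  by rewrite !mulf_neq0 // two_neq0.
by rewrite /loop2N11 !mulf_eq0 !negb_or => /andP[].
Qed.

Lemma gen_gauge : exists2 d, forall t, d t != 0 &
  [/\ forall t, rescale d l 1 t = T t + b, forall t,
    rescale d l (- 1) t = T t - b
    & forall t, T t + b = 0 -> 2 * b - 1 = 0 -> rescale d l 2 t = T t + 2 * b].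
Proof.
have half_neq0 t : T t + b = 0 -> T t + 1 - b = 0 ->
    b = 2^-1 /\ l 2 t != 0.
  move=> e1 e2; have bE : b = 2^-1 by apply: gen_half;
    lc2 (1 : F) e1 (- 1 : F) e2.
  split=> //; have : loop2 l t != 0.
    have [_ -> _ _] := gen_factors t; rewrite (_ : T t = - b); last by lc e1.
    rewrite bE (_ : _ * _ = 4^-1) ?invr_eq0 ?pnatr_eq0 //.
    by field; rewrite ?pnatr_eq0.
  by rewrite /loop2 mulf_eq0 negb_or => /andP[].
have up1_neq0 t : T t + b = 0 -> l 1 (t + 1) != 0.
  by move=> e; apply: gen_up_neq0;
    rewrite intrD (_ : _ + b = 1) ?oner_neq0 //; lc e.
(* The ratio of d at t + 1 and t is dictated by whichever of L(1), L(-1) is nonzero between the two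
   lines. In the last case, b = 1/2 and T = -1/2, neither is; the factor 2 then gives L(2) e_t the
   scalar T + 2b = 1/2. *)
pose rho t := if T t + b != 0 then l 1 t / (T t + b) else
  if T t + 1 - b != 0 then (T t + 1 - b) / l (- 1) (t + 1)
  else 2 * l 2 t / l 1 (t + 1).
have [t|d d0 dS] := @gauge_exists rho.
  rewrite /rho; case: ifPn => [n|/negPn/eqP e1].
    by rewrite mulf_neq0 ?invr_eq0 ?gen_up_neq0.
  case: ifPn => [n|/negPn/eqP e2].
    by rewrite mulf_neq0 ?invr_eq0 ?gen_down_neq0.
  have [_ l2] := half_neq0 t e1 e2.
  by rewrite !mulf_neq0 ?invr_eq0 ?two_neq0 ?up1_neq0.
exists d => //; split=> t.
- rewrite /rescale addrC dS /rho; case: ifPn => [n|/negPn/eqP e].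
    by have := gen_up_neq0 n => l1; field; rewrite l1 n d0.
  by rewrite gen_up0 // e !mul0r.
- have [u ->] : exists u, t = u + 1 by exists (t - 1); lia.
  rewrite /rescale (_ : - 1 + (u + 1) = u); last by lia.
  rewrite dS mulrA mulfK // intrD (_ : _ - b = T u + 1 - b); last by ring.
  have [e|n] := eqVneq (T u + 1 - b) 0; first by rewrite gen_down0 // e mul0r.
  rewrite /rho; case: ifPn => [n1|_].
    have [L1 _ _ _] := gen_factors u; apply: (mulIf n1).
    by rewrite mulrA divfK // mulrC -[LHS]/(loop1 l u) L1 mulrC.
  by rewrite n mulrCA mulfV ?mulr1 ?gen_down_neq0.
- move=> e bh; have e2 : T t + 1 - b = 0 by lc2 (1 : F) e (- 1 : F) bh.
  have [bE l2] := half_neq0 t e e2; have l1 := up1_neq0 t e.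
  rewrite /rescale (_ : 2 + t = t + 1 + 1); last by lia.
  rewrite !dS {2}/rho e eqxx /= e2 eqxx /= /rho intrD.
  rewrite (_ : _ + b = 1); last by lc e.
  rewrite oner_neq0 /= (_ : T t + 2 * b = b); last by lc e.
  by rewrite bE; field; rewrite ?pnatr_eq0 l1 l2 d0.
Qed.

End Generic.

Lemma generic_normal_form s a b l (q := b ^+ 2 - b) :
  vir_data s a l 0 -> (forall t, s t) ->
  (forall t, loop_formulas a l q ((2 * b - 1) * q) t) ->
  (forall t : int, a + t%:~R != 0 \/ (b != 0) && (b != 1)) ->
  exists2 d, forall t, d t != 0 & forall n t, rescale d l n t = A_ell a b n t.
Proof.
move=> D full L gen; have [d d0 [l1 lN1 half]] := gen_gauge L gen.
exists d => // ; have Dd := vd_rescale d0 D.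
have [] := @gen_edges2 s a b (rescale d l) Dd full _ gen l1 lN1 half.
  by move=> t; apply: rescale_loops.
move=> l2 lN2; have sE : s = xpredT by apply/funext => t; rewrite full.
have DA : vir_data s a (A_ell a b) 0.
  by rewrite sE; apply: (vd_graded (A_axiom a b 0)) => t; rewrite /A_ell; ring.
move=> n t; apply: (vir_data_unique Dd DA) => u;
  rewrite ?l1 ?l2 ?lN1 ?lN2 /A_ell; ring.
Qed.

End NormalForms.

(** * Integral weights with q = 0: the line of weight 0 *)

Section SpecialForms.
Variable F : numClosedFieldType.
Implicit Types (s : int -> bool) (a b C q c : F) (l : int -> int -> F).
Implicit Types (d h : int -> F) (m n t r u : int).

(* Twist by the automorphism L(n) |-> - L(-n), with e_t renamed e_(-t). *)
Definition flip l n t : F := - l (- n) (- t).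

Lemma flip_loops l t : [/\ loop1 (flip l) t = loop1 l (- t - 1),
  loop2 (flip l) t = loop2 l (- t - 2),
  loop2N11 (flip l) t = - loop11N2 l (- t - 2)
  & loop11N2 (flip l) t = - loop2N11 l (- t - 2)].
Proof.
rewrite /loop1 /loop2 /loop2N11 /loop11N2 /flip !opprK !subrK !opprD.
have -> : - t - 2 + 1 = - t - 1 by lia.
by split; ring.
Qed.

Lemma full_formulas s a C l : vir_data s a l C -> (forall t, s t) ->
  exists q c, c ^+ 2 = (4 * q + 1) * q ^+ 2 /\ forall t,
    loop_formulas a l q c t.
Proof.
move=> D full; have [_ [q [c [qc L]]]] := ray_formulas D (fun t (_ : 0 <= t) =>
  full t).
exists q, c; split=> // t; have [t0|/ltW t0] := leP 0 t; first exact: L.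
have [_ [q' [c' [_ L']]]] := ray_formulas D (fun u (_ : t <= u) => full u).
have [E1 _ E2 _] := L 0 (lexx 0); have [E1' _ E2' _] := L' 0 t0.
have qE : q' = q by move: E1; rewrite E1' => e; lc1 (-1 : F) e.
have cE : c' = c by move: E2; rewrite E2' qE => e; lc e.
by rewrite -qE -cE; apply: L'.
Qed.

(** The missing weight makes [loop1] vanish at 0, which forces q = 0 and then c = 0. *)
Lemma hole_loops l t : vir_data (fun t => t != 0) 0 l 0 -> 1 <= t ->
  [/\ loop1 l t = (t * (t + 1))%:~R, loop2 l t = (t * (t + 2))%:~R,
      loop2N11 l t = (t * (t + 1) * (t + 2))%:~R
    & loop11N2 l t = (t * (t + 1) * (t + 2))%:~R].
Proof.
move=> D t1; have [r r1|_ [q [c [qc L]]]] := ray_formulas (r := 1) D;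
  first by lia.
have [E1 _ _ _] := L 1 (lexx _).
have := loop1_step D (t := 0) (t' := 1) isT erefl;
  rewrite E1 {1}/loop1 (vd0l D) // => e.
have q0 : q = 0 by lc1 (-1 : F) e.
have c0 : c = 0.
  by move/eqP: qc; rewrite q0 expr0n mulr0 expf_eq0 => /andP[_ /eqP].
have [-> -> -> ->] := L t t1; rewrite q0 c0; split; ring.
Qed.

Lemma hole_flip l : vir_data (fun t => t != 0) 0 l 0 ->
  vir_data (fun t => t != 0) 0 (flip l) 0.
Proof.
move=> /vd_flip; rewrite oppr0; set s := (fun t => _).
by have -> : s = (fun t => t != 0) by apply/funext => t; rewrite /s oppr_eq0.
Qed.

Lemma hole_loop1 l t : vir_data (fun t => t != 0) 0 l 0 ->
  t != 0 -> t != - 1 -> loop1 l t = (t * (t + 1))%:~R.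
Proof.
move=> D t0 tN1; have [t1|t1] := leP 1 t; first by have [] := hole_loops D t1.
have [E _ _ _] := hole_loops (hole_flip D) (t := - t - 1) ltac:(lia).
have [] := flip_loops l (- t - 1); rewrite E.
by rewrite (_ : - (- t - 1) - 1 = t) => [<- _ _ _|]; [ring|lia].
Qed.

Lemma hole_loops2 l t : vir_data (fun t => t != 0) 0 l 0 ->
  t != 0 -> t != - 1 -> t != - 2 ->
  [/\ loop2 l t = (t * (t + 2))%:~R,
      loop2N11 l t = (t * (t + 1) * (t + 2))%:~R
    & loop11N2 l t = (t * (t + 1) * (t + 2))%:~R].
Proof.
move=> D t0 tN1 tN2; have [t1|t1] := leP 1 t;
  first by have [] := hole_loops D t1.
have [_ E2 EX EY] := hole_loops (hole_flip D) (t := - t - 2) ltac:(lia).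
have [] := flip_loops l (- t - 2); rewrite E2 EX EY.
rewrite (_ : - (- t - 2) - 2 = t); last by lia.
move=> _ <- e1 e2; split; first by ring.
  by lc e2.
by lc e1.
Qed.

Lemma vd_tU : vir_data (fun t => t != 0) 0 (tU_ell F) 0.
Proof.
have [LL _ _] := @tU_axiom F 0; split.
- by move=> n t; rewrite /tU_ell; case: ifP => nt;
  rewrite ?eqxx // intr_eq0 => ->.
- by move=> t t0; rewrite /tU_ell !add0r t0.
- by move=> m n t _; rewrite LL mulr0 addr0.
Qed.

Lemma hole_normal_form l : vir_data (fun t => t != 0) 0 l 0 ->
  exists2 d, forall t, d t != 0 & forall n t, rescale d l n t = tU_ell F n t.
Proof.
move=> D.
(* The formulas of [hole_loops2] leave out t = -1, where the path jumps over 0; one step of [loop2]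
   from t = -3 reaches it. *)
have jump l' : vir_data (fun t => t != 0) 0 l' 0 -> l' 2 (- 1) * l' (- 2) 1 = -
  1.
  move=> D'; have := loop2_step D' (t := - 3) (t' := - 1) isT erefl.
  have [-> _ _] := hole_loops2 D' (t := - 3) isT isT isT.
  by rewrite {1}/loop2 => ->; ring.
have l2 : l 2 (- 1) != 0.
  by apply/eqP => z; have /eqP := jump l D;
    rewrite z mul0r eq_sym oppr_eq0 oner_eq0.
have l1 t : t != 0 -> t != - 1 -> l 1 t != 0.
  move=> t0 t1; have : loop1 l t != 0.
    by rewrite (hole_loop1 D) // intr_eq0 mulf_eq0 negb_or t0 addr_eq0.
  by rewrite /loop1 mulf_eq0 negb_or => /andP[].
(* L(1) cannot cross the missing weight, so the two half-lines are tied together by L(2), normalized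
   to send e_(-1) to - e_1. The value of [d] at 0 itself is immaterial. *)
pose rho t : F := if t == 0 then 1 else if t == - 1 then - l 2 (- 1)
  else l 1 t / t%:~R.
have [t|d d0 dS] := @gauge_exists F rho.
  rewrite /rho; case: (eqVneq t 0) => [_|t0]; first exact: oner_neq0.
  case: (eqVneq t (- 1)) => [_|t1]; first by rewrite oppr_eq0.
  by rewrite mulf_neq0 ?l1 // invr_eq0 intr_eq0.
exists d => //; have DR := vd_rescale d0 D; set R := rescale d l in DR *.
have R1 t : R 1 t = tU_ell F 1 t.
  have [->|t0] := eqVneq t 0; first by rewrite (vd0l DR).
  have [->|t1] := eqVneq t (- 1); first by rewrite (vd0r DR (u := 0)).
  rewrite /tU_ell addrC addr_eq0 t1 /R /rescale addrC dS /rho (negPf t0) (negPf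
    t1).
  have l1t := l1 t t0 t1.
  by have ti : t%:~R != 0 :> F := ltac:(by rewrite intr_eq0); field;
    rewrite ti l1t d0.
have RN1 t : R (- 1) t = tU_ell F (- 1) t.
  have [u ->] : exists u, t = u + 1 by exists (t - 1); lia.
  have [->|u0] := eqVneq u 0; first by rewrite (vd0r DR (u := 0)).
  have [->|u1] := eqVneq u (- 1); first by rewrite (vd0l DR).
  have := hole_loop1 DR u0 u1; rewrite /loop1 R1 /tU_ell addrC addr_eq0 u1.
  rewrite (_ : - 1 + _ = u) ?u0; last by lia.
  by rewrite intrM => /mulfI -> //; rewrite intr_eq0.
have R2 t : R 2 t = tU_ell F 2 t.
  have [->|t0] := eqVneq t 0; first by rewrite (vd0l DR).
  have [->|t2] := eqVneq t (- 2); first by rewrite (vd0r DR (u := 0)).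
  have [->|t1] := eqVneq t (- 1).
    rewrite /R /rescale /tU_ell (_ : 2 + - 1 = 0 + 1) // dS (_ : 0 = - 1 + 1)
      // dS.
    by rewrite /rho /=; field; rewrite ?oppr_eq0 ?l2 ?d0.
  have [_ EX _] := hole_loops2 DR t0 t1 t2; move: EX.
  rewrite /loop2N11 !RN1 /tU_ell (_ : - 1 + (t + 2) = t + 1); last by lia.
  rewrite (_ : - 1 + (t + 1) = t); last by lia.
  rewrite (addrC 2) !addr_eq0 t1 t0 t2 => e.
  have n1 : (t + 1)%:~R != 0 :> F by rewrite intr_eq0 addr_eq0.
  have n2 : (t + 2)%:~R != 0 :> F by rewrite intr_eq0 addr_eq0.
  by apply: (mulIf n2); apply: (mulIf n1); lc e.
have RN2 t : R (- 2) t = tU_ell F (- 2) t.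
  have [u ->] : exists u, t = u + 2 by exists (t - 2); lia.
  have [->|u0] := eqVneq u 0; first by rewrite (vd0r DR (u := 0)).
  have [->|u2] := eqVneq u (- 2); first by rewrite (vd0l DR).
  have [->|u1] := eqVneq u (- 1).
    by have := jump _ DR; rewrite R2 /tU_ell /= => e; lc1 (- 1 : F) e.
  have [_ _ EY] := hole_loops2 DR u0 u1 u2; move: EY.
  rewrite /loop11N2 !R1 /tU_ell (_ : - 2 + (u + 2) = u); last by lia.
  rewrite (_ : 1 + (u + 1) = u + 2); last by lia.
  rewrite (addrC 1) !addr_eq0 u1 u0 u2 => e.
  have n1 : (u + 1)%:~R != 0 :> F by rewrite intr_eq0 addr_eq0.
  have n0 : u%:~R != 0 :> F by rewrite intr_eq0.
  by apply: (mulfI n0); apply: (mulfI n1); lc e.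
exact: vir_data_unique DR vd_tU R1 R2 RN1 RN2.
Qed.

Section SpecialFull.
Variables (s : int -> bool) (l : int -> int -> F).
Hypothesis D : vir_data s 0 l 0.
Hypothesis full : forall t, s t.
Hypothesis L : forall t, loop_formulas 0 l 0 0 t.

Lemma special_loop1 t : t != 0 -> t != - 1 -> l 1 t != 0 /\ l (- 1) (t + 1) !=
  0.
Proof.
move=> t0 t1; have : loop1 l t != 0.
  have [-> _ _ _] := L t; rewrite (_ : _ - 0 = (t * (t + 1))%:~R); last by ring.
  by rewrite intr_eq0 mulf_eq0 negb_or t0 addr_eq0.
by rewrite /loop1 mulf_eq0 negb_or => /andP.
Qed.

(** All four loops at 0 vanish, while the L(1) and L(-1) edges between e_1 and e_2 do not; hence
    arrows between e_0 and the lines above it survive in one direction at most. *)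
Lemma special_out : (l 1 0 = 0 /\ l 2 0 = 0) \/ (l (- 1) 1 = 0 /\ l (- 2) 2 =
  0).
Proof.
have [E1 E2 EX EY] := L 0; have [l1 lN1] := special_loop1 (t := 1) isT isT.
have {}E1 : l 1 0 * l (- 1) 1 = 0 by rewrite -[LHS]/(loop1 l 0) E1; ring.
have {}E2 : l 2 0 * l (- 2) 2 = 0 by rewrite -[LHS]/(loop2 l 0) E2; ring.
have {}EX : l 2 0 * l (- 1) 1 = 0.
  by apply: (mulIf lN1); rewrite mul0r mulrAC -[LHS]/(loop2N11 l 0) EX; ring.
have {}EY : l 1 0 * l (- 2) 2 = 0.
  by apply: (mulIf l1); rewrite mul0r mulrAC -[LHS]/(loop11N2 l 0) EY; ring.
have [z1|n1] := eqVneq (l (- 1) 1) 0.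
  have [z2|n2] := eqVneq (l (- 2) 2) 0; first by right.
  by left; split; apply: (mulIf n2); rewrite mul0r.
by left; split; apply: (mulIf n1); rewrite mul0r.
Qed.

(* L(-2) e_1 is nonzero, e_1 being otherwise a lowest weight vector of weight 1. *)
Lemma special_in : l (- 1) 1 = 0 -> l (- 2) 2 = 0 -> l 1 (- 1) = 0 /\ l 2 (- 2)
  = 0.
Proof.
move=> z1 z2; have lN2 : l (- 2) 1 != 0.
  apply/eqP => z; have [e _] := lowest_weight D (full 1) z1 z.
  by move/eqP: e; rewrite add0r intr_eq0.
have l1 : l 1 (- 1) = 0.
  have := vd_bracket D (m := 1) (n := - 2) (p := - 1) (q := 2) (r := - 1) (full
    1)
    erefl erefl erefl isT.
  rewrite z1 z2 !mulr0 addr0 => /eqP.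
  by rewrite mulf_eq0 (negPf lN2) => /eqP.
split=> //; have [_ lN1] := special_loop1 (t := - 2) isT isT.
have := vd_bracket D (m := 2) (n := - 1) (p := - 2) (q := 1) (r := 1) (full (-
  1))
    erefl erefl erefl isT.
rewrite z1 l1 !mulr0 addr0 => /eqP.
by rewrite mulf_eq0 (negPf lN1) => /eqP.
Qed.

End SpecialFull.

(* The restricted dual module. *)
Lemma vd_dual s a l C : vir_data s a l C ->
  vir_data (fun t => s (- t)) (- a) (fun n t => - l n (- n - t)) (- C).
Proof.
move=> D; split.
- move=> n t; rewrite oppr_eq0 => /(vd_supp D).
  by rewrite addrA subrr sub0r opprD andbC.
- by move=> t st; rewrite oppr0 sub0r (vd_L0 D) //; ring.
- move=> m n t st; pose v := - (m + n) - t.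
  have -> : - m - (n + t) = v by rewrite /v; lia.
  have -> : - n - (m + t) = v by rewrite /v; lia.
  have -> : - (m + n) - t = v by [].
  have -> : - n - t = m + v by rewrite /v; lia.
  have -> : - m - t = n + v by rewrite /v; lia.
  have [sv|sv] := boolP (s v); last first.
    have z k : l k v = 0 by apply: vd0l D _ _ sv.
    rewrite !z; have [mn|_] := eqVneq (m + n) 0; last by rewrite mulr0n; ring.
    by move: sv; rewrite /v mn oppr0 sub0r st.
  have := vd_br D n m sv; rewrite (addrC n m).
  have [mn|_] := eqVneq (m + n) 0; rewrite ?(mulr0n, mulr1n) => e; last by lc e.
  have nE : n = - m by lia.
  by rewrite nE in e *; lc e.
Qed.

(** [special_out], applied to l and to its flip, leaves four combinations; by [special_in], once
    nothing enters e_0 from one side, nothing enters from the other. Arrows into e_0 are arrows out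
    of it in the dual, so [pos_eq0] and [neg_eq0] extend either alternative to all n. *)
Lemma special_alternative s l : vir_data s 0 l 0 -> (forall t, s t) ->
  (forall t, loop_formulas 0 l 0 0 t) ->
  (forall n, l n 0 = 0) \/ (forall n, l n (- n) = 0).
Proof.
move=> D full L; have Df : vir_data (fun t => s (- t)) 0 (flip l) 0.
  by have := vd_flip D; rewrite oppr0.
have Lf t : loop_formulas 0 (flip l) 0 0 t.
  have [E1 E2 EX EY] := flip_loops l t.
  split; rewrite ?E1 ?E2 ?EX ?EY.
  - by have [-> _ _ _] := L (- t - 1); ring.
  - by have [_ -> _ _] := L (- t - 2); ring.
  - by have [_ _ _ ->] := L (- t - 2); ring.
  - by have [_ _ -> _] := L (- t - 2); ring.
have ext (k : int -> F) : k 0 = 0 -> (forall m, 0 < m -> k m = 0) ->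
    (forall m, m < 0 -> k m = 0) -> forall n, k n = 0.
  by move=> k0 kp kn n; case: (ltgtP n 0) => [|| ->]; auto.
have l00 : l 0 0 = 0 by rewrite (vd_L0 D) // addr0.
have flip0 (x : F) : - x = 0 -> x = 0 by move/eqP; rewrite oppr_eq0 => /eqP.
have inward : l (- 1) 1 = 0 -> l (- 2) 2 = 0 -> forall n, l n (- n) = 0.
  move=> z1 z2 n; have [w1 w2] := special_in D full L z1 z2.
  have Dd := vd_dual D; rewrite /= !oppr0 in Dd.
  suff H k : - l k (- k - 0) = 0 by apply: flip0; rewrite -[X in l n X]subr0.
  move: k; apply: (ext (fun k => - l k (- k - 0))).
  - by rewrite !oppr0 addr0 l00 oppr0.
  - by apply: (pos_eq0 Dd) => //; rewrite ?subr0 ?w1 ?w2 oppr0.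
  - by apply: (neg_eq0 Dd) => //; rewrite ?subr0 ?opprK ?z1 ?z2 oppr0.
case: (special_out L) => [[u1 u2]|[z1 z2]]; last by right; apply: inward.
case: (special_out Lf) => -[v1 v2].
  rewrite /flip oppr0 in v1 v2; left; apply: ext => //;
    first exact: (pos_eq0 D).
  by apply: (neg_eq0 D) => //; apply: flip0.
have [|x1 x2] := special_in Df _ Lf v1 v2; first by move=> t; apply: full.
by rewrite /flip !opprK in x1 x2; right; apply: inward; apply: flip0.
Qed.

(** Both n and n^2 are solutions. Once the combination agreeing with h at 1 and 2 is subtracted, the
    relation propagates these two zeros to -1, -2 and then to all n. *)
Lemma cocycle_form h :
  (forall m n, m != 0 -> n != 0 -> m + n != 0 ->
    (m + n)%:~R * (h n - h m) = (n - m)%:~R * h (m + n)) ->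
  exists al be, forall n, n != 0 -> h n = al * n%:~R + be * n%:~R ^+ 2.
Proof.
move=> H; have two : 2 != 0 :> F by rewrite pnatr_eq0.
pose be := (h 2 - 2 * h 1) / 2; pose al := h 1 - be.
exists al, be; pose k n := h n - (al * n%:~R + be * n%:~R ^+ 2).
suff K n : n != 0 -> k n = 0 by move=> n n0; have := K n n0; rewrite /k => e;
  lc e.
have k1 : k 1 = 0 by rewrite /k /al; ring.
have k2 : k 2 = 0 by rewrite /k /al /be; field.
have kH m n' : m != 0 -> n' != 0 -> m + n' != 0 ->
    (m + n')%:~R * (k n' - k m) = (n' - m)%:~R * k (m + n').
  by move=> m0 n0 mn0; have := H m n' m0 n0 mn0; rewrite /k => e; lc e.
have kN1 : k (- 1) = 0.
  by have := kH (- 1) 2 isT isT isT; rewrite k1 k2 => e; lc1 (- 1 : F) e.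
have kN2 : k (- 2) = 0.
  by have := kH 1 (- 2) isT isT isT; rewrite k1 kN1 => e; lc1 (- 1 : F) e.
have pos (j : nat) : k j.+1%:Z = 0.
  elim: j => [|[|j] IH] //; have := kH 1 j.+2%:Z isT isT ltac:(lia).
  rewrite IH k1 subrr mulr0 (_ : 1 + _ = j.+3%:Z); last by lia.
  by move/esym/eqP; rewrite mulf_eq0 intr_eq0 => /orP[|/eqP //]; lia.
have neg (j : nat) : k (- j.+1%:Z) = 0.
  elim: j => [|[|j] IH] //; have := kH (- 1) (- j.+2%:Z) isT isT ltac:(lia).
  rewrite IH kN1 subrr mulr0 (_ : - 1 + _ = - j.+3%:Z); last by lia.
  by move/esym/eqP; rewrite mulf_eq0 intr_eq0 => /orP[|/eqP //]; lia.
by case: n => [[|n]|n] // _; rewrite NegzE; exact: neg.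
Qed.

(* Extensions of the module with weights Z \ {0} by a trivial submodule C e_0. *)
Definition sub_ell al be n t : F :=
  if n + t != 0 then t%:~R else al * n%:~R + be * n%:~R ^+ 2.

Lemma special_sub_form s l : vir_data s 0 l 0 -> (forall t, s t) ->
  (forall n, l n 0 = 0) ->
  exists2 d, forall t, d t != 0 &
    exists al be, forall n t, rescale d l n t = sub_ell al be n t.
Proof.
(* [lq] is the quotient by C e_0, whose normal form constrains [d] only away from 0. What remains
   are the arrows into 0, which the bracket relations make a cocycle. *)
move=> D full l0; pose lq n t := if n + t == 0 then 0 else l n t.
have Dq : vir_data (fun t => t != 0) 0 lq 0.
  split.
  - move=> n t; rewrite /lq; have [_|nt] := eqVneq (n + t) 0;
    first by rewrite eqxx.
    by rewrite andbT; apply: contraNneq => ->; rewrite l0.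
  - by move=> t t0; rewrite /lq add0r (negPf t0) (vd_L0 D).
  - move=> m n t t0; rewrite mulr0 addr0 /lq.
    have -> : m + (n + t) = m + n + t by lia.
    have -> : n + (m + t) = m + n + t by lia.
    have [_|mnt] := eqVneq (m + n + t) 0; first by ring.
    have := vd_br D m n (full t); rewrite mulr0 addr0 => <-; congr (_ - _).
      by case: (eqVneq (n + t) 0) => [->|//]; rewrite l0 mulr0 ?mul0r ?mulr0.
    by case: (eqVneq (m + t) 0) => [->|//]; rewrite l0 mulr0 ?mul0r ?mulr0.
have [d d0 dE] := hole_normal_form Dq; exists d => //.
have DR := vd_rescale d0 D; set R := rescale d l in DR *.
have RE n t : n + t != 0 -> R n t = t%:~R.
  by move=> nt; have := dE n t; rewrite /rescale /lq /tU_ell nt (negPf nt).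
have [|al [be hE]] := @cocycle_form (fun n => R n (- n)).
  move=> m n m0 n0 mn0; have := vd_br DR m n (full (- (m + n))).
  have -> : n + - (m + n) = - m by lia.
  have -> : m + - (m + n) = - n by lia.
  rewrite (RE n (- (m + n))) ?(RE m (- (m + n))) ?mulr0 ?addr0; [|lia..].
  by move=> e; lc e.
exists al, be => n t; rewrite /sub_ell; case: eqVneq => [nt|]; last exact: RE.
have [n0|n0] := eqVneq n 0.
  by rewrite n0 (_ : t = 0) /R /rescale ?l0; [ring|lia].
by rewrite -hE //; congr (R _ _); lia.
Qed.

End SpecialForms.

(** * The action of the I(n) *)

Section HeisenbergVirasoroData.
Variable F : numClosedFieldType.
Implicit Types (s : int -> bool) (a b c : F) (l i : int -> int -> F).
Implicit Types (d : int -> F) (m n t r : int).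

(* As [vir_data], with I(n) e_t = [i n t] e_(n+t); [td_I0] is where
   indecomposability enters, I(0) being central. *)
Record thv_data s a l i (C CI CLI : F) : Prop := ThvData {
  td_vir : vir_data s a l C;
  td_supp : forall n t, i n t != 0 -> s t && s (n + t);
  td_LI : forall m n t, s t -> i n t * l m (n + t) - l m t * i n (m + t)
    = n%:~R * i (m + n) t + (m + n == 0)%:R * (m ^+ 2 - m)%:~R * CLI;
  td_II : forall m n t, s t -> i n t * i m (n + t) - i m t * i n (m + t)
    = n%:~R * (m + n == 0)%:R * CI;
  td_I0 : exists c, forall t, s t -> i 0 t = c
}.

Section Relations.
Variables (s : int -> bool) (a C CI CLI : F) (l i : int -> int -> F).
Hypothesis D : thv_data s a l i C CI CLI.

Lemma td0l n t : ~~ s t -> i n t = 0.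
Proof. by move=> st; apply/eqP/negPn/negP => /(td_supp D);
  rewrite (negPf st). Qed.

Lemma td0r n t u : n + t = u -> ~~ s u -> i n t = 0.
Proof.
move=> <- st; apply/eqP/negPn/negP => /(td_supp D).
by rewrite (negPf st) andbF.
Qed.

Lemma td_bracket m n t p q r : s t -> n + t = p -> m + t = q -> m + n = r -> r
  != 0 ->
  i n t * l m p - l m t * i n q = n%:~R * i r t.
Proof.
by move=> st <- <- <- /negPf r0; rewrite (td_LI D) // r0 !mul0r addr0.
Qed.

Lemma td_bracket0 c m n t p q : (forall t, s t -> i 0 t = c) ->
  s t -> n + t = p -> m + t = q -> m + n = 0 ->
  i n t * l m p - l m t * i n q = n%:~R * c + (m ^+ 2 - m)%:~R * CLI.
Proof.
by move=> i0 st <- <- mn; rewrite (td_LI D) // mn eqxx mul1r i0.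
Qed.

End Relations.

Lemma td_rescale s a l i C CI CLI d : (forall t, d t != 0) ->
  thv_data s a l i C CI CLI ->
  thv_data s a (rescale d l) (rescale d i) C CI CLI.
Proof.
move=> d0 D; have E t x y v w : d v != 0 -> d w != 0 ->
    x * d t / d v * (y * d v / d w) = x * y * (d t / d w) :> F.
  by move=> v0 w0; field; rewrite v0 w0.
split.
- exact: vd_rescale (td_vir D).
- move=> n t H; apply: (td_supp D); apply: contraNneq H => l0.
  by rewrite /rescale l0 !mul0r.
- move=> m n t st; have := td_LI D m n st; rewrite /rescale !E //.
  rewrite (_ : n + (m + t) = m + (n + t)); last by lia.
  rewrite (_ : m + n + t = m + (n + t)); last by lia.
  have [mn|mn] := eqVneq (m + n) 0 => e; last first.
    by rewrite mulr0n !mul0r addr0 in e *; lc1 (d t / d (m + (n + t))) e.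
  have mt : m + (n + t) = t by lia.
  by rewrite mt mulfV // mulfK //; lc e.
- move=> m n t st; have := td_II D m n st; rewrite /rescale !E //.
  rewrite (_ : n + (m + t) = m + (n + t)); last by lia.
  have [mn|mn] := eqVneq (m + n) 0 => e; last first.
    by rewrite mulr0n !mulr0 mul0r in e *; lc1 (d t / d (m + (n + t))) e.
  have mt : m + (n + t) = t by lia.
  by rewrite mt mulfV //; lc e.
- have [c i0] := td_I0 D; exists c => t st.
  by rewrite /rescale add0r mulfK // i0.
Qed.

Lemma td_dual s a l i C CI CLI : thv_data s a l i C CI CLI ->
  thv_data (fun t => s (- t)) (- a) (fun n t => - l n (- n - t))
    (fun n t => - i n (- n - t)) (- C) (- CI) (- CLI).
Proof.
move=> D; split.
- exact: vd_dual (td_vir D).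
- move=> n t; rewrite oppr_eq0 => /(td_supp D).
  by rewrite addrA subrr sub0r opprD andbC.
- move=> m n t st; pose v := - (m + n) - t.
  have -> : - m - (n + t) = v by rewrite /v; lia.
  have -> : - n - (m + t) = v by rewrite /v; lia.
  have -> : - (m + n) - t = v by [].
  have -> : - n - t = m + v by rewrite /v; lia.
  have -> : - m - t = n + v by rewrite /v; lia.
  have [sv|sv] := boolP (s v); last first.
    have z k : l k v = 0 by apply: vd0l (td_vir D) _ _ sv.
    have z' k : i k v = 0 by apply: td0l D _ _ sv.
    rewrite !z !z'; have [mn|_] := eqVneq (m + n) 0; last by rewrite mulr0n;
      ring.
    by move: sv; rewrite /v mn oppr0 sub0r st.
  by have := td_LI D m n sv => e; lc1 (- 1 : F) e.
- move=> m n t st; pose v := - (m + n) - t.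
  have -> : - m - (n + t) = v by rewrite /v; lia.
  have -> : - n - (m + t) = v by rewrite /v; lia.
  have -> : - n - t = m + v by rewrite /v; lia.
  have -> : - m - t = n + v by rewrite /v; lia.
  have [sv|sv] := boolP (s v); last first.
    have z' k : i k v = 0 by apply: td0l D _ _ sv.
    rewrite !z'; have [mn|_] := eqVneq (m + n) 0; last by rewrite mulr0n; ring.
    by move: sv; rewrite /v mn oppr0 sub0r st.
  by have := td_II D m n sv => e; lc1 (- 1 : F) e.
- have [c i0] := td_I0 D; exists (- c) => t st.
  by rewrite oppr0 sub0r i0.
Qed.

Lemma int_const (k : int -> F) : (forall t, k (t + 1) = k t) -> forall t,
  k t = k 0.
Proof.
move=> ks; have pos (j : nat) t : k (t + j%:Z) = k t.
  elim: j => [|j IH]; first by rewrite addr0.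
  by rewrite (_ : t + _ = t + j%:Z + 1) ?ks ?IH //; lia.
case=> n; first by have := pos n 0; rewrite add0r.
by have := pos n.+1 (Negz n); rewrite (_ : Negz n + _ = 0) //; lia.
Qed.

(* I(1) = c' + r / (T + 1 - b) and I(-1) = c + r' / (T - 1 + b), the solutions of
   the relations for [L(-1), I(1)] and [L(1), I(-1)], are compared through
   [L(-2), I(1)] = I(-1); here e = c' - c. *)
Lemma pole_eq0 (b r r' e : F) x :
  (forall t, let T := x + t%:~R in
     e * ((T - 1 + b) * (T + 1 - b) * (T - 1 - b))
     + r * ((T - 1 + b) * (- T + 3 * b - 1)) = r' * ((T + 1 - b) * (T - 1 -
       b))) ->
  [/\ e = 0, r' = - r & r * (b * (b - 1)) = 0].
Proof.
move=> H; pose es : seq F := [:: (b - 1) * (b ^+ 2 - 1) * e + r * (b - 1) * (3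
  * b - 1)
    - r' * (b ^+ 2 - 1); - (b - 1) ^+ 2 * e + 2 * b * r + 2 * b * r';
    - (b + 1) * e - r - r'; e].
have es0 : forall j, es`_j = 0.
  apply: (coef_eq0_progression (x := x) (d := 1)); first exact: oner_neq0.
  move=> k; have := H k%:Z; rewrite -pmulrn /= => E; lc E.
have e0 : e = 0 := es0 3.
have r'E : r' = - r by have := es0 2; rewrite /= e0 => E; lc1 (- 1 : F) E.
split=> //; have := es0 0; rewrite /= e0 r'E => E.
have four : 4 != 0 :> F by rewrite pnatr_eq0.
by apply: (mulfI four); lc E.
Qed.

(** * I(n) over the Virasoro modules A_{a,b} *)

Section Generic.
Variables (s : int -> bool) (a b CI CLI : F) (i : int -> int -> F).
Hypothesis D : thv_data s a (A_ell a b) i 0 CI CLI.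
Hypothesis full : forall t, s t.

Local Notation T t := (a + t%:~R).

Lemma generic_I : exists c (r : F), [/\ CLI = 0, r * (b * (b - 1)) = 0,
  forall t, i 0 t = c, forall t, i 1 t * (T t + 1 - b) = c * (T t + 1 - b) + r
  & forall t, i (- 1) t * (T t - 1 + b) = c * (T t - 1 + b) - r].
Proof.
(* [c'] is the scalar of [L(-1), I(1)] = I(0) + 2 C_LI, while [L(1), I(-1)] = - I(0) has no central
   part. *)
have [c i0] := td_I0 D; pose c' := c + 2 * CLI; exists c.
pose k t := i 1 t * (T t + 1 - b) - c' * (T t + 1 - b).
pose k' t := i (- 1) t * (T t - 1 + b) - c * (T t - 1 + b).
have [K kE] : exists K, forall t, k t = K.
  exists (k 0); apply: int_const => t; have := td_bracket0 D (m := - 1) (n := 1)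
    (t := t + 1) (p := t + 2) (q := t) i0 (full _) ltac:(lia) ltac:(lia) erefl.
  by rewrite /A_ell /k /c' !intrD => e; lc e.
have [K' k'E] : exists K', forall t, k' t = K'.
  exists (k' 0); apply: int_const => t;
    have := td_bracket0 D (m := 1) (n := - 1)
    (t := t) (p := t - 1) (q := t + 1) i0 (full _) ltac:(lia) ltac:(lia) erefl.
  by rewrite /A_ell /k' !intrD => e; lc1 (- 1 : F) e.
have [t| e0 r'E rb] := @pole_eq0 b K K' (c' - c) a.
  have := td_bracket D (m := - 2) (n := 1) (t := t) (p := t + 1) (q := t - 2)
    (r := - 1) (full _) ltac:(lia) ltac:(lia) erefl isT.
  have e1 := kE t; have e2 := kE (t - 2); have e3 := k'E t.
  rewrite /k /k' !intrD in e1 e2 e3; rewrite /A_ell !intrD => e /=.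
  lc4 ((T t + 1 - b) * (T t - 1 - b) * (T t - 1 + b)) e
    (- (T t + 1 - 2 * b) * (T t - 1 - b) * (T t - 1 + b)) e1
    ((T t - 2 * b) * (T t + 1 - b) * (T t - 1 + b)) e2
    ((T t + 1 - b) * (T t - 1 - b)) e3.
exists K; split=> //.
- have : 2 * CLI = 0 by rewrite /c' in e0; lc e0.
  by move/eqP; rewrite mulf_eq0 pnatr_eq0 => /eqP.
- by move=> t; apply: i0.
- by move=> t; have := kE t; rewrite /k => e; lc2 (1 : F) e (T t + 1 - b) e0.
- by move=> t; have := k'E t; rewrite r'E /k' => e; lc e.
Qed.

Lemma generic_I_const : b != 0 -> b != 1 ->
  exists c, [/\ CLI = 0, CI = 0 & forall n t, i n t = c].
Proof.
move=> b0 b1; have [c [r [CLI0 rb i0 i1 iN1]]] := generic_I; exists c.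
have b1' : b - 1 != 0 by rewrite subr_eq0.
have r0 : r = 0.
  by move/eqP: rb; rewrite !mulf_eq0 (negPf b0) (negPf b1') !orbF => /eqP.
have I1 t : i 1 t = c.
  (* At T = b - 1 the equation for I(1) is empty; the value there comes from [L(-2), I(1)] =
     I(-1). *)
  have [e|n] := eqVneq (T t + 1 - b) 0; last first.
    by apply: (mulIf n); rewrite i1 r0 addr0.
  have nN1 : T t - 1 + b != 0.
    by rewrite (_ : _ + b = 2 * (b - 1)) ?mulf_neq0 ?pnatr_eq0 //; lc e.
  have n2 : T (t - 2) + 1 - b != 0.
    rewrite (_ : _ - b = - 2) ?oppr_eq0 ?pnatr_eq0 // intrD; lc e.
  have I2 : i 1 (t - 2) = c by apply: (mulIf n2); rewrite i1 r0 addr0.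
  have IN1 : i (- 1) t = c by apply: (mulIf nN1); rewrite iN1 r0 subr0.
  have := td_bracket D (m := - 2) (n := 1) (t := t) (p := t + 1) (q := t - 2)
    (r := - 1) (full _) ltac:(lia) ltac:(lia) erefl isT.
  rewrite I2 IN1 /A_ell intrD (_ : a = b - 1 - t%:~R); last by lc e.
  by move=> E; apply: (mulfI b0); lc1 (- 1 : F) E.
have In n t : i n t = c.
  have [->//|n0] := eqVneq n 0.
  have := td_bracket D (m := n - 1) (n := 1) (t := t) (p := t + 1) (q := n - 1
    + t)
    (r := n) (full _) ltac:(lia) erefl ltac:(lia) n0.
  by rewrite !I1 /A_ell !intrD => E; lc1 (- 1 : F) E.
split=> //; have := td_II D (- 1) 1 (full 0); rewrite !In eqxx mulr1n => E.
by lc1 (- 1 : F) E.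
Qed.

(** Without a zero weight, A_{a,0} and A_{a,1} are the same Virasoro module up to scaling e_t by a +
    t, and I(n) may be constant in either basis. The relation [I(2), I(1)] = 0 forces r (c + r) = 0,
    whose two solutions are these. *)
Lemma generic_I_pole : b = 0 -> (forall t : int, T t != 0) ->
  exists c, [/\ CLI = 0, CI = 0 & (forall n t, i n t = c) \/
    (forall n t, i n t = c * T t / T (n + t))].
Proof.
move=> b0 T0; have [c [r [CLI0 rb i0 i1 iN1]]] := generic_I; exists c.
have In n t : i n t = c + r * n%:~R / T (n + t).
  have I1 u : i 1 u = c + r / T (u + 1).
    have e : T u + 1 - b = T (u + 1) by rewrite b0 intrD; ring.
    have := i1 u; rewrite e => E; apply: (mulIf (T0 (u + 1))); rewrite E.
    by move: (T (u + 1)) (T0 (u + 1)) => y y0; field.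
  have [->|n0] := eqVneq n 0; first by rewrite i0 mulr0 mul0r addr0.
  have := td_bracket D (m := n - 1) (n := 1) (t := t) (p := t + 1) (q := n - 1
    + t)
    (r := n) (full _) ltac:(lia) erefl ltac:(lia) n0.
  rewrite !I1 /A_ell (_ : n - 1 + t + 1 = n + t); last by lia.
  rewrite b0 mul1r => <-.
  have TE : T t + 1 = T (t + 1) by rewrite intrD; ring.
  have nE : n%:~R = T (n + t) - T t :> F by rewrite !intrD; ring.
  rewrite -TE nE; move: (T (t + 1)) (T0 (t + 1)) TE => z z0 TE.
  by move: (T (n + t)) (T0 (n + t)) => y y0; rewrite -TE in z0 *; field;
    rewrite y0 z0.
have rc : r * (c + r) = 0.
  have := td_II D 2 1 (full 0); rewrite !In mulr0 mul0r.
  have T1 := T0 1; have T2 := T0 2; have T3 := T0 3; move: T1 T2 T3.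
  rewrite !(addr0, add0r) /= => T1 T2 T3 E.
  apply: (eq_lincomb (eq_scale ((a + 1) * (a + 2) * (a + 3) / 2) E)).
  by field; rewrite T1 T2 T3.
have CI_E := td_II D (- 1) 1 (full 0).
have alt : (forall n t, i n t = c) \/ (forall n t, i n t = c * T t / T (n + t)).
  move/eqP: rc; rewrite mulf_eq0 => /orP[/eqP r0|/eqP rc]; [left|right] => n t.
    by rewrite In r0 !mul0r addr0.
  rewrite In (_ : r = - c); last by lc rc.
  have nE : n%:~R = T (n + t) - T t :> F by rewrite !intrD; ring.
  by rewrite nE; move: (T (n + t)) (T0 (n + t)) => y y0; field.
split=> //; move: CI_E; rewrite eqxx mulr1n; case: alt => {}In;
  rewrite !In => E.
  by lc1 (- 1 : F) E.
move: (T0 0) (T0 1) (T0 (- 1)) E; rewrite !(addr0, add0r) /= => T0' T1 TN1 E.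
by apply: (eq_lincomb (eq_scale (- 1) E)); field; rewrite T0' T1 TN1.
Qed.

End Generic.

Lemma down_from (k : int -> F) (t0 : int) : k t0 = 0 ->
  (forall t, t <= t0 -> k t = 0 -> k (t - 1) = 0) -> forall t,
    t <= t0 -> k t = 0.
Proof.
move=> k0 ks t tt; have [j ->] : exists j : nat, t = t0 - j%:Z.
  by exists `|t0 - t|%N; lia.
elim: j => [|j IH]; first by rewrite subr0.
by rewrite (_ : t0 - _ = t0 - j%:Z - 1) ?ks //; lia.
Qed.

Lemma up_from (k : int -> F) (t0 : int) : k t0 = 0 ->
  (forall t, t0 <= t -> k t = 0 -> k (t + 1) = 0) -> forall t,
    t0 <= t -> k t = 0.
Proof.
move=> k0 ks t tt; have [j ->] : exists j : nat, t = t0 + j%:Z.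
  by exists `|t - t0|%N; lia.
elim: j => [|j IH]; first by rewrite addr0.
by rewrite (_ : t0 + _ = t0 + j%:Z + 1) ?ks //; lia.
Qed.

(** The hole provides the boundary values 0 for I(1) e_0 and I(-1) e_1. Computing from there up to t
    = 3 and comparing through [L(-2), I(1)] = I(-1) gives c = 2c' and 2c = 3c', so both vanish; the
    recurrence for I(1) then carries 0 away from the hole on both sides. *)
Lemma hole_I i CI CLI :
  thv_data (fun t => t != 0) 0 (tU_ell F) i 0 CI CLI ->
  [/\ CI = 0, CLI = 0 & forall n t, i n t = 0].
Proof.
move=> D; have [c i0] := td_I0 D; pose c' := c + 2 * CLI.
have iN0 n : i n 0 = 0 by rewrite (td0l D).
have lE n t p : n + t = p -> p != 0 -> tU_ell F n t = t%:~R.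
  by move=> <- nt; rewrite /tU_ell nt.
have lz n t u v : (n + t = 0 -> i u v = 0) -> tU_ell F n t * i u v = t%:~R * i
  u v.
  by rewrite /tU_ell; case: eqVneq => [nt -> //|//]; rewrite ?mulr0.
have R1 t u : u = t - 1 -> t != 0 -> i 1 t * (t + 1)%:~R - t%:~R * i 1 u = c'.
  move=> -> t0; have := td_bracket0 D (m := - 1) (n := 1) (t := t) (p := t + 1)
    (q := t - 1) i0 t0 ltac:(lia) ltac:(lia) erefl.
  rewrite (lE _ _ t) //; last by lia.
  rewrite lz => [|tE]; last by rewrite (_ : t - 1 = 0) //; lia.
  by move=> ->; rewrite /c'; ring.
have RN1 t u : u = t + 1 -> t != 0 ->
    i (- 1) t * (t - 1)%:~R - t%:~R * i (- 1) u = - c.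
  move=> -> t0; have := td_bracket0 D (m := 1) (n := - 1) (t := t) (p := t - 1)
    (q := t + 1) i0 t0 ltac:(lia) ltac:(lia) erefl.
  rewrite (lE _ _ t) //; last by lia.
  rewrite lz => [|tE]; last by rewrite (_ : t + 1 = 0) //; lia.
  by move=> ->; ring.
have R2 t u : u = t - 2 -> t != 0 -> t != 1 ->
    i 1 t * (t + 1)%:~R - t%:~R * i 1 u = i (- 1) t.
  move=> -> t0 t1; have := td_bracket D (m := - 2) (n := 1) (t := t) (p := t +
    1)
    (q := t - 2) (r := - 1) t0 ltac:(lia) ltac:(lia) erefl isT.
  rewrite (lE _ _ (t - 1)) //; [|lia|by rewrite subr_eq0].
  rewrite lz => [|tE]; last by rewrite (_ : t - 2 = 0) //; lia.
  by rewrite mul1r.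
have a1 := R1 1 0 erefl isT; have a2 := R1 2 1 erefl isT.
have a3 := R1 3 2 erefl isT.
have b1 := RN1 1 2 erefl isT; have b2 := RN1 2 3 erefl isT.
have r2 := R2 2 0 erefl isT isT; have r3 := R2 3 1 erefl isT isT.
rewrite iN0 in a1 r2.
have y1 : i (- 1) 1 = 0 by rewrite (td0r D (u := 0)).
have y2 : i (- 1) 2 = c by rewrite y1 in b1; lc1 (- 1 : F) b1.
have cE : c = 2 * c'.
  rewrite -y2; lc3 (- 1 : F) r2 (1 : F) a2 (1 : F) a1.
have y3 : 2 * i (- 1) 3 = 3 * c'.
  lc4 (- 2 : F) r3 (2 : F) a3 (2 : F) a2 (- 1 : F) a1.
have c'0 : c' = 0 by lc4 (1 : F) b2 (1 : F) y3 (- 1 : F) y2 (- 2 : F) cE.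
have c0 : c = 0 by rewrite cE c'0 mulr0.
have I1 t : i 1 t = 0.
  have [t0|t0] := leP 1 t.
    move: t t0; apply: up_from => [|t t1 it].
      have two : 2 != 0 :> F by rewrite pnatr_eq0.
      by apply: (mulfI two); lc2 (1 : F) a1 (1 : F) c'0.
    have := R1 (t + 1) t ltac:(lia) ltac:(lia);
      rewrite it mulr0 subr0 c'0 => /eqP.
    by rewrite mulf_eq0 intr_eq0 => /orP[/eqP //|]; lia.
  have [t2|t2] := leP t (- 2).
    move: t t2 {t0}; apply: down_from => [|t t1 it].
      by have := R1 (- 1) (- 2) erefl isT; rewrite c'0 => e; lc e.
    have := R1 t (t - 1) erefl ltac:(lia); rewrite it mul0r c'0 => /eqP.
    by rewrite sub0r oppr_eq0 mulf_eq0 intr_eq0 => /orP[|/eqP //]; lia.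
  have [->//|t3] := eqVneq t 0.
  by rewrite (td0r D (u := 0)) //; lia.
have In n t : i n t = 0.
  have [->//|t0] := eqVneq t 0.
  have [->|n0] := eqVneq n 0; first by rewrite i0.
  have := td_bracket D (m := n - 1) (n := 1) (t := t) (p := t + 1) (q := n - 1
    + t)
    (r := n) t0 ltac:(lia) erefl ltac:(lia) n0.
  by rewrite !I1 => e; lc1 (- 1 : F) e.
split=> //.
  have := td_II D (- 1) 1 (t := 1) isT; rewrite !In eqxx mulr1n => E.
  by lc1 (- 1 : F) E.
have : 2 * CLI = 0 by rewrite /c' c0 in c'0; lc c'0.
by move/eqP; rewrite mulf_eq0 pnatr_eq0 => /eqP.
Qed.

(** * I(n) when e_0 spans a Virasoro submodule *)

Section Sub.
Variables (s : int -> bool) (al be CI CLI : F) (i : int -> int -> F).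
Hypothesis D : thv_data s 0 (sub_ell al be) i 0 CI CLI.
Hypothesis full : forall t, s t.

Lemma sub_ellE n t u : n + t = u -> u != 0 -> sub_ell al be n t = t%:~R.
Proof. by move=> <- nt; rewrite /sub_ell nt. Qed.

Lemma sub_ell_in n t : n + t = 0 -> sub_ell al be n t = al * n%:~R + be * n%:~R
  ^+ 2.
Proof. by move=> nt; rewrite /sub_ell nt eqxx. Qed.

Lemma sub_ell_out n : sub_ell al be n 0 = 0.
Proof.
by rewrite /sub_ell; case: eqVneq => [|//]; rewrite addr0 => ->; ring.
Qed.

(** On e_0, where L vanishes, [L(n-1), I(1)] gives I(n) e_0 = g e_n, and [L(m), I(-m)] with m = 1,
    -1 expresses c and c' by g, [al], [be]. Away from 0 the relation for [L(1), I(-1)] forces c =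
    c', that is CLI = 0 and g be = 0; finally [I(-1), I(1)] on e_0 gives g e = 0. *)
Lemma sub_I : exists g e, [/\ CI = 0, CLI = 0, g * be = 0, g * e = 0 &
  forall n t, i n t = if n == 0 then - g * al
    else if t == 0 then g else if n + t == 0 then g * al ^+ 2 + e * n%:~R
    else - g * al].
Proof.
have [c c0] := td_I0 D; have {}c0 t : i 0 t = c by apply: c0.
have [c' c'_def] : exists c', c + 2 * CLI = c' by exists (c + 2 * CLI).
have [g gE] : exists g, i 1 0 = g by exists (i 1 0).
have rel0 m n t p q (f := full t) :=
  @td_bracket0 _ _ _ _ _ _ _ D c m n t p q (fun t _ => c0 t) f.
have ig n : n != 0 -> i n 0 = g.
  move=> n0; have [->//|n1] := eqVneq n 1.
  have := td_bracket D (m := n - 1) (n := 1) (t := 0) (p := 1) (q := n - 1)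
    (r := n) (full 0) erefl ltac:(lia) ltac:(lia) n0.
  by rewrite (sub_ellE (u := n)) ?sub_ell_out ?gE; [move=> e;
    lc1 (- 1 : F) e|lia..].
have eg m k : k = - m -> m != 0 ->
    g * (al * m%:~R + be * m%:~R ^+ 2) = - m%:~R * c + (m ^+ 2 - m)%:~R * CLI.
  move=> kE m0; have := @rel0 m k 0 k m ltac:(lia) ltac:(lia) ltac:(lia).
  by rewrite sub_ell_out mul0r subr0 (ig k) ?sub_ell_in ?kE; [move=> ->;
    ring|lia..].
have e1 := eg 1 _ erefl isT; have e2 := eg (- 1) _ erefl isT.
have cE : c = - g * (al + be) by lc e1.
have c'E : c' = g * (be - al) by rewrite -c'_def; lc1 (- 1 : F) e2.
have two : 2 != 0 :> F by rewrite pnatr_eq0.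
have R1 t u v : u = t - 1 -> v = t + 1 ->
    i 1 t * sub_ell al be (- 1) v - sub_ell al be (- 1) t * i 1 u = c'.
  move=> uE vE; rewrite (@rel0 (- 1) 1 t v u) ?uE ?vE; [|lia..].
  by rewrite -c'_def; ring.
have i1pos t : 1 <= t -> i 1 t = c'.
  move=> t1; suff : i 1 t - c' = 0 by move=> e; lc e.
  apply: (up_from (k := fun t => i 1 t - c')) t1 => [|u u1 iu].
    have := R1 1 0 2 erefl erefl; rewrite gE (sub_ellE (u := 1)) // sub_ell_in
      // c'E => e.
    by apply: (mulfI two); lc e.
  have := R1 (u + 1) u (u + 2) ltac:(lia) ltac:(lia).
  rewrite (sub_ellE (u := u + 1)) ?(sub_ellE (u := u)); [move=> e|lia..].
  have u2 : (u + 2)%:~R != 0 :> F by rewrite intr_eq0; lia.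
  by apply: (mulfI u2); lc2 (1 : F) e ((u + 1)%:~R : F) iu.
have i1neg t : t <= - 2 -> i 1 t = c'.
  move=> t1; suff : i 1 t - c' = 0 by move=> e; lc e.
  apply: (down_from (k := fun t => i 1 t - c')) t1 => [|u u1 iu].
    have := R1 (- 1) (- 2) 0 erefl erefl.
    by rewrite sub_ell_out (sub_ellE (u := - 2)) // => e; lc e.
  have := R1 u (u - 1) (u + 1) ltac:(lia) ltac:(lia).
  rewrite (sub_ellE (u := u)) ?(sub_ellE (u := u - 1)); [move=> e|lia..].
  have u2 : - u%:~R != 0 :> F by rewrite oppr_eq0 intr_eq0; lia.
  by apply: (mulfI u2); lc2 (1 : F) e (- (u + 1)%:~R : F) iu.
have I1 t : t != 0 -> t != - 1 -> i 1 t = c'.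
  by move=> t0 t1; have [t2|t2] := leP 1 t; [apply: i1pos|apply: i1neg; lia].
have r3 : i (- 1) 3 = c'.
  have := td_bracket D (m := - 2) (n := 1) (t := 3) (p := 4) (q := 1)
    (r := - 1) (full _) erefl erefl erefl isT.
  by rewrite !I1 // (sub_ellE (u := 2)) // (sub_ellE (u := 1)) // => e;
    lc1 (- 1 : F) e.
have r4 : i (- 1) 4 = c'.
  have := td_bracket D (m := - 2) (n := 1) (t := 4) (p := 5) (q := 2)
    (r := - 1) (full _) erefl erefl erefl isT.
  by rewrite !I1 // (sub_ellE (u := 3)) // (sub_ellE (u := 2)) // => e;
    lc1 (- 1 : F) e.
have cc' : c' = c.
  have := @rel0 1 (- 1) 3 2 4 erefl erefl erefl.
  by rewrite r3 r4 (sub_ellE (u := 3)) // (sub_ellE (u := 4)) // => e;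
    lc1 (- 1 : F) e.
have CLI0 : CLI = 0 by apply: (mulfI two); lc2 (1 : F) c'_def (1 : F) cc'.
have gbe : g * be = 0.
  by apply: (mulfI two); lc3 (- 1 : F) c'E (1 : F) cE (1 : F) cc'.
have cA : c = - g * al by lc2 (1 : F) cE (- 1 : F) gbe.
rewrite {}cc' in I1 i1pos i1neg.
have Igen n t : t != 0 -> n + t != 0 -> i n t = c.
  move=> t0 nt; have [->//|n0] := eqVneq n 0.
  have := td_bracket D (m := n - 1) (n := 1) (t := t) (p := t + 1) (q := n - 1
    + t)
    (r := n) (full t) ltac:(lia) erefl ltac:(lia) n0.
  rewrite (sub_ellE (u := n + t)) //; last by lia.
  have [nt1|nt1] := eqVneq (n - 1 + t) 0.
    rewrite nt1 gE sub_ell_in //; have [t1|t1] := eqVneq t (- 1).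
      by rewrite t1 (_ : n = 2) => [e|]; [lc2 (- 1 : F) e (- 1 : F) cE|lia].
    rewrite I1 // (_ : n - 1 = - t) => [e|]; last by lia.
    by lc3 (- 1 : F) e (t%:~R : F) cA (- t%:~R ^+ 2 : F) gbe.
  rewrite (sub_ellE (u := n - 1 + t)) // (I1 (n - 1 + t)) //; last by lia.
  have [->|t1] := eqVneq t (- 1); first by move=> e; lc1 (- 1 : F) e.
  by rewrite I1 // => e; lc1 (- 1 : F) e.
have [e eE] : exists e, i 1 (- 1) = g * al ^+ 2 + e.
  by exists (i 1 (- 1) - g * al ^+ 2); ring.
have K n t : n != 0 -> n + t = 0 -> i n t = g * al ^+ 2 + e * n%:~R.
  move=> n0 nt; have [n1|n1] := eqVneq n 1.
    by rewrite n1 (_ : t = - 1) ?eE ?mulr1 //; lia.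
  have := td_bracket D (m := n - 1) (n := 1) (t := t) (p := t + 1) (q := - 1)
    (r := n) (full t) ltac:(lia) ltac:(lia) ltac:(lia) n0.
  rewrite sub_ell_in ?(sub_ellE (u := - 1)) ?(Igen 1 t); [move=> E|lia..].
  rewrite eE (_ : t = - n) in E; last by lia.
  rewrite (_ : t = - n); last by lia.
  lc3 (- 1 : F) E (al * (n - 1)%:~R + be * (n - 1)%:~R ^+ 2) cA
    (- al * (n - 1)%:~R ^+ 2) gbe.
have CI0 : CI = 0.
  have := td_II D (- 1) 1 (full 5); rewrite eqxx mulr1n !Igen // => E.
  by lc1 (- 1 : F) E.
exists g, e; split=> //.
  have := td_II D (- 1) 1 (full 0); rewrite CI0 !addr0 gE ig // !K // => E.
  by apply: (mulfI two); lc1 (- 1 : F) E.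
move=> n t; case: (eqVneq n 0) => [->|n0]; first by rewrite c0.
case: (eqVneq t 0) => [->|t0]; first exact: ig.
by case: (eqVneq (n + t) 0) => nt; [exact: K|rewrite Igen].
Qed.

End Sub.
End HeisenbergVirasoroData.

(** * Classification of the structure constants *)

Section Classification.
Variable F : numClosedFieldType.
Implicit Types (s : int -> bool) (a b c x : F) (l i ell iota : int -> int -> F).
Implicit Types (d : int -> F) (m n t r u : int).

Lemma rescale_mul d d' l n t : rescale d' (rescale d l) n t
  = rescale (fun t => d t * d' t) l n t.
Proof. by rewrite /rescale invfM; ring. Qed.

Definition modeled l i : Prop :=
  exists ell iota (ax : graded_axiom ell iota) d,
    [/\ listed (graded_module ax), forall t, d t != 0,
        forall n t, rescale d l n t = ell n t
      & forall n t, rescale d i n t = iota n t].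

(** The listed modules in which every L(n) kills v_0; for A_{a,b,c} this means a = b = 0. *)
Inductive sub_family : (int -> int -> F) -> (int -> int -> F) -> Prop :=
| sub_family_A c : sub_family (A_ell 0 0) (A_iota c)
| sub_family_B a (d : F) : sub_family (Bad_ell a) (Bad_iota d)
| sub_family_U (d : F) : sub_family (U_ell F) (U_iota d)
| sub_family_tU (d : F) of d != 0 : sub_family (tU_ell F) (tU_iota d)
| sub_family_tV c of c != 0 : sub_family (tV_ell F) (tV_iota c).

Lemma sub_family_listed ell iota : sub_family ell iota ->
  exists ax : graded_axiom ell iota, listed (graded_module ax).
Proof.
case=> [c|a d|d|d d0|c c0].
- by exists (A_axiom 0 0 c); apply: listed_A.
- by exists (Bad_axiom a d); apply: listed_Bad.
- by exists (U_axiom d); apply: listed_U.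
- by exists (tU_axiom d); apply: listed_tU.
- by exists (tV_axiom c); apply: listed_tV.
Qed.

(** Duality takes A_{0,0,c} to A_{0,1,-c}, B to A(a,-d), U to V, and exchanges the two families with
    a tilde. Over the Virasoro algebra the latter are a trivial line plus the module with weights Z
    \ {0}, which is self-dual only after scaling e_t by t. *)
Lemma sub_family_dual ell iota : sub_family ell iota ->
  modeled (fun n t => - ell n (- n - t)) (fun n t => - iota n (- n - t)).
Proof.
have one : (1 : F) != 0 := oner_neq0 _.
have z0 n t : (- n - t == - n) = (t == 0) by lia.
have z1 n t : (n + (- n - t) == 0) = (t == 0) by lia.
have z2 n t : (- n - t == 0) = (n + t == 0) by lia.
have z3 t : t != 0 -> t%:~R != 0 :> F by rewrite intr_eq0.
case=> [c|a d|d|d d0|c c0].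
- exists (A_ell 0 1), (A_iota (- c)), (A_axiom 0 1 (- c)), (fun=> 1).
  split=> // [|n t|n t]; first exact: listed_A.
    by rewrite /rescale /A_ell; field.
  by rewrite /rescale /A_iota; field.
- exists (Aad_ell a), (Aad_iota (- d)), (Aad_axiom a (- d)), (fun=> 1).
  split=> // [|n t|n t]; first exact: listed_Aad.
    by rewrite /rescale /Bad_ell /Aad_ell z0; case: eqVneq => _ /=; field.
  by rewrite /rescale /Bad_iota /Aad_iota z1; case: eqVneq => _ /=; field.
- exists (V_ell F), (V_iota (- d)), (V_axiom (- d)), (fun=> 1).
  split=> // [|n t|n t]; first exact: listed_V.
    by rewrite /rescale /U_ell /V_ell; field.
  by rewrite /rescale /U_iota /V_iota z1; case: eqVneq => _ /=; field.
- exists (tV_ell F), (tV_iota (- d)), (tV_axiom (- d)),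
    (fun t => if t == 0 then 1 else t%:~R).
  split=> [|t|n t|n t].
  + by apply: listed_tV; rewrite oppr_eq0.
  + by case: (eqVneq t 0) => [_|t0]; [exact: one|exact: z3].
  + rewrite /rescale /tU_ell /tV_ell z1; case: (eqVneq t 0) => [->|t0] /=.
      by rewrite oppr0 !mul0r if_same.
    case: (eqVneq (n + t) 0) => [nt|nt] /=; first by rewrite (_ : t = - n);
      [ring|lia].
    by have {}nt := z3 _ nt; rewrite intrD in nt *; field.
  + rewrite /rescale /tU_iota /tV_iota z1; case: (eqVneq t 0) => [->|t0] /=.
      rewrite addr0 andbT; case: (eqVneq n 0) => [->|n0] /=; first by ring.
      by have {}n0 := z3 _ n0; field.
    by rewrite oppr0 !mul0r.
- exists (tU_ell F), (tU_iota c), (tU_axiom c),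
    (fun t => if t == 0 then 1 else t%:~R).
  split=> [|t|n t|n t].
  + by apply: listed_tU.
  + by case: (eqVneq t 0) => [_|t0]; [exact: one|exact: z3].
  + rewrite /rescale /tU_ell /tV_ell z1; case: (eqVneq t 0) => [->|t0] /=.
      by rewrite oppr0 !mul0r if_same.
    case: (eqVneq (n + t) 0) => [nt|nt] /=; first by rewrite (_ : t = - n);
      [ring|lia].
    by have {}nt := z3 _ nt; rewrite intrD in nt *; field.
  + rewrite /rescale /tU_iota /tV_iota z2;
    case: (eqVneq (n + t) 0) => [nt|nt] /=.
      rewrite andbT; have [n0|n0] /= := eqVneq n 0.
        by rewrite n0; ring.
      have t0 : t != 0 by lia.
      by rewrite (negPf t0) (_ : t = - n); [field|lia].
    by rewrite oppr0 !mul0r.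
Qed.

(** If g is nonzero, [be] and [e] vanish, and [al] decides between [tV] and A_{0,0,c}. If g = 0, the
    first nonzero one among [be], [al], [e] yields B, U or [tU]. If all vanish, e_0 splits off: this
    is the last alternative, left to indecomposability. *)
Lemma special_sub_classification s l i CI CLI :
  thv_data s 0 l i 0 CI CLI -> (forall t, s t) -> (forall n, l n 0 = 0) ->
  [/\ CI = 0, CLI = 0 & (exists ell iota d, [/\ sub_family ell iota,
        forall t, d t != 0, forall n t, rescale d l n t = ell n t
      & forall n t, rescale d i n t = iota n t]) \/
    forall n, [/\ l n 0 = 0, l n (- n) = 0, i n 0 = 0 & i n (- n) = 0]].
Proof.
move=> D full l0.
have [d d0 [al [be lE]]] := special_sub_form (td_vir D) full l0.
have DR := td_rescale d0 D.
have lE' : rescale d l = sub_ell al be by apply/funext => n; apply/funext => t.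
rewrite {}lE' in DR; have [g [e [CI0 CLI0 gbe ge iE]]] := sub_I DR full.
(* Scaling e_0 alone keeps the normal form of the quotient; x = - al or x = - be will normalize the
   cocycle. *)
split=> //; pose pt x t : F := if t == 0 then x else 1.
have pt0 x : x != 0 -> forall t, d t * pt x t != 0.
  by move=> x0 t; rewrite mulf_neq0 // /pt; case: (t == 0) => //;
    apply: oner_neq0.
have lp x n t : x != 0 -> rescale (fun t => d t * pt x t) l n t =
    if n + t != 0 then t%:~R else (al * n%:~R + be * n%:~R ^+ 2) / x.
  move=> x0; rewrite -rescale_mul {1}/rescale lE /sub_ell /pt.
  have [nt|nt] /= := eqVneq (n + t) 0; have [t0|t0] := eqVneq t 0.
  - by rewrite (_ : n = 0) ?t0; [ring|lia].
  - by rewrite mulr1.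
  - by rewrite t0 !mul0r.
  - by rewrite mulr1 divr1.
have ip x n t : x != 0 -> rescale (fun t => d t * pt x t) i n t =
    if n == 0 then - g * al else if t == 0 then g * x
    else if n + t == 0 then (g * al ^+ 2 + e * n%:~R) / x else - g * al.
  move=> x0; rewrite -rescale_mul {1}/rescale iE /pt.
  have [->|n0] := eqVneq n 0.
    by rewrite add0r; case: eqVneq => _; [rewrite mulfK|rewrite mulr1 divr1].
  have [->|t0] := eqVneq t 0; first by rewrite addr0 (negPf n0) divr1.
  by case: (eqVneq (n + t) 0) => _; rewrite mulr1 ?divr1.
have [g0|g0] := eqVneq g 0; last first.
  left; have be0 : be = 0 by apply: (mulfI g0); rewrite gbe mulr0.
  have e0 : e = 0 by apply: (mulfI g0); rewrite ge mulr0.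
  have [al0|al0] := eqVneq al 0.
    exists (tV_ell F), (tV_iota g), (fun t => d t * pt 1 t).
    split=> [|||n t]; [exact: sub_family_tV|exact: pt0 (oner_neq0 _)| |].
      move=> n t; rewrite lp ?oner_neq0 // al0 be0 /tV_ell.
      by case: ifP => // _; ring.
    rewrite ip ?oner_neq0 // al0 e0 /tV_iota.
    case: (eqVneq n 0) => [n0|n0] /=; first by rewrite orNb; ring.
    by rewrite orbF; case: (eqVneq t 0) => _ /=; [ring|case: ifP => _; ring].
  exists (A_ell 0 0), (A_iota (- g * al)), (fun t => d t * pt (- al) t).
  have al1 : - al != 0 by rewrite oppr_eq0.
  split=> [|||n t]; [exact: sub_family_A|exact: pt0| |].
    move=> n t; rewrite lp // be0 /A_ell.
    case: eqVneq => [nt|_] /=; last by ring.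
    by rewrite (_ : t = - n); [field|lia].
  rewrite ip // e0 /A_iota.
  case: ifP => // _; case: ifP => _; first by ring.
  by case: ifP => // _; field.
have [be0|be0] := eqVneq be 0; last first.
  left; exists (Bad_ell (al / be)), (Bad_iota (- e / be)),
    (fun t => d t * pt (- be) t).
  have be1 : - be != 0 by rewrite oppr_eq0.
  split=> [|||n t]; [exact: sub_family_B|exact: pt0| |].
    move=> n t; rewrite lp // /Bad_ell (_ : (t == - n) = (n + t == 0));
      last by lia.
    by case: ifP => //= _; field.
  rewrite ip // g0 /Bad_iota.
  case: (eqVneq n 0) => [n0|n0] /=; first by rewrite n0; case: ifP => _; ring.
  case: (eqVneq t 0) => [t0|t0] /=; first by rewrite t0 addr0 n0; ring.
  by case: ifP => _ /=; [field|ring].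
have [al0|al0] := eqVneq al 0; last first.
  left; exists (U_ell F), (U_iota (- e / al)), (fun t => d t * pt (- al) t).
  have al1 : - al != 0 by rewrite oppr_eq0.
  split=> [|||n t]; [exact: sub_family_U|exact: pt0| |].
    move=> n t; rewrite lp // /U_ell be0; case: eqVneq => //= nt.
    by rewrite (_ : t = - n); [field|lia].
  rewrite ip // g0 /U_iota.
  case: (eqVneq n 0) => [n0|n0] /=; first by rewrite n0; case: ifP => _; ring.
  case: (eqVneq t 0) => [t0|t0] /=; first by rewrite t0 addr0 n0; ring.
  by case: ifP => _ /=; [field|ring].
have [e0|e0] := eqVneq e 0; last first.
  left; exists (tU_ell F), (tU_iota e), (fun t => d t * pt 1 t).
  split=> [|||n t]; [exact: sub_family_tU|exact: pt0 (oner_neq0 _)| |].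
    move=> n t; rewrite lp ?oner_neq0 // al0 be0 /tU_ell.
    by case: ifP => // _; ring.
  rewrite ip ?oner_neq0 // g0 /tU_iota.
  case: (eqVneq n 0) => [n0|n0] /=; first by rewrite n0; case: ifP => _; ring.
  case: (eqVneq t 0) => [t0|t0] /=; first by rewrite t0 addr0 n0; ring.
  by case: ifP => _ /=; [field|ring].
right; have cancel (k : int -> int -> F) n t : rescale d k n t = 0 -> k n t = 0.
  by move/eqP; rewrite /rescale !mulf_eq0 invr_eq0 !(negPf (d0 _)) !orbF =>
    /eqP.
move=> n; split; apply: cancel; rewrite ?lE ?iE.
- exact: sub_ell_out.
- by rewrite sub_ell_in ?subrr // al0 be0; ring.
- by rewrite g0; case: ifP => _; rewrite ?eqxx //; ring.
- rewrite g0 e0 subrr eqxx; case: ifP => _; first by ring.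
  by case: ifP => _ //; ring.
Qed.

Theorem data_classification s a l i C CI CLI p :
  thv_data s a l i C CI CLI -> s p ->
  a = 0 \/ (forall t : int, a + t%:~R != 0) ->
  (forall Q : int -> bool,
    (forall n t, (l n t != 0) || (i n t != 0) -> Q t = Q (n + t)) ->
    (forall t, s t -> Q t) \/ (forall t, s t -> ~~ Q t)) ->
  [/\ C = 0, CI = 0 & CLI = 0] /\
  [\/ forall n t, l n t = 0 /\ i n t = 0,
      (forall t, s t) /\ modeled l i
    | [/\ a = 0, forall t, s t = (t != 0), forall n t, i n t = 0
        & exists2 d, forall t, d t != 0 & forall n t,
          rescale d l n t = tU_ell F n t]].
Proof.
move=> D sp a_int indec; have Dv := td_vir D.
have two : 2 != 0 :> F by rewrite pnatr_eq0.
case: (vir_support Dv sp) => [[ap only]|[C0 full]|[C0 [t [st at0 others]]]].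
- have lz n t : n != 0 -> l n t = 0.
    move=> n0; have [/only ->|st] := boolP (s t); last by rewrite (vd0l Dv).
    by rewrite (vd0r Dv (u := n + p)) //; apply/negP => /only; lia.
  have iz n t : n != 0 -> i n t = 0.
    move=> n0; have [/only ->|st] := boolP (s t); last by rewrite (td0l D).
    by rewrite (td0r D (u := n + p)) //; apply/negP => /only; lia.
  have l0 t : l 0 t = 0.
    by have [/only ->|st] := boolP (s t);
      [rewrite (vd_L0 Dv)|rewrite (vd0l Dv)].
  (* [L(1), I(-1)] = - I(0) has no central term, as m^2 - m = 0 for m = 1. *)
  have i0p : i 0 p = 0.
    have := td_LI D 1 (- 1) sp; rewrite subrr !(iz (- 1)) // eqxx mulr1n => e.
    by lc1 (1 : F) e.
  have i0 t : i 0 t = 0.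
    by have [/only ->|st] := boolP (s t); last rewrite (td0l D).
  have z n t : l n t = 0 /\ i n t = 0.
    by have [->|n0] := eqVneq n 0; rewrite ?l0 ?i0 ?lz ?iz.
  split; last by constructor 1.
  split.
  + have := vd_br Dv 2 (- 2) sp; rewrite subrr !(lz 2) // !(lz (- 2)) // l0
    eqxx mulr1n => e.
    by apply: (mulIf (x := 2^-1)); rewrite ?invr_eq0 //;
      apply: (eq_lincomb (eq_scale (-1) e)); field; rewrite ?pnatr_eq0.
  + by have := td_II D (- 1) 1 sp; rewrite addNr !(iz 1) // eqxx mulr1n => e;
    lc1 (-1 : F) e.
  + have := td_LI D (- 1) 1 sp; rewrite addNr !(iz 1) // i0 eqxx mulr1n => e.
    by apply: (mulfI two); lc1 (-1 : F) e.
- rewrite {}C0 in D Dv *.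
  have [q [c [qc L]]] := full_formulas Dv full.
  have [q0|q0] := eqVneq q 0; last first.
    have [b [qb cb]] := loop_parameter qc; rewrite cb qb in L q0.
    have b0 : b != 0 by apply: contraNneq q0 => ->; rewrite expr0n subrr.
    have b1 : b != 1 by apply: contraNneq q0 => ->; rewrite expr1n subrr.
    have [|d d0 lE] := generic_normal_form Dv full L.
      by move=> t; right; rewrite b0 b1.
    have DR := td_rescale d0 D; rewrite (_ : rescale d l = A_ell a b) in DR;
      last first.
      by apply/funext => n; apply/funext => t.
    have [c' [CLI0 CI0 iE]] := generic_I_const DR full b0 b1.
    split=> //; constructor 2; split=> //.
    exists (A_ell a b), (A_iota c'), (A_axiom a b c'), d.
    by split=> //; apply: listed_A.
  rewrite {}q0 in qc L; have c0 : c = 0.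
    by move/eqP: qc; rewrite expr0n mulr0 expf_eq0 => /andP[_ /eqP].
  rewrite {}c0 in L {qc}; case: a_int => [a0|aN].
    rewrite a0 in D Dv L.
    case: (special_alternative Dv full L) => [l0|lN].
      have [CI0 CLI0 [[ell [iota [d [fam d0 lE iE]]]]|z]] :=
        special_sub_classification D full l0.
        split=> //; constructor 2; split=> //.
        by have [ax X] := sub_family_listed fam; exists ell, iota, ax, d.
      (* No arrow joins e_0 to another line, so the index set {0} would split V. *)
      have [n t|all0|none] := indec (fun t => t == 0).
        have [lz liz iz inz] := z n; apply: contraTeq; rewrite negb_or !negbK.
        have [->|t0] := eqVneq t 0; first by rewrite lz iz !eqxx.
        have [nt|nt] := eqVneq (n + t) 0; last by [].
        by rewrite (_ : t = - n) ?liz ?inz ?eqxx //; lia.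
        by have := all0 1 (full 1).
      by have := none 0 (full 0).
    have Dd := td_dual D; rewrite !oppr0 in Dd.
    have fulld t : s (- t) by apply: full.
    have ld0 n : - l n (- n - 0) = 0 by rewrite subr0 lN oppr0.
    have [CI0 CLI0 [[ell [iota [d [fam d0 lE iE]]]]|z]] :=
        special_sub_classification Dd fulld ld0.
      split; first by split=> //; apply: oppr_inj; rewrite oppr0.
      constructor 2; split=> //.
      have [ell' [iota' [ax [d' [X d'0 lE' iE']]]]] := sub_family_dual fam.
      (* Rescaling the dual by d amounts to rescaling the original by the inverse of d at the
         opposite index. *)
      have undual (k k' : int -> int -> F) :
          (forall n t, rescale d (fun n t => - k n (- n - t)) n t = k' n t) ->
          forall n t, rescale (fun t => (d (- t))^-1) k n t = - k' n (- n - t).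
        move=> kE n t; have e1 : - n - (- n - t) = t by lia.
        have e2 : n + (- n - t) = - t by lia.
        have e3 : - (n + t) = - n - t by lia.
        rewrite -kE /rescale e1 e2 e3 !mulNr opprK invrK.
        by rewrite -!mulrA [_^-1 * _]mulrC.
      exists ell', iota', ax, (fun t => (d (- t))^-1 * d' t); split=> //.
      + by move=> t; rewrite mulf_neq0 ?invr_eq0.
      + by move=> n t; rewrite -rescale_mul -lE' {1}/rescale (undual _ _ lE).
      + by move=> n t; rewrite -rescale_mul -iE' {1}/rescale (undual _ _ iE).
    have flip0 (x : F) : - x = 0 -> x = 0 by move/eqP; rewrite oppr_eq0 => /eqP.
    have [n t|all0|none] := indec (fun t => t == 0).
    + have [/flip0 lz /flip0 liz /flip0 iz /flip0 inz] := z n.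
      rewrite !subr0 in lz iz; rewrite opprK addNr in liz inz.
      apply: contraTeq; rewrite negb_or !negbK.
      have [->|t0] := eqVneq t 0; first by rewrite liz inz !eqxx.
      have [nt|nt] := eqVneq (n + t) 0; last by [].
      by rewrite (_ : t = - n) ?lz ?iz ?eqxx //; lia.
    + by have := all0 1 (full 1).
    + by have := none 0 (full 0).
  have L' t : loop_formulas a l (0 ^+ 2 - 0) ((2 * 0 - 1) * (0 ^+ 2 - 0)) t.
    by rewrite expr0n subrr mulr0; apply: L.
  have [|d d0 lE] := generic_normal_form Dv full L'; first by move=> t; left.
  have DR := td_rescale d0 D; rewrite (_ : rescale d l = A_ell a 0) in DR;
    last first.
    by apply/funext => n; apply/funext => t.
  have [c' [CLI0 CI0 [iE|iE]]] := generic_I_pole DR full erefl aN.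
    split=> //; constructor 2; split=> //.
    exists (A_ell a 0), (A_iota c'), (A_axiom a 0 c'), d.
    by split=> //; apply: listed_A.
  split=> //; constructor 2; split=> //.
  (* In the basis (a + t)^-1 e_t the second solution of [generic_I_pole] becomes constant and L
     takes the form b = 1. *)
  exists (A_ell a 1), (A_iota c'), (A_axiom a 1 c'),
    (fun t => d t * (a + t%:~R)^-1).
  split=> [|t|n t|n t]; first exact: listed_A.
  + by rewrite mulf_neq0 ?invr_eq0.
  + rewrite -rescale_mul {1}/rescale lE /A_ell invrK mul0r addr0 mulfV //.
    by rewrite intrD; ring.
  + rewrite -rescale_mul {1}/rescale iE /A_iota invrK.
    move: (a + t%:~R) (a + (n + t)%:~R) (aN t) (aN (n + t)) => y z y0 z0.
    by field; rewrite y0 z0.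
- have a_0 : a = 0.
    by case: a_int => // aN; move: (aN t); rewrite at0 eqxx.
  have t0 : t = 0 by move/eqP: at0; rewrite a_0 add0r intr_eq0 => /eqP.
  have sE u : s u = (u != 0).
    rewrite t0 in st others; apply/idP/idP => [su|]; last exact: others.
    by apply: contraNneq st => <-.
  have sE' : s = (fun t => t != 0) by apply/funext.
  rewrite C0 a_0 sE' in D Dv *.
  have [d d0 lE] := hole_normal_form Dv.
  have DR := td_rescale d0 D; rewrite (_ : rescale d l = tU_ell F) in DR;
    last first.
    by apply/funext => n; apply/funext => u.
  have [CI0 CLI0 iE] := hole_I DR.
  split=> //; constructor 3; split=> // [n u|]; last by exists d.
  have := iE n u; move/eqP; rewrite /rescale !mulf_eq0 invr_eq0 !(negPf (d0 _))
    !orbF.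
  by move/eqP.
Qed.

End Classification.

(** * From modules to structure constants and back *)

Local Open Scope classical_set_scope.

(** * Weight vectors and the separation of weights *)

Section ModuleBasics.
Variables (F : numClosedFieldType) (V : lieModule (thv F)).
Implicit Types (x y : thv F) (u v w : V) (j k : thv_gen) (mu nu : F).

Local Notation B k := (thv_basis F k).

Lemma actDr x u v : act x (u + v) = act x u + act x v.
Proof. by have := act_linearr x 1 u v; rewrite !scale1r. Qed.

Lemma act0r x : act x (0 : V) = 0.
Proof. by apply: (addrI (act x 0)); rewrite -actDr !addr0. Qed.

Lemma actZr x mu v : act x (mu *: v) = mu *: act x v.
Proof. by have := act_linearr x mu v 0; rewrite act0r !addr0. Qed.

Lemma act_sumr x (I : Type) (r : seq I) (f : I -> V) :
  act x (\sum_(t <- r) f t) = \sum_(t <- r) act x (f t).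
Proof. exact: (big_morph _ (actDr x) (act0r x)). Qed.

Lemma actDl x y v : act (x + y) v = act x v + act y v.
Proof. by have := act_linearl v 1 x y; rewrite !scale1r. Qed.

Lemma act0l v : act (0 : thv F) v = 0.
Proof. by apply: (addrI (act (0 : thv F) v)); rewrite -actDl !addr0. Qed.

Lemma actZl mu x v : act (mu *: x) v = mu *: act x v.
Proof. by have := act_linearl v mu x 0; rewrite act0l !addr0. Qed.

Lemma act_br j k v :
  act (thv_br F j k : thv F) v = act (B j) (act (B k) v) - act (B k) (act (B j)
    v).
Proof. by rewrite -act_lie; congr (act _ v);
  rewrite -[RHS]/(thv_lie _ _) thv_lieE. Qed.

Lemma act_ind (N : set V) v : N 0 ->
  (forall mu u w, N u -> N w -> N (mu *: u + w)) ->
  (forall k, N (act (B k) v)) -> forall x, N (act x v).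
Proof.
move=> N0 Nlin NB; apply: malg_ind => [|mu x y Nx Ny|k].
- by rewrite act0l.
- by rewrite act_linearl; apply: Nlin.
- exact: NB.
Qed.

Definition gen_degree k : int := match k with Lg n | Ig n => n | _ => 0 end.

Lemma thv_br_L0 k : thv_br F (Lg 0) k = (gen_degree k)%:~R *: B k.
Proof.
case: k => [n|n|||]; rewrite /thv_br /gen_degree ?mulr0z ?scale0r // add0r.
  by rewrite subr0 !mulr0 scale0r addr0.
by rewrite mulr0 scale0r addr0.
Qed.

Lemma weight_act mu k v : weight_space mu v ->
  weight_space (mu + (gen_degree k)%:~R) (act (B k) v).
Proof.
rewrite /weight_space /= => wv; have := act_br (Lg 0) k v.
rewrite thv_br_L0 actZl wv actZr scalerDl => ->.
by rewrite addrCA subrr addr0.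
Qed.

Lemma weightZ mu c v : weight_space mu v -> weight_space mu (c *: v).
Proof. by rewrite /weight_space /= actZr => ->; rewrite !scalerA mulrC. Qed.

Definition weight_part (Q : F -> Prop) : set V := [set v | exists s : seq V,
  (forall u, u \in s -> exists2 mu,
    Q mu & weight_space mu u) /\ v = \sum_(u <- s) u].

Lemma weight_part0 Q : weight_part Q 0.
Proof. by exists [::]; rewrite big_nil. Qed.

Lemma weight_part_lin Q mu u v :
  weight_part Q u -> weight_part Q v -> weight_part Q (mu *: u + v).
Proof.
move=> [s [sQ ->]] [s' [s'Q ->]]; exists ([seq mu *: w | w <- s] ++ s'); split.
  move=> w; rewrite mem_cat => /orP[/mapP[w' /sQ[nu Qnu wnu] ->]|/s'Q //].
  by exists nu => //; apply: weightZ.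
by rewrite big_cat big_map scaler_sumr.
Qed.

Lemma weight_partW (Q : F -> Prop) mu v : Q mu -> weight_space mu v ->
  weight_part Q v.
Proof.
move=> Qmu wv; exists [:: v]; rewrite big_seq1; split=> // u.
by rewrite inE => /eqP ->; exists mu.
Qed.

Lemma weight_part_sum Q (I : eqType) (r : seq I) (f : I -> V) :
  (forall t, t \in r -> weight_part Q (f t)) -> weight_part Q (\sum_(t <- r) f
    t).
Proof.
move=> fQ; rewrite big_seq; apply: big_ind => //; first exact: weight_part0.
by move=> u v Qu Qv; rewrite -[u]scale1r; apply: weight_part_lin.
Qed.

(** [kill r] is the product of the L(0) - mu for mu in r: it annihilates the weight spaces of weight
    in r and acts on the others by a nonzero scalar. *)
Let shift mu v := act (B (Lg 0)) v - mu *: v.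
Let kill (r : seq F) v := foldr shift v r.

Lemma kill_weight r nu v : weight_space nu v ->
  kill r v = (\prod_(mu <- r) (nu - mu)) *: v.
Proof.
move=> wv; elim: r => [|mu r IH]; first by rewrite big_nil scale1r.
by rewrite /= -/(kill r v) IH /shift actZr wv big_cons !scalerA -scalerBl
  mulrBl mulrC.
Qed.

Lemma kill_sum r (I : Type) (s : seq I) (f : I -> V) :
  kill r (\sum_(t <- s) f t) = \sum_(t <- s) kill r (f t).
Proof.
elim: r => [//|mu r IH]; rewrite /= -/(kill r _) IH /shift act_sumr scaler_sumr.
by rewrite -sumrB.
Qed.

Lemma weight_part_shift Q mu v : weight_part Q v -> weight_part Q (shift mu v).
Proof.
move=> [s [sQ ->]]; rewrite /shift act_sumr scaler_sumr -sumrB.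
apply: weight_part_sum => u /sQ[nu Qnu wu]; apply: (weight_partW Qnu).
by rewrite wu -scalerBl; apply: weightZ.
Qed.

Lemma weight_part_eigen Q mu v : ~ Q mu -> weight_part Q v -> weight_space mu v
  -> v = 0.
Proof.
move=> nQ [s [sQ vE]] wv.
have /choice [nu nuP] : forall u, exists nu,
  u \in s -> Q nu /\ weight_space nu u.
  move=> u; have [/sQ[nu ? ?]|us] := boolP (u \in s); first by exists nu.
  by exists 0.
have : kill (map nu s) v = 0.
  rewrite {1}vE kill_sum big_seq big1 // => u us; have [Qu wu] := nuP u us.
  rewrite (kill_weight _ wu) big_map (big_rem u) //= subrr mul0r scale0r //.
rewrite (kill_weight _ wv) => /eqP;
  rewrite scaler_eq0 big_map => /orP[|/eqP //].
rewrite prodf_seq_eq0 => /hasP[u us]; rewrite /= subr_eq0 => /eqP muE.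
by case: nQ; rewrite muE; case: (nuP u us).
Qed.

(** Being a sum of vectors with weights in Q, v is killed by a product of factors L(0) - mu with mu
    in Q. As v also has only weights outside Q, [weight_part_eigen] strips these factors off one by
    one. *)
Lemma weight_part_disjoint Q v :
  weight_part Q v -> weight_part (fun mu => ~ Q mu) v -> v = 0.
Proof.
move=> [s [sQ vE]].
have /choice [nu nuP] : forall u, exists nu,
  u \in s -> Q nu /\ weight_space nu u.
  move=> u; have [/sQ[nu ? ?]|us] := boolP (u \in s); first by exists nu.
  by exists 0.
have : kill (map nu s) v = 0.
  rewrite {1}vE kill_sum big_seq big1 // => u us; have [Qu wu] := nuP u us.
  by rewrite (kill_weight _ wu) big_map (big_rem u) //= subrr mul0r scale0r.
have : forall mu, mu \in map nu s -> Q mu.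
  by move=> _ /mapP[u us ->]; case: (nuP u us).
elim: (map nu s) v {vE nuP sQ} => [//|mu r IH] v rQ kv nQv.
apply: (IH v) => //; first by move=> mu' r'; apply: rQ; rewrite inE r' orbT.
have nQk : weight_part (fun mu => ~ Q mu) (kill r v).
  elim: r {IH rQ kv} => [//|mu' r IH] /=; exact: weight_part_shift.
apply: (weight_part_eigen _ nQk (mu := mu)).
  by move/(_ (rQ mu (mem_head _ _))).
by move/eqP: kv; rewrite /= subr_eq0 => /eqP.
Qed.

(* The span of the weight vectors of weight in Q and its complementary span are
   submodules with direct sum V as soon as no generator crosses Q. *)
Lemma indecomposable_weights (Q : F -> Prop) :
  indecomposable V -> weight_module V ->
  (forall mu v k, weight_space mu v -> act (B k) v != 0 ->
     Q mu <-> Q (mu + (gen_degree k)%:~R)) ->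
  (forall mu v, Q mu -> weight_space mu v -> v = 0) \/
  (forall mu v, ~ Q mu -> weight_space mu v -> v = 0).
Proof.
move=> [_ indec] wV closedQ.
have sub (P : F -> Prop) : (forall mu v k,
  weight_space mu v -> act (B k) v != 0 ->
     P mu -> P (mu + (gen_degree k)%:~R)) -> submodule (weight_part P).
  move=> cP; split; [exact: weight_part0|exact: weight_part_lin|].
  move=> x v [s [sP ->]]; rewrite act_sumr; apply: weight_part_sum => u us.
  have [mu Pmu wu] := sP u us.
  apply: act_ind; [exact: weight_part0|exact: weight_part_lin|] => k.
  have [->|n0] := eqVneq (act (B k) u) 0; first exact: weight_part0.
  exact: weight_partW (cP _ _ _ wu n0 Pmu) (weight_act k wu).
have part0 (P : F -> Prop) : weight_part P = [set 0] ->
    forall mu v, P mu -> weight_space mu v -> v = 0.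
  by move=> P0 mu v Pmu wv; have : weight_part P v := weight_partW Pmu wv;
    rewrite P0.
have [||||/part0|/part0] := indec (weight_part Q) (weight_part (fun mu => ~ Q
  mu)).
- by apply: sub => mu v k wv n0 /(closedQ _ _ _ wv n0).
- by apply: sub => mu v k wv n0 nQ /(closedQ _ _ _ wv n0).
- apply/seteqP; split=> // v _; have [n [mu [u [wu ->]]]] := wV v.
  exists (\sum_(j < n | `[< Q (mu j) >]) u j).
    rewrite -big_filter; apply: weight_part_sum => j; rewrite mem_filter.
    by case/andP=> /asboolP Qj _; apply: weight_partW Qj (wu j).
  exists (\sum_(j < n | ~~ `[< Q (mu j) >]) u j);
    last by rewrite [RHS](bigID (fun j : 'I_n => `[< Q (mu j) >])).
  rewrite -big_filter; apply: weight_part_sum => j; rewrite mem_filter.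
  by case/andP=> /asboolPn Qj _; apply: weight_partW Qj (wu j).
- apply/seteqP; split=> [v [/= Qv nQv]|_ ->];
  first exact: weight_part_disjoint Qv nQv.
  by split; apply: weight_part0.
- by left.
- by right.
Qed.

(** In place of a Vandermonde determinant: L(0) - (a + t0) removes the term of index t0 and
    multiplies each other one by t - t0, which is nonzero. *)
Lemma graded_subspace (N : set V) (a : F) (e : int -> V) (c : int -> F) (r :
  seq int) :
  N 0 -> (forall mu u v, N u -> N v -> N (mu *: u + v)) ->
  (forall v, N v -> N (act (B (Lg 0)) v)) ->
  (forall t, weight_space (a + t%:~R) (e t)) -> uniq r ->
  N (\sum_(t <- r) c t *: e t) -> forall t, t \in r -> N (c t *: e t).
Proof.
move=> N0 Nlin NL we; elim: r c => [//|t0 r IH] c /=/andP[t0r ur].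
rewrite big_cons => Nv.
have NZ mu v : N v -> N (mu *: v) by move=> Nv'; rewrite -[_ *: _]addr0;
  apply: Nlin.
have Nr t : t \in r -> N (c t *: e t).
  move=> tr; have tt0 : (t - t0)%:~R != 0 :> F.
    by rewrite intr_eq0 subr_eq0; apply: contraNneq t0r => <-.
  have -> : c t *: e t = (t - t0)%:~R^-1 *: (((t - t0)%:~R * c t) *: e t).
    by rewrite scalerA mulKf.
  apply: NZ; apply: (IH (fun k : int => (k - t0)%:~R * c k) ur _ t tr).
  have -> : \sum_(k <- r) ((k - t0)%:~R * c k) *: e k = - (a + t0%:~R) *:
      (c t0 *: e t0 + \sum_(k <- r) c k *: e k) + act (B (Lg 0))
      (c t0 *: e t0 + \sum_(k <- r) c k *: e k).
    rewrite actDr actZr we act_sumr scalerDr addrACA scalerA scalerA -scalerDl.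
    rewrite (_ : - _ * _ + _ = 0) ?scale0r ?add0r; last by ring.
    rewrite scaler_sumr -big_split; apply: eq_bigr => u _ /=.
    rewrite actZr we !scalerA -scalerDl; congr (_ *: _); ring.
  by apply: Nlin => //; apply: NL.
move=> t; rewrite inE => /orP[/eqP ->|]; last exact: Nr.
rewrite -[X in N X](addrK (\sum_(k <- r) c k *: e k)) addrC -scaleN1r.
apply: (Nlin) => //; rewrite big_seq; apply: big_ind => // u v Nu Nv'.
by rewrite -[u]scale1r; apply: Nlin.
Qed.

End ModuleBasics.

(** * Homomorphisms out of the modules with basis v_t *)

Section Isomorphisms.
Variable F : numClosedFieldType.

Lemma module_iso_of_bijection (X V : lieModule (thv F)) (f : X -> V) :
  module_hom f -> injective f -> (forall v, exists x,
    f x = v) -> module_iso V X.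
Proof.
move=> [flin fact] finj /choice[h hK]; exists h; split; last first.
  by exists f => [v|x]; [exact: hK|apply: finj; rewrite hK].
split=> [a u v|x v]; apply: finj; first by rewrite flin !hK.
by rewrite fact !hK.
Qed.

Section FromBasis.
Variables (V : lieModule (thv F)) (a : F) (e : int -> V).
Variables (ell iota : int -> int -> F) (ax : graded_axiom ell iota).
Hypothesis weight_e : forall t, weight_space (a + t%:~R) (e t).
Hypothesis L_e : forall n t, act (thv_basis F (Lg n)) (e t) = ell n t *: e (n +
  t).
Hypothesis I_e : forall n t, act (thv_basis F (Ig n)) (e t) = iota n t *: e (n
  + t).
Hypothesis C_e : forall k t, k \in [:: CL; CI;
  CLI] -> act (thv_basis F k) (e t) = 0.
Hypothesis span_e : forall N : set V, N 0 ->
  (forall mu u v, N u -> N v -> N (mu *: u + v)) -> (forall t, N (e t)) ->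
  forall v, N v.

Let f : graded_module ax -> V := lext e.

Lemma lext_act (x : thv F) (v : {malg F[int]}) :
  lext e (graded_act ell iota x v) = act x (lext e v).
Proof.
elim/malg_ind: v => [|mu u v Hu Hv|t].
- by rewrite graded_act0r linear0 act0r.
- by rewrite graded_act_linearr !linearP /= Hu Hv actDr actZr.
rewrite lextU; elim/malg_ind: x => [|mu x y Hx Hy|k].
- by rewrite graded_act0l linear0 act0l.
- by rewrite graded_act_linearl linearP /= Hx Hy act_linearl.
rewrite graded_actE; case: k => [n|n|||] /=;
  rewrite ?linearZ ?linear0 /= ?lextU.
- by rewrite -L_e.
- by rewrite -I_e.
- by rewrite -[RHS]/(act (thv_basis F CL) _) C_e.
- by rewrite -[RHS]/(act (thv_basis F CI) _) C_e.
- by rewrite -[RHS]/(act (thv_basis F CLI) _) C_e.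
Qed.

Lemma lext_hom : module_hom f.
Proof. by split; [exact: lext_linear|exact: lext_act]. Qed.

Lemma lext_surjective v : exists x, f x = v.
Proof.
have flin : linear f by apply: lext_linear.
move: v; apply: span_e => [|mu u v [x <-] [y <-]|t].
- by exists 0; have := flin (-1) 0 0; rewrite scaler0 add0r scaleN1r addNr.
- by exists (mu *: x + y); rewrite flin.
- by exists << t >>; rewrite /f lextU.
Qed.

Lemma lext_subspace (N : set V) (x : {malg F[int]}) : N 0 ->
  (forall mu u v, N u -> N v -> N (mu *: u + v)) ->
  (forall v, N v -> N (act (thv_basis F (Lg 0)) v)) ->
  N (lext e x) -> forall t, t \in msupp x -> N (x@_t *: e t).
Proof.
move=> N0 Nlin NL; rewrite lext.unlock => Nx.
exact: graded_subspace N0 Nlin NL weight_e (fset_uniq _) Nx.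
Qed.

Lemma lext_injective : (forall t, e t != 0) -> injective f.
Proof.
move=> e0 x y xy; apply/eqP; rewrite -subr_eq0; apply/eqP.
have flin : linear f by apply: lext_linear.
have z0 : f (x - y) = 0.
  by rewrite addrC -scaleN1r flin xy scaleN1r addNr.
apply/malgP => t; rewrite mcoeff0.
have [tz|tz] := boolP (t \in msupp (x - y)); last exact: mcoeff_outdom.
have := @lext_subspace [set 0] (x - y) erefl _ _ z0 t tz.
move=> H; have /eqP : (x - y)@_t *: e t = 0.
  apply: H => [mu u v -> ->|v ->]; first by rewrite scaler0 addr0.
  exact: act0r.
by rewrite scaler_eq0 (negPf (e0 t)) orbF => /eqP.
Qed.

End FromBasis.
End Isomorphisms.

(** * The table of scalars of a module of the intermediate series *)

Section StructureConstants.
Variables (F : numClosedFieldType) (V : lieModule (thv F)).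
Hypothesis hV : intermediate_series V.

Local Notation B k := (thv_basis F k).

(** The representative [a] of the weight coset is taken to be 0 when the coset is Z, so that a
    weight 0 can only have index 0. *)
Lemma weight_vector_exists : exists a (t : int) (v : V),
  [/\ v != 0, weight_space (a + t%:~R) v & a = 0 \/ forall t : int,
    a + t%:~R != 0].
Proof.
have [[_ wV _] [x [v xv]] dim1] := hV.
have [n [mu [u [wu vE]]]] := wV v.
have [j uj] : exists j, u j != 0.
  apply: contrapT => no; case/negP: xv; rewrite vE big1 ?act0r // => j _.
  by apply/eqP/negPn/negP => uj; apply: no; exists j.
have [[t /eqP mt]|no] := pselect (exists t : int, mu j + t%:~R == 0);
  last first.
  exists (mu j), 0, (u j); rewrite addr0; split=> //; right=> t;
    apply/negP => mt.
  by apply: no; exists t.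
exists 0, (- t), (u j); split=> //; last by left.
by rewrite (_ : 0 + _ = mu j) //; lc1 (-1 : F) mt.
Qed.

(** [e t] is 0 exactly when a + t is not a weight; the support used below is the set of t with [e t]
    nonzero. *)
Lemma weight_basis_exists a : exists e : int -> V,
  (forall t, weight_space (a + t%:~R) (e t)) /\
  (forall t v, weight_space (a + t%:~R) v -> exists c, v = c *: e t).
Proof.
have [_ _ dim1] := hV.
have /choice[e eP] : forall t : int, exists v : V, weight_space (a + t%:~R) v /\
    forall w, weight_space (a + t%:~R) w -> exists c, w = c *: v.
  move=> t; have [e [we eE]] := dim1 (a + t%:~R); exists (e ord0);
    split=> // w ww.
  by have [c ->] := eE w ww; exists (c ord0); rewrite big_ord1.
by exists e; split=> t; case: (eP t).
Qed.

Section Scalars.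
Variables (a : F) (e : int -> V) (p : int).
Hypothesis weight_e : forall t, weight_space (a + t%:~R) (e t).
Hypothesis line_e : forall t v, weight_space (a + t%:~R) v -> exists c,
  v = c *: e t.
Hypothesis e_p : e p != 0.

Let s t := e t != 0.

Lemma weight_coset mu (v : V) : v != 0 -> weight_space mu v ->
  exists2 t : int, mu = a + t%:~R & exists c, v = c *: e t.
Proof.
move=> v0 wv; have [[ind wV _] _ _] := hV.
suff [t muE] : exists t : int, mu = a + t%:~R.
  by exists t => //; apply: line_e; rewrite -muE.
have [|none|H] := indecomposable_weights (Q := fun mu => exists t : int,
  mu = a + t%:~R) ind wV.
- move=> nu u k _ _; split=> [[t ->]|[t tE]].
    by exists (t + gen_degree k); rewrite intrD addrA.
  by exists (t - gen_degree k); rewrite intrB addrA -tE addrK.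
- by case/eqP: e_p; apply: none (weight_e p); exists p.
- by apply: contrapT => nQ; case/eqP: v0; apply: H wv.
Qed.

Lemma span_e (N : set V) : N 0 ->
  (forall mu u v, N u -> N v -> N (mu *: u + v)) -> (forall t, N (e t)) ->
  forall v, N v.
Proof.
move=> N0 Nlin Ne v; have [[_ wV _] _ _] := hV;
  have [n [mu [u [wu ->]]]] := wV v.
apply: big_ind => // [x y Nx Ny|j _]; first by rewrite -[x]scale1r; apply: Nlin.
have [->//|uj] := eqVneq (u j) 0.
have [t _ [c ->]] := weight_coset uj (wu j).
by rewrite -[_ *: _]addr0; apply: Nlin.
Qed.

Lemma scalars_exist : exists sc : thv_gen -> int -> F,
  (forall k t, act (B k) (e t) = sc k t *: e (gen_degree k + t)) /\
  forall k t, sc k t != 0 -> s t && s (gen_degree k + t).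
Proof.
have /choice[sc scP] : forall kt : thv_gen * int, exists c : F,
    act (B kt.1) (e kt.2) = c *: e (gen_degree kt.1 + kt.2) /\
    (c != 0 -> s kt.2 && s (gen_degree kt.1 + kt.2)).
  move=> [k t] /=; have [st|] := boolP (s t && s (gen_degree k + t)).
    have := weight_act k (weight_e t).
    rewrite -addrA -intrD (addrC t) => /line_e[c cE].
    by exists c.
  (* If an end of the arrow is the zero vector the scalar is arbitrary; the choice 0 confines the
     nonzero scalars to the support. *)
  rewrite negb_and /s !negbK => st; exists 0; rewrite eqxx; split=> //.
  rewrite scale0r; case/orP: st => /eqP z; first by rewrite z act0r.
  have := weight_act k (weight_e t).
  by rewrite -addrA -intrD (addrC t) => /line_e[c ->]; rewrite z scaler0.
by exists (fun k t => sc (k, t)); split=> k t; case: (scP (k, t)).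
Qed.

Variable sc : thv_gen -> int -> F.
Hypothesis sc_act : forall k t,
  act (B k) (e t) = sc k t *: e (gen_degree k + t).
Hypothesis sc_supp : forall k t, sc k t != 0 -> s t && s (gen_degree k + t).

Lemma sc_indecomposable (Q : int -> bool) :
  (forall n t, (sc (Lg n) t != 0) || (sc (Ig n) t != 0) -> Q t = Q (n + t)) ->
  (forall t, s t -> Q t) \/ (forall t, s t -> ~~ Q t).
Proof.
move=> cQ; have [[ind wV _] _ _] := hV.
pose QQ (mu : F) := exists2 t : int, mu = a + t%:~R & Q t.
have QQE t : QQ (a + t%:~R) <-> Q t.
  by split=> [[u /addrI/intr_inj ->] //|Qt]; exists t.
have [mu u k wu ku|none|all0] := indecomposable_weights (Q := QQ) ind wV.
- have u0 : u != 0 by apply: contraNneq ku => ->; rewrite act0r.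
  have [t -> [c uE]] := weight_coset u0 wu.
  have sk : sc k t != 0.
    by apply: contraNneq ku => z; rewrite uE actZr sc_act z scale0r scaler0.
  rewrite -addrA -intrD !QQE; case: k ku sk => [n|n|||] _ sk /=;
    rewrite ?addr0 //.
    by rewrite addrC -cQ ?sk.
  by rewrite addrC -cQ ?sk ?orbT.
- right=> t; apply: contraNN => Qt; apply/eqP.
  by apply: (none _ _ _ (weight_e t)); apply/QQE.
- left=> t st; apply/negPn/negP => nQt; case/eqP: st.
  by apply: all0 (weight_e t); rewrite QQE; apply/negP.
Qed.

(** A central element has the same scalar at both ends of every nonzero arrow, so no arrow leaves
    the set of indices where this scalar is the one at [p]. This also covers I(0). *)
Lemma sc_central k : gen_degree k = 0 -> (forall j, thv_br F k j = 0) ->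
  exists c, forall t, s t -> sc k t = c.
Proof.
move=> k0 kj; have comm j t : sc j t != 0 -> sc k t = sc k (gen_degree j + t).
  move=> sj; have /andP[_ st] := sc_supp sj.
  have := act_br k j (e t); rewrite kj act0l !sc_act !actZr !sc_act k0 !add0r.
  rewrite !scalerA -scalerBl => /esym/eqP; rewrite scaler_eq0 (negPf st) orbF.
  by rewrite mulrC -mulrBl mulf_eq0 (negPf sj) orbF subr_eq0 => /eqP.
exists (sc k p); have [n t|H|H] := sc_indecomposable (Q := fun t => sc k t ==
  sc k p).
- case/orP=> /comm /= -> //.
- by move=> t /H/eqP.
- by have := H p e_p; rewrite eqxx.
Qed.

Lemma sc_coef_eq (x y : F) t : x *: e t = y *: e t -> (~~ s t -> x = y) -> x =
  y.
Proof.
move=> xy; have [st _|_ ->//] := boolP (s t).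
by apply/eqP; rewrite -subr_eq0; move/eqP: xy;
  rewrite -subr_eq0 -scalerBl scaler_eq0 (negPf st) orbF.
Qed.

Lemma sc_bracket j k t T : gen_degree j + (gen_degree k + t) = T ->
  act (thv_br F j k : thv F) (e t) =
  (sc k t * sc j (gen_degree k + t) - sc j t * sc k (gen_degree j + t)) *: e T.
Proof.
move=> <-; rewrite act_br !sc_act !actZr !sc_act !scalerA scalerBl.
by rewrite (addrCA (gen_degree k)).
Qed.

Lemma sc0r k t u : gen_degree k + t = u -> ~~ s u -> sc k t = 0.
Proof.
move=> <- st; apply/eqP/negPn/negP => /sc_supp.
by rewrite (negPf st) andbF.
Qed.

Lemma delta_e m n t (c : F) :
  ((m + n == 0 :> int)%:R * c) *: e t = ((m + n == 0 :> int)%:R * c) *: e (m +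
    n + t).
Proof. by have [->|_] := eqVneq (m + n) 0;
  rewrite ?add0r // mul0r !scale0r. Qed.

Lemma sc_data : exists c1 c2 c3,
  thv_data s a (fun n => sc (Lg n)) (fun n => sc (Ig n)) c1 c2 c3
  /\ forall t, s t -> [/\ sc CL t = c1, sc CI t = c2 & sc CLI t = c3].
Proof.
have [c1 CE] : exists c, forall t,
  s t -> sc CL t = c by apply: sc_central => // -[].
have [c2 CIE] : exists c, forall t,
  s t -> sc CI t = c by apply: sc_central => // -[].
have [c3 CLIE] : exists c, forall t,
  s t -> sc CLI t = c by apply: sc_central => // -[].
have delta0 m n t : s t -> ~~ s (m + n + t) -> (m + n == 0)%:R = 0 :> F.
  by move=> st; have [->|//] := eqVneq (m + n) 0; rewrite add0r st.
exists c1, c2, c3; split; last by move=> t st; rewrite CE ?CIE ?CLIE.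
split.
- split.
  + by move=> n t /sc_supp.
  + move=> t st; apply: (@sc_coef_eq _ _ t); last by rewrite st.
    by have := sc_act (Lg 0) t; rewrite /= add0r => <-; apply: weight_e.
  + move=> m n t st; apply: (@sc_coef_eq _ _ (m + n + t)).
      rewrite -(@sc_bracket (Lg m) (Lg n)) /=; last by rewrite addrA.
      rewrite actDl !actZl -![act << _ >> _]/(act (B _) _) !sc_act /= add0r CE
        //.
      by rewrite scalerDl !scalerA -mulrA delta_e.
    move=> sT.
    have z1 : sc (Lg m) (n + t) = 0 by apply: (sc0r _ sT); rewrite /= addrA.
    have z2 : sc (Lg n) (m + t) = 0 by apply: (sc0r _ sT);
      rewrite /= addrCA addrA.
    have z3 : sc (Lg (m + n)) t = 0 by apply: (sc0r _ sT).
    by rewrite z1 z2 z3 (delta0 _ _ _ st sT); ring.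
- by move=> n t /sc_supp.
- move=> m n t st; apply: (@sc_coef_eq _ _ (m + n + t)).
    rewrite -(@sc_bracket (Lg m) (Ig n)) /=; last by rewrite addrA.
    rewrite actDl !actZl -![act << _ >> _]/(act (B _) _) !sc_act /= add0r CLIE
      //.
    by rewrite scalerDl !scalerA -mulrA delta_e.
  move=> sT.
  have z1 : sc (Lg m) (n + t) = 0 by apply: (sc0r _ sT); rewrite /= addrA.
  have z2 : sc (Ig n) (m + t) = 0 by apply: (sc0r _ sT);
    rewrite /= addrCA addrA.
  have z3 : sc (Ig (m + n)) t = 0 by apply: (sc0r _ sT).
  by rewrite z1 z2 z3 (delta0 _ _ _ st sT); ring.
- move=> m n t st; apply: (@sc_coef_eq _ _ (m + n + t)).
    rewrite -(@sc_bracket (Ig m) (Ig n)) /=; last by rewrite addrA.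
    rewrite !actZl -![act << _ >> _]/(act (B _) _) !sc_act /= add0r CIE //.
    by rewrite !scalerA -!mulrA ![n%:~R * _]mulrCA delta_e.
  move=> sT.
  have z1 : sc (Ig m) (n + t) = 0 by apply: (sc0r _ sT); rewrite /= addrA.
  have z2 : sc (Ig n) (m + t) = 0 by apply: (sc0r _ sT);
    rewrite /= addrCA addrA.
  by rewrite z1 z2 (delta0 _ _ _ st sT); ring.
- apply: sc_central => // -[n|n|||] //=.
    rewrite ?mulr0z ?oppr0 ?scale0r ?add0r.
    by have [->|_] := eqVneq n 0; rewrite ?mul0r ?mulr0 ?oppr0 ?scale0r.
  by rewrite add0r; have [->|_] := eqVneq n 0; rewrite ?mul0r ?mulr0 ?scale0r.
Qed.

End Scalars.
End StructureConstants.

(** * The classification for modules *)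

Section MainTheorem.
Variable F : numClosedFieldType.

Local Notation B k := (thv_basis F k).

Lemma module_iso_refl (V : lieModule (thv F)) : module_iso V V.
Proof. by exists id; split=> //; exists id. Qed.

(* Here [e 0 = 0], so [lext e] maps A_{0,0,0} onto V with kernel spanned by v_0. *)
Lemma punctured_module (V : lieModule (thv F)) (e : int -> V) :
  intermediate_series V ->
  (forall t, weight_space (0 + t%:~R) (e t)) -> (forall t,
    (e t != 0) = (t != 0)) ->
  (forall n t, act (B (Lg n)) (e t) = tU_ell F n t *: e (n + t)) ->
  (forall n t, act (B (Ig n)) (e t) = 0) ->
  (forall k t, k \in [:: CL; CI; CLI] -> act (B k) (e t) = 0) ->
  (forall N : set V, N 0 -> (forall mu u v, N u -> N v -> N (mu *: u + v)) ->
     (forall t, N (e t)) -> forall v, N v) ->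
  iso_to_nontrivial_simple_subquotient V (mod_A 0 0 0).
Proof.
move=> [_ ntV _] we e0 Le Ie Ce span.
have e00 : e 0 = 0 by apply/eqP/negPn; rewrite e0.
have LA n t : act (B (Lg n)) (e t) = A_ell 0 0 n t *: e (n + t).
  rewrite Le /tU_ell /A_ell; case: eqVneq => [->|_] /=;
    first by rewrite e00 !scaler0.
  by congr (_ *: _); ring.
have IA n t : act (B (Ig n)) (e t) = A_iota 0 n t *: e (n + t).
  by rewrite Ie scale0r.
have hom := lext_hom (A_axiom 0 0 0) LA IA Ce.
have surj := lext_surjective (A_axiom 0 0 0) span.
exists V; split=> //; last exact: module_iso_refl.
  exists (mod_A 0 0 0), id, (lext e); split=> //.
split=> [|N [N0 Nlin Nact]].
  by exists (e 1); rewrite e0.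
have [[v [Nv v0]]|triv] := pselect (exists v, N v /\ v != 0); last first.
  left; apply/seteqP; split=> [v Nv|_ ->] //=.
  by apply/eqP/negPn/negP => v0; apply: triv; exists v.
right; apply/seteqP; split=> // w _; apply: span => // t.
have NZ mu u : N u -> N (mu *: u) by move=> Nu; rewrite -[_ *: _]addr0;
  apply: Nlin.
have [x xv] := surj v.
have [k [kx ek]] : exists k, k \in msupp x /\ x@_k *: e k != 0.
  apply: contrapT => no; case/eqP: v0;
    rewrite -xv lext.unlock big_seq big1 // => k kx.
  by apply/eqP/negPn/negP => xk; apply: no; exists k.
have Nk : N (e k).
  have := lext_subspace we N0 Nlin (Nact _) _ kx; rewrite xv => /(_ Nv) Nxk.
  have xk : x@_k != 0 by apply: contraNneq ek => ->; rewrite scale0r.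
  by rewrite -[e k](scalerK xk); apply: NZ.
have k0 : k != 0 by rewrite -e0; apply: contraNneq ek => ->; rewrite scaler0.
have [->|t0] := eqVneq t 0; first by rewrite e00.
(* L(t - k) e_k = k e_t with k nonzero: any single line generates the module. *)
have := Nact (B (Lg (t - k))) _ Nk; rewrite Le /tU_ell subrK t0 => Nt.
have kF : k%:~R != 0 :> F by rewrite intr_eq0.
by rewrite -[e t](scalerK kF); apply: NZ.
Qed.

Lemma intermediate_series_listed (V : lieModule (thv F)) : intermediate_series
  V ->
  exists2 X : lieModule (thv F), listed X &
    module_iso V X \/ iso_to_nontrivial_simple_subquotient V X.
Proof.
move=> hV; have [a [p [v [v0 wv a_int]]]] := weight_vector_exists hV.
have [e [we line]] := weight_basis_exists hV a.
have ep : e p != 0.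
  by have [c vE] := line p v wv; apply: contraNneq v0; rewrite vE => ->;
    rewrite scaler0.
have [sc [sc_act sc_supp]] := scalars_exist we line.
have [c1 [c2 [c3 [D ctr]]]] := sc_data hV we line ep sc_act sc_supp.
have span := span_e hV we line ep.
have indec := sc_indecomposable hV we line ep sc_act.
have [[z1 z2 z3] cases] := data_classification D ep a_int indec.
have Ce k t : k \in [:: CL; CI; CLI] -> act (B k) (e t) = 0.
  move=> kC; have [->|et] := eqVneq (e t) 0; first exact: act0r.
  have [E1 E2 E3] := ctr t et; rewrite sc_act; move: kC.
  by rewrite !inE => /or3P[]/eqP ->; rewrite ?E1 ?E2 ?E3 ?z1 ?z2 ?z3 scale0r.
case: cases => [triv|[full [ell [iota [ax [d [X d0 lE iE]]]]]]|[a0 sE iz [d d0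
  lE]]].
- have [_ [x [w /eqP xw]] _] := hV; case: xw;
  apply: (span [set u | act x u = 0]) => /=.
  + exact: act0r.
  + by move=> mu u u' Hu Hu'; rewrite act_linearr Hu Hu' scaler0 addr0.
  + move=> t; apply: (act_ind (N := [set 0])) => //= [mu u u' -> ->|k].
      by rewrite scaler0 addr0.
    case: k => [n|n|||]; try exact: Ce.
      by rewrite sc_act; have [-> _] := triv n t; rewrite scale0r.
    by rewrite sc_act; have [_ ->] := triv n t; rewrite scale0r.
- exists (graded_module ax) => //; left; pose e' t := d t *: e t.
  have gauge k n t : sc k t * d t / d (n + t) *: e' (n + t) = (sc k t * d t) *:
    e (n + t).
    by rewrite /e' scalerA divfK.
  have we' t : weight_space (a + t%:~R) (e' t) by apply: weightZ.
  have Le n t : act (B (Lg n)) (e' t) = ell n t *: e' (n + t).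
    by rewrite -lE gauge /e' actZr sc_act scalerA mulrC.
  have Ie n t : act (B (Ig n)) (e' t) = iota n t *: e' (n + t).
    by rewrite -iE gauge /e' actZr sc_act scalerA mulrC.
  have Ce' k t : k \in [:: CL; CI; CLI] -> act (B k) (e' t) = 0.
    by move=> kC; rewrite /e' actZr Ce ?scaler0.
  have span' (N : set V) : N 0 -> (forall mu u v,
    N u -> N v -> N (mu *: u + v)) ->
      (forall t, N (e' t)) -> forall v, N v.
    move=> N0 Nlin Ne'; apply: span => // t.
    rewrite -[e t](scalerK (d0 t)) -[_ *: _]addr0.
    by apply: Nlin => //; apply: Ne'.
  apply: (module_iso_of_bijection (lext_hom ax Le Ie Ce')).
    apply: (lext_injective we') => t; rewrite scaler_eq0 negb_or d0;
      exact: full.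
  exact: lext_surjective ax span'.
exists (mod_A 0 0 0); first exact: listed_A.
right; rewrite a0 in we; pose e' t := d t *: e t.
apply: (@punctured_module V e') => //.
- by move=> t; apply: weightZ.
- by move=> t; rewrite /e' scaler_eq0 (negPf (d0 t)); apply: sE.
- by move=> n t; rewrite -lE /rescale /e' actZr sc_act !scalerA divfK // mulrC.
- by move=> n t; rewrite /e' actZr sc_act iz scale0r scaler0.
- by move=> k t kC; rewrite /e' actZr Ce ?scaler0.
- move=> N N0 Nlin Ne'; apply: span => // t.
  rewrite -[e t](scalerK (d0 t)) -[_ *: _]addr0.
    by apply: Nlin => //; apply: Ne'.
Qed.

End MainTheorem.

Lemma module_iso_simple (F : fieldType) (g : lieAlgType F) (V X : lieModule g) :
  module_iso V X -> simple V -> simple X.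
Proof.
move=> [f [[flin fact] [h fK hK]]] [[v v0] simpV].
have f0 : f 0 = 0 by have := flin (-1) 0 0;
  rewrite scaler0 add0r scaleN1r addNr.
split; first by exists (f v); apply: contraNneq v0 => fv;
  rewrite -(fK v) fv -f0 fK.
move=> N [N0 Nlin Nact]; have [|E|E] := simpV [set u | N (f u)].
- split=> /=; first by rewrite f0.
    by move=> mu u w Nu Nw; rewrite flin; apply: Nlin.
  by move=> x u Nu; rewrite fact; apply: Nact.
- left; apply/seteqP; split=> [x Nx|_ ->] //=.
  have : [set u | N (f u)] (h x) by rewrite /= hK.
  by rewrite E /= => hx; rewrite -(hK x) hx f0.
- right; apply/seteqP; split=> // x _.
  by have : [set u | N (f u)] (h x); [rewrite E|rewrite /= hK].
Qed.

(** The second part makes the proviso on irreducibility precise: for simple V the listed module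
    isomorphic to it is simple too, as simplicity passes along the isomorphism. *)
Theorem theorem3p6 (R : realType) (V : lieModule (thv R[i]))
    (hV : intermediate_series V) :
  (exists2 X : lieModule (thv R[i]), listed X &
     module_iso V X \/ iso_to_nontrivial_simple_subquotient V X)
  /\
  (simple V ->
   exists2 X : lieModule (thv R[i]), listed X &
     (simple X /\ module_iso V X)
     \/ iso_to_nontrivial_simple_subquotient V X).
Proof.
have [X lX isoX] := @intermediate_series_listed R[i] V hV.
split=> [|simpV]; exists X => //; case: isoX => iso; [left|right] => //.
by split=> //; apply: module_iso_simple iso simpV.
Qed.
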